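(* Let $(E,\theta)$ be a regular semisimple Higgs bundle on a smooth complex projective curve $X$, with smooth spectral curve $\pi\colon Y\to X$ and spectral line bundle $L$. Assume that the discriminant divisor $\Delta\subset X$ is reduced. Let $$k\colon\Omega_X^1\hookrightarrow\Omega_X^1(\log\Delta),\qquad q\colon\mathcal{Z}_\theta\hookrightarrow\mathrm{End}(E)$$ be the natural inclusions, where $\mathcal{Z}_\theta$ is the regularized centralizer sheaf of $\theta$. Then the logarithmic spectral Atiyah class $$\mathrm{At}^{\log}_\theta(E)\in H^1\bigl(X,\Omega_X^1(\log\Delta)\otimes\mathcal{Z}_\theta\bigr)$$ satisfies $$(k\otimes\mathrm{id}_{\mathrm{End}(E)})_*\mathrm{At}(E)=(\mathrm{id}\otimes q)_*\mathrm{At}^{\log}_\theta(E)\qquad\text{in } H^1\bigl(X,\Omega_X^1(\log\Delta)\otimes\mathrm{End}(E)\bigr).$$ Consequently, after restriction along $j\colon X^\circ:=X\setminus\Delta\hookrightarrow X$, one has $$(\mathrm{id}\otimes q^\circ)_*j^*\mathrm{At}^{\log}_\theta(E)=(\mathrm{id}\otimes m^\circ)_*\beta^\circ_{\mathrm{spec}}(L,\pi)=j^*\mathrm{At}(E)$$ in $H^1\bigl(X^\circ,\Omega^1_{X^\circ}\otimes\mathrm{End}(E|_{X^\circ})\bigr)$, where $q^\circ\colon\mathcal{Z}_\theta|_{X^\circ}\hookrightarrow\mathrm{End}(E|_{X^\circ})$ is the restricted inclusion.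
   Context: Higgs and spectral data. A Higgs bundle $(E,\theta)$ on $X$ is a vector bundle $E$ with an $\mathcal{O}_X$-linear map $\theta\colon E\to E\otimes\Omega_X^1$. Regular semisimple means that $\theta$ has pairwise distinct eigenvalues generically, i.e. the discriminant of its characteristic polynomial is not identically zero. The spectral curve $Y\subset\mathrm{Tot}(\Omega_X^1)$ is the zero scheme of the characteristic polynomial of $\theta$, assumed smooth; $\pi\colon Y\to X$ is the (finite) projection. By the Beauville–Narasimhan–Ramanan correspondence there is a line bundle $L$ on $Y$ (the spectral line bundle) with $E\cong\pi_*L$, such that $\theta$ is the pushforward of multiplication by the tautological section of $\pi^*\Omega_X^1$ on $Y$. $\Delta$ is the scheme-theoretic discriminant divisor of $\pi$, i.e. the branch divisor defined by the zeroth Fitting ideal of $\pi_*\Omega^1_{Y/X}$; it agrees with the divisor cut out by the discriminant of the characteristic polynomial. Put $X^\circ=X\setminus\Delta$, $Y^\circ=\pi^{-1}(X^\circ)$, $\pi^\circ=\pi|_{Y^\circ}\colon Y^\circ\to X^\circ$, which is finite étale. Atiyah classes. For a vector bundle $F$ on a smooth complex curve $C$, $\mathrm{At}(F)\in\mathrm{Ext}^1_C(F,\Omega_C^1\otimes F)\cong H^1(C,\Omega_C^1\otimes\mathrm{End}(F))$ is the extension class of the first jet sequence $0\to\Omega_C^1\otimes F\to J_C^1(F)\to F\to0$ ($J_C^1(F)$ the bundle of first-order jets, $\mathrm{End}(F)$ the endomorphism sheaf). For a line bundle it lies in $H^1(C,\Omega_C^1)$. Multiplication map and regularized centralizer. $m\colon\pi_*\mathcal{O}_Y\to\mathrm{End}(E)$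 is the action of $\pi_*\mathcal{O}_Y$ on $E\cong\pi_*L$ by multiplication, and $m^\circ$ is its restriction to $X^\circ$. The regularized centralizer sheaf $\mathcal{Z}_\theta\subset\mathrm{End}(E)$ is the saturation of $m(\pi_*\mathcal{O}_Y)$ in $\mathrm{End}(E)$: $$\mathcal{Z}_\theta=\ker\Bigl(\mathrm{End}(E)\to\bigl(\mathrm{End}(E)/m(\pi_*\mathcal{O}_Y)\bigr)/\text{torsion}\Bigr).$$ Scalar form on the étale locus. With $L^\circ=L|_{Y^\circ}$, $\beta^\circ_{\mathrm{spec}}(L,\pi)\in H^1(X^\circ,\Omega^1_{X^\circ}\otimes\pi^\circ_*\mathcal{O}_{Y^\circ})$ is the class corresponding to $\mathrm{At}(L^\circ)\in H^1(Y^\circ,\Omega^1_{Y^\circ})$ under $H^1(Y^\circ,\Omega^1_{Y^\circ})\cong H^1(Y^\circ,\pi^{\circ*}\Omega^1_{X^\circ})\cong H^1(X^\circ,\Omega^1_{X^\circ}\otimes\pi^\circ_*\mathcal{O}_{Y^\circ})$ (étale identification of differentials, finiteness of $\pi^\circ$ and projection formula). Logarithmic spectral Atiyah class. Since $\Delta$ is reduced, there is a unique morphism $$\lambda_\pi\colon\pi_*\Omega_Y^1\to\Omega_X^1(\log\Delta)\otimes\pi_*\mathcal{O}_Y$$ whose restriction to $X^\circ$ is the étale identification $\pi^\circ_*\Omega^1_{Y^\circ}\cong\Omega^1_{X^\circ}\otimes\pi^\circ_*\mathcal{O}_{Y^\circ}$; it is $\pi_*\mathcal{O}_Y$-linear.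 Let $\mu_\pi\colon\pi_*\Omega_Y^1\to\Omega_X^1(\log\Delta)\otimes\mathcal{Z}_\theta$ be the morphism through which $(\mathrm{id}\otimes m)\circ\lambda_\pi$ factors, using $m(\pi_*\mathcal{O}_Y)\subset\mathcal{Z}_\theta$. Because $\pi$ is finite, $\mathrm{At}(L)\in H^1(Y,\Omega_Y^1)$ may be viewed as a class $\pi_*\mathrm{At}(L)\in H^1(X,\pi_*\Omega_Y^1)$. Then $$\mathrm{At}^{\log}_\theta(E):=(\mu_\pi)_*\bigl(\pi_*\mathrm{At}(L)\bigr)\in H^1\bigl(X,\Omega_X^1(\log\Delta)\otimes\mathcal{Z}_\theta\bigr).$$ *)

(* Defs.v *)
From HB Require Import structures.
From mathcomp Require Import all_boot all_order all_algebra.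
From mathcomp Require Import boolp classical_sets functions topology reals.
From mathcomp Require Import complex.
From mathcomp Require mpoly.
Import (canonicals) mpoly.

Set Implicit Arguments.
Unset Strict Implicit.
Unset Printing Implicit Defensive.

Import GRing.Theory.
Local Open Scope classical_set_scope.
Local Open Scope quotient_scope.
Local Open Scope ring_scope.

Section Opens.
Variable X : topologicalType.

Record opens := Opens { oset : set X; osetP : open oset }.
Local Coercion oset : opens >-> set.

Definition oT : opens := Opens openT.
Definition oI (U V : opens) : opens := Opens (openI (osetP U) (osetP V)).

Lemma oIl (U V : opens) : oI U V `<=` U. Proof. by move=> x []. Qed.
Lemma oIr (U V : opens) : oI U V `<=` V. Proof. by move=> x []. Qed.
Lemma oIs (U V W : opens) : W `<=` U -> W `<=` V -> W `<=` oI U V.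
Proof. by move=> h h' x Wx; split; [apply: h|apply: h']. Qed.
Lemma opens_refl (U : opens) : U `<=` U. Proof. by []. Qed.
End Opens.
Coercion oset : opens >-> set.

Definition opre (X Y : topologicalType) (f : X -> Y) (cf : continuous f)
  (U : opens Y) : opens X := Opens ((@continuousP X Y f).1 cf U (osetP U)).

(* [r U V] is only meaningful when V is contained in U; the laws below are
   only required in that case. *)
Section SheafAxioms.
Variables (X : topologicalType) (F : opens X -> Type).
Variable r : forall U V : opens X, F U -> F V.
Arguments r : clear implicits.

Record is_presheaf : Prop := IsPresheaf {
  psh_id : forall U s, r U U s = s;
  psh_comp : forall (U V W : opens X) s, V `<=` U -> W `<=` V -> r V W (r U V s) = r U W s }.

Record is_gluing : Prop := IsGluing {
  sheaf_sep : forall (U : opens X) (s t : F U),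
    (forall x, oset U x ->
      exists V : opens X, [/\ oset V x, V `<=` U & r U V s = r U V t]) ->
    s = t;
  sheaf_glue : forall (U : opens X) (V : X -> opens X) (s : forall x, F (V x)),
    (forall x, oset U x -> oset (V x) x /\ V x `<=` U) ->
    (forall x y, oset U x -> oset U y ->
      r (V x) (oI (V x) (V y)) (s x) = r (V y) (oI (V x) (V y)) (s y)) ->
    exists t : F U, forall x, oset U x -> r U (V x) t = s x }.
End SheafAxioms.

Record rspace (k : fieldType) := Space {
  pts :> topologicalType;
  fn : opens pts -> comPzRingType;
  cst : forall U, {rmorphism k -> fn U};
  fres : forall U V, fn U -> fn V;
  fresD : forall (U V : opens pts), V `<=` U -> {morph @fres U V : a b / a + b};
  fresM : forall (U V : opens pts), V `<=` U -> {morph @fres U V : a b / a * b};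
  fres1 : forall (U V : opens pts), V `<=` U -> @fres U V 1 = 1;
  fres_cst : forall (U V : opens pts) c, V `<=` U -> @fres U V (cst U c) = cst V c;
  fn_psh : is_presheaf fres;
  fn_glue : is_gluing fres }.
Arguments fn {k} r U.
Arguments cst {k r} U.
Arguments fres {k r} U V.

Section FresMorph.
Variables (k : fieldType) (X : rspace k) (U V : opens X) (h : V `<=` U).
Lemma fresB_subproof : {morph (@fres k X U V) : a b / a - b}.
Proof.
have f0 : fres U V 0 = 0.
  by apply: (addrI (fres U V 0)); rewrite -fresD // !addr0.
have fN a : fres U V (- a) = - fres U V a.
  by apply: (addrI (fres U V a)); rewrite -fresD // !subrr.
by move=> a b; rewrite fresD // fN.
Qed.
Definition fresm : {rmorphism fn X U -> fn X V} :=
  HB.pack (@fres k X U V)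
    (GRing.isZmodMorphism.Build _ _ (@fres k X U V) fresB_subproof)
    (GRing.isMonoidMorphism.Build _ _ (@fres k X U V)
       (conj (fres1 h) (fresM h))).
Lemma fresmE a : fresm a = fres U V a. Proof. by []. Qed.
End FresMorph.

Section Modules.
Variables (k : fieldType) (X : rspace k).

Record psh := Psh {
  sec :> forall U : opens X, lmodType (fn X U);
  rs : forall U V, sec U -> sec V;
  rs_lin : forall (U V : opens X) a (s t : sec U), V `<=` U ->
    rs V (a *: s + t) = fres U V a *: rs V s + rs V t;
  rs_psh : is_presheaf rs }.

Record omod := Omod { opsh :> psh; omodP : is_gluing (@rs opsh) }.

Record ohom (M N : psh) := Hom {
  hf :> forall U, M U -> N U;
  hf_lin : forall U a s t, @hf U (a *: s + t) = a *: hf s + hf t;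
  hf_rs : forall (U V : opens X) (s : M U), V `<=` U ->
    @hf V (rs V s) = rs V (hf s) }.
End Modules.
Arguments rs {k X p} U V.
Arguments hf {k X M N} h U : rename.

Section RsTheory.
Variables (k : fieldType) (X : rspace k) (M : psh X).
Implicit Types U V W : opens X.
Lemma rsD U V (s t : M U) : V `<=` U -> rs U V (s + t) = rs U V s + rs U V t.
Proof. by move=> h; rewrite -[s]scale1r rs_lin // fres1 // !scale1r. Qed.
Lemma rs0 U V : V `<=` U -> rs U V (0 : M U) = 0.
Proof. by move=> h; apply: (addrI (rs U V 0)); rewrite -rsD // !addr0. Qed.
Lemma rsZ U V a (s : M U) : V `<=` U -> rs U V (a *: s) = fres U V a *: rs U V s.
Proof. by move=> h; rewrite -[X in rs U V X]addr0 rs_lin // rs0 // addr0. Qed.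
Lemma rsN U V (s : M U) : V `<=` U -> rs U V (- s) = - rs U V s.
Proof. by move=> h; apply: (addrI (rs U V s)); rewrite -rsD // !subrr rs0. Qed.
Lemma rs_id U (s : M U) : rs U U s = s.
Proof. exact: (psh_id (rs_psh M)). Qed.
Lemma rs_comp U V W (s : M U) : V `<=` U -> W `<=` V -> rs V W (rs U V s) = rs U W s.
Proof. exact: (psh_comp (rs_psh M)). Qed.
End RsTheory.

Section HomTheory.
Variables (k : fieldType) (X : rspace k) (M N : psh X) (f : ohom M N).
Implicit Types U V W : opens X.
Lemma hfD U : {morph f U : s t / s + t}.
Proof. by move=> s t; rewrite -[s]scale1r hf_lin !scale1r. Qed.
Lemma hf0 U : f U 0 = 0.
Proof. by apply: (addrI (f U 0)); rewrite -hfD !addr0. Qed.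
Lemma hfZ U a s : f U (a *: s) = a *: f U s.
Proof. by rewrite -[X in f U X]addr0 hf_lin hf0 addr0. Qed.
End HomTheory.

(* Modules over a ring A presented by generators G, subject to all relations
   valid in every A-module under every family satisfying Phi. *)
Section PresentedModule.
Variables (A : comPzRingType) (G : choiceType).
Variable Phi : forall P : lmodType A, (G -> P) -> Prop.
Implicit Types s t : seq (A * G).

Definition pev (P : lmodType A) (g : G -> P) s : P :=
  \sum_(p <- s) p.1 *: g p.2.

Definition pres_rel s t : bool :=
  `[< forall P g, Phi g -> @pev P g s = pev g t >].

Lemma pres_rel_refl : reflexive pres_rel.
Proof. by move=> s; apply/asboolP. Qed.
Lemma pres_rel_sym : symmetric pres_rel.
Proof.
by move=> s t; apply/asboolP/asboolP => h P g hg; rewrite h.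
Qed.
Lemma pres_rel_trans : transitive pres_rel.
Proof.
move=> s t u /asboolP h /asboolP h'; apply/asboolP => P g hg.
by rewrite h // h'.
Qed.
Canonical pres_equiv := EquivRel pres_rel pres_rel_refl pres_rel_sym pres_rel_trans.
Definition pres := {eq_quot pres_equiv}%qT.
HB.instance Definition _ := Choice.on pres.
HB.instance Definition _ := Quotient.on pres.

Definition pres_ev (P : lmodType A) (g : G -> P) (u : pres) : P := pev g (repr u).

Lemma pres_evE (P : lmodType A) (g : G -> P) s :
  Phi g -> pres_ev g (\pi_pres s) = pev g s.
Proof.
move=> hg; rewrite /pres_ev; have := reprK (\pi_pres s).
by move=> /eqmodP/asboolP ->.
Qed.

Lemma pres_ext (u v : pres) :
  (forall (P : lmodType A) (g : G -> P), Phi g -> pres_ev g u = pres_ev g v) -> u = v.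
Proof. by move=> h; rewrite -(reprK u) -(reprK v); apply/eqmodP/asboolP. Qed.

Definition pres_add (u v : pres) : pres := \pi_pres (repr u ++ repr v).
Definition pres_scale (a : A) (u : pres) : pres :=
  \pi_pres [seq (a * p.1, p.2) | p <- repr u].
Definition pres_zero : pres := \pi_pres [::].
Definition pres_opp (u : pres) : pres := pres_scale (-1) u.

Section Ev.
Variables (P : lmodType A) (g : G -> P) (hg : Phi g).
Lemma pres_ev_add u v : pres_ev g (pres_add u v) = pres_ev g u + pres_ev g v.
Proof. by rewrite pres_evE // /pev big_cat. Qed.
Lemma pres_ev_scale a u : pres_ev g (pres_scale a u) = a *: pres_ev g u.
Proof.
rewrite pres_evE // /pev big_map scaler_sumr; apply: eq_bigr => p _ /=.
by rewrite scalerA.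
Qed.
Lemma pres_ev_zero : pres_ev g pres_zero = 0.
Proof. by rewrite pres_evE // /pev big_nil. Qed.
Lemma pres_ev_opp u : pres_ev g (pres_opp u) = - pres_ev g u.
Proof. by rewrite pres_ev_scale scaleN1r. Qed.
End Ev.
Let evE := (pres_ev_add, pres_ev_scale, pres_ev_zero, pres_ev_opp).

Lemma pres_addA : associative pres_add.
Proof. by move=> u v w; apply: pres_ext => P g hg; rewrite !evE // addrA. Qed.
Lemma pres_addC : commutative pres_add.
Proof. by move=> u v; apply: pres_ext => P g hg; rewrite !evE // addrC. Qed.
Lemma pres_add0 : left_id pres_zero pres_add.
Proof. by move=> u; apply: pres_ext => P g hg; rewrite !evE // add0r. Qed.
Lemma pres_addN : left_inverse pres_zero pres_opp pres_add.
Proof. by move=> u; apply: pres_ext => P g hg; rewrite !evE // addNr. Qed.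
HB.instance Definition _ :=
  GRing.isZmodule.Build pres pres_addA pres_addC pres_add0 pres_addN.

Lemma pres_scaleA a b u : pres_scale a (pres_scale b u) = pres_scale (a * b) u.
Proof. by apply: pres_ext => P g hg; rewrite !evE // scalerA. Qed.
Lemma pres_scale1 : left_id 1 pres_scale.
Proof. by move=> u; apply: pres_ext => P g hg; rewrite !evE // scale1r. Qed.
Lemma pres_scaleDr : right_distributive pres_scale +%R.
Proof. by move=> a u v; apply: pres_ext => P g hg; rewrite !evE // scalerDr. Qed.
Lemma pres_scaleDl u : {morph pres_scale^~ u : a b / a + b}.
Proof. by move=> a b; apply: pres_ext => P g hg; rewrite !evE // scalerDl. Qed.
HB.instance Definition _ := GRing.Zmodule_isLmodule.Build A pres
  pres_scaleA pres_scale1 pres_scaleDr pres_scaleDl.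

Definition pgen (g : G) : pres := \pi_pres [:: (1, g)].

Lemma pres_ev_gen (P : lmodType A) (g : G -> P) x :
  Phi g -> pres_ev g (pgen x) = g x.
Proof. by move=> hg; rewrite pres_evE // /pev big_seq1 scale1r. Qed.

Lemma pres_ev_lin (P : lmodType A) (g : G -> P) : Phi g ->
  forall a u v, pres_ev g (a *: u + v) = a *: pres_ev g u + pres_ev g v.
Proof. by move=> hg a u v; rewrite pres_ev_add // pres_ev_scale. Qed.

Lemma pres_span (u : pres) : u = \sum_(p <- repr u) p.1 *: pgen p.2.
Proof.
apply: pres_ext => P g hg; rewrite {1}/pres_ev /pev.
elim: (repr u) => [|p s IH]; first by rewrite !big_nil pres_ev_zero.
by rewrite !big_cons IH pres_ev_add // pres_ev_scale // pres_ev_gen.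
Qed.
End PresentedModule.

(* The sheaf associated with a presheaf of modules: a section over U is a
   family of germs indexed by the points of U which is locally induced by
   sections of P.  A germ at x is encoded as the set of pairs (V, s) which
   represent it. *)
Section Sheafify.
Variables (k : fieldType) (X : rspace k) (P : psh X).
Implicit Types (x : X) (U V W : opens X).

Definition germ_eq x V W (s : P V) (t : P W) : Prop :=
  exists O : opens X, [/\ oset O x, O `<=` V, O `<=` W & rs V O s = rs W O t].

Lemma geq_refl x V (s : P V) : oset V x -> germ_eq x s s.
Proof. by move=> Vx; exists V; split. Qed.
Lemma geq_sym x V W (s : P V) (t : P W) : germ_eq x s t -> germ_eq x t s.
Proof. by case=> O [? ? ? e]; exists O. Qed.
Lemma geq_trans x V1 V2 V3 (s : P V1) (t : P V2) (u : P V3) :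
  germ_eq x s t -> germ_eq x t u -> germ_eq x s u.
Proof.
move=> [O [Ox h1 h2 e]] [O' [Ox' h2' h3 e']]; exists (oI O O').
have hl := @oIl _ O O'; have hr := @oIr _ O O'; split => //.
- exact: subset_trans hl h1.
- exact: subset_trans hr h3.
by rewrite -(rs_comp s h1 hl) e rs_comp // -(rs_comp u h3 hr) -e' rs_comp.
Qed.
Lemma geq_rs x V W (s : P V) : W `<=` V -> oset W x -> germ_eq x s (rs V W s).
Proof. by move=> h Wx; exists W; split=> //; rewrite rs_id. Qed.
Lemma geq_dom x V W (s : P V) (t : P W) : germ_eq x s t -> oset V x /\ oset W x.
Proof. by case=> O [Ox h1 h2 _]; split; [apply: h1|apply: h2]. Qed.
Lemma geq_near x V W (s : P V) (t : P W) : germ_eq x s t ->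
  exists O : opens X, oset O x /\ forall y, oset O y -> germ_eq y s t.
Proof. by case=> O [Ox h1 h2 e]; exists O; split=> // y Oy; exists O. Qed.
Lemma geq_lin x V (s s' : P V) W (t t' : P W) U (a : fn X U) :
  V `<=` U -> W `<=` U ->
  germ_eq x s t -> germ_eq x s' t' ->
  germ_eq x (fres U V a *: s + s') (fres U W a *: t + t').
Proof.
move=> hV hW [O [Ox h1 h2 e]] [O' [Ox' h1' h2' e']].
exists (oI O O'); have hl := @oIl _ O O'; have hr := @oIr _ O O'.
have l1 := subset_trans hl h1; have l2 := subset_trans hl h2; split=> //.
rewrite !rs_lin // !(psh_comp (fn_psh X)) //.
rewrite -(rs_comp s h1 hl) e rs_comp //.
by rewrite -(rs_comp s' h1' hr) e' rs_comp.
Qed.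

Record shf (U : opens X) := Shf {
  at_ :> forall x V, P V -> Prop;
  at_mem : forall x V (s : P V), at_ x s -> oset U x;
  at_ex : forall x, oset U x -> exists V, exists2 s : P V, V `<=` U & at_ x s;
  at_geq : forall x V (s : P V) W (t : P W), at_ x s -> (at_ x t <-> germ_eq x s t);
  at_near : forall x V (s : P V), at_ x s ->
    exists O : opens X, oset O x /\ forall y, oset O y -> oset U y -> at_ y s }.

HB.instance Definition _ U := gen_eqMixin (shf U).
HB.instance Definition _ U := gen_choiceMixin (shf U).

Lemma shf_eqP U (s t : shf U) : (forall x V (a : P V), s x V a <-> t x V a) -> s = t.
Proof.
case: s t => [a a1 a2 a3 a4] [b b1 b2 b3 b4] /= h.
have e : a = b.
  by apply: functional_extensionality_dep => x;
     apply: functional_extensionality_dep => V; apply/funext => s; apply/propext.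
by case: _ / e in b1 b2 b3 b4 *; congr Shf; apply: Prop_irrelevance.
Qed.

Lemma shf_ext U (s t : shf U) :
  (forall x, oset U x -> exists V, exists2 a : P V, s x V a & t x V a) -> s = t.
Proof.
move=> h; apply: shf_eqP => x V a; split=> ha.
  have [W [b sb tb]] := h x (at_mem ha).
  by apply/(at_geq _ tb)/(at_geq a sb).
have [W [b sb tb]] := h x (at_mem ha).
by apply/(at_geq _ sb)/(at_geq a tb).
Qed.

Lemma at_dom U (s : shf U) x V (a : P V) : s x V a -> oset V x.
Proof. by move=> h; case/(at_geq a h): (h) => O [Ox hV _ _]; apply: hV. Qed.

Lemma at_rs U (s : shf U) x V W (a : P V) :
  W `<=` V -> oset W x -> s x V a -> s x W (rs V W a).
Proof. by move=> hW Wx h; apply/(at_geq _ h)/geq_rs. Qed.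

Section Make.
Variables (U : opens X) (V : X -> opens X) (a : forall x, P (V x)).
Hypothesis hV : forall x, oset U x -> oset (V x) x /\ V x `<=` U.
Hypothesis ha : forall x, oset U x ->
  exists O : opens X, oset O x /\ forall y, oset O y -> oset U y -> germ_eq y (a x) (a y).

Definition mk_at x W (s : P W) : Prop := oset U x /\ germ_eq x (a x) s.

Lemma mk_mem x W (s : P W) : mk_at x s -> oset U x. Proof. by case. Qed.
Lemma mk_ex x : oset U x -> exists W, exists2 s : P W, W `<=` U & mk_at x s.
Proof.
by move=> Ux; have [Vx hU] := hV Ux; exists (V x), (a x) => //; split=> //; apply: geq_refl.
Qed.
Lemma mk_geq x W (s : P W) W' (t : P W') : mk_at x s -> (mk_at x t <-> germ_eq x s t).
Proof.
move=> [Ux h]; split => [[_ h']|h']; last by split=> //; apply: geq_trans h'.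
exact: geq_trans (geq_sym h) h'.
Qed.
Lemma mk_near x W (s : P W) : mk_at x s ->
  exists O : opens X, oset O x /\ forall y, oset O y -> oset U y -> mk_at y s.
Proof.
move=> [Ux h]; have [O [Ox hO]] := ha Ux; have [O' [Ox' hO']] := geq_near h.
exists (oI O O'); split=> // y [Oy Oy'] Uy; split=> //.
exact: geq_trans (geq_sym (hO y Oy Uy)) (hO' y Oy').
Qed.
Definition mk_shf : shf U := Shf mk_mem mk_ex mk_geq mk_near.

Lemma mk_shfE x : oset U x -> mk_shf x (V x) (a x).
Proof. by move=> Ux; split=> //; apply: geq_refl; case: (hV Ux). Qed.
End Make.

Section Unit.
Variables (U : opens X) (s : P U).
Lemma unit_mem x : oset U x -> oset U x /\ U `<=` U. Proof. by split. Qed.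
Lemma unit_near x : oset U x ->
  exists O : opens X, oset O x /\ forall y, oset O y -> oset U y -> germ_eq y s s.
Proof. by move=> Ux; exists U; split=> // y Uy _; apply: geq_refl. Qed.
Definition shf_unit : shf U := @mk_shf U (fun=> U) (fun=> s) unit_mem unit_near.
Lemma shf_unitE x : oset U x -> shf_unit x U s. Proof. exact: mk_shfE. Qed.
End Unit.

Section Rep.
Variables (U : opens X) (s : shf U).
Lemma rep_ex x : exists p : {V : opens X & P V}, oset U x ->
  [/\ oset (projT1 p) x, projT1 p `<=` U &
      forall y, oset (projT1 p) y -> s y (projT1 p) (projT2 p)].
Proof.
have [Ux|nUx] := pselect (oset U x); last by exists (existT (fun V => P V : Type) U (0 : P U)).
have [V [a hV h]] := at_ex s Ux; have [O [Ox hO]] := at_near h.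
exists (existT (fun V => P V : Type) (oI V O) (rs V (oI V O) a)) => _ /=; split.
- by split=> //; apply: at_dom h.
- exact: subset_trans (@oIl _ _ _) hV.
move=> y [Vy Oy]; apply: at_rs => //; first exact: oIl.
by apply: hO => //; apply: hV.
Qed.
Definition rep x := projT1 (cid (rep_ex x)).
Lemma repP x : oset U x -> [/\ oset (projT1 (rep x)) x, projT1 (rep x) `<=` U &
  forall y, oset (projT1 (rep x)) y -> s y (projT1 (rep x)) (projT2 (rep x))].
Proof. exact: (projT2 (cid (rep_ex x))). Qed.
End Rep.

Section Lin.
Variables (U : opens X) (c : fn X U) (s t : shf U).
Let V x : opens X := oI (projT1 (rep s x)) (projT1 (rep t x)).
Let a x : P (V x) :=
  fres U (V x) c *: rs _ _ (projT2 (rep s x)) + rs _ _ (projT2 (rep t x)).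
Lemma lin_mem x : oset U x -> oset (V x) x /\ V x `<=` U.
Proof.
move=> Ux; have [sx hs _] := repP s Ux; have [tx _ _] := repP t Ux.
by split; [split|apply: subset_trans hs => //; apply: oIl].
Qed.
Lemma lin_near x : oset U x ->
  exists O : opens X, oset O x /\ forall y, oset O y -> oset U y -> germ_eq y (a x) (a y).
Proof.
move=> Ux; have [_ _ hs] := repP s Ux; have [_ _ ht] := repP t Ux.
have [Vx hxU] := lin_mem Ux.
exists (V x); split=> // y Vy Uy; have [Vyy hyU] := lin_mem Uy.
have [sy _ hsy] := repP s Uy; have [ty _ hty] := repP t Uy.
have rsx := at_rs (@oIl _ _ _ : V x `<=` _) Vy (hs y (@oIl _ _ _ _ Vy)).
have rtx := at_rs (@oIr _ _ _ : V x `<=` _) Vy (ht y (@oIr _ _ _ _ Vy)).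
have rsy := at_rs (@oIl _ _ _ : V y `<=` _) Vyy (hsy y sy).
have rty := at_rs (@oIr _ _ _ : V y `<=` _) Vyy (hty y ty).
by apply: geq_lin => //; [apply/(at_geq _ rsx)|apply/(at_geq _ rtx)].
Qed.
Definition shf_lin : shf U := mk_shf lin_mem lin_near.

Lemma shf_linE x W (u v : P W) : W `<=` U -> s x W u -> t x W v ->
  shf_lin x W (fres U W c *: u + v).
Proof.
move=> hW hu hv; have Ux := at_mem hu; have [Vx hxU] := lin_mem Ux.
have [sx _ hs] := repP s Ux; have [tx _ ht] := repP t Ux.
have rsx := at_rs (@oIl _ _ _ : V x `<=` _) Vx (hs x sx).
have rtx := at_rs (@oIr _ _ _ : V x `<=` _) Vx (ht x tx).
by split=> //; apply: geq_lin => //; [apply/(at_geq _ rsx)|apply/(at_geq _ rtx)].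
Qed.
End Lin.

Lemma shf_common U (s t : shf U) x : oset U x -> exists W : opens X,
  exists u v : P W, [/\ W `<=` U, s x W u & t x W v].
Proof.
move=> Ux; have [V [u hV hu]] := at_ex s Ux; have [W [v hW hv]] := at_ex t Ux.
have m : oset (oI V W) x by split; [exact: at_dom hu|exact: at_dom hv].
exists (oI V W), (rs _ _ u), (rs _ _ v); split.
- exact: subset_trans (@oIl _ _ _) hV.
- exact: (at_rs (@oIl _ _ _)).
- exact: (at_rs (@oIr _ _ _)).
Qed.

Lemma shf_common3 U (s t r : shf U) x : oset U x -> exists W : opens X,
  exists u v w : P W, [/\ W `<=` U, s x W u, t x W v & r x W w].
Proof.
move=> Ux; have [W [u [v [hW hu hv]]]] := shf_common s t Ux.
have [V [w hV hw]] := at_ex r Ux.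
have m : oset (oI W V) x by split; [exact: at_dom hu|exact: at_dom hw].
exists (oI W V), (rs _ _ u), (rs _ _ v), (rs _ _ w); split.
- exact: subset_trans (@oIl _ _ _) hW.
- exact: (at_rs (@oIl _ _ _)).
- exact: (at_rs (@oIl _ _ _)).
- exact: (at_rs (@oIr _ _ _)).
Qed.

Section Mod.
Variable U : opens X.
Implicit Types s t : shf U.
Definition shf_zero : shf U := shf_unit 0.
Definition shf_add s t : shf U := shf_lin 1 s t.
Definition shf_scale c s : shf U := shf_lin c s shf_zero.
Definition shf_opp s : shf U := shf_scale (-1) s.

Lemma shf_zeroE x W : W `<=` U -> oset W x -> shf_zero x W 0.
Proof.
move=> hW Wx; have Ux := hW _ Wx.
by rewrite -(rs0 P hW); apply: at_rs => //; apply: shf_unitE.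
Qed.
Lemma shf_addE s t x W (u v : P W) : W `<=` U -> s x W u -> t x W v ->
  shf_add s t x W (u + v).
Proof.
by move=> hW hu hv; move: (shf_linE 1 hW hu hv); rewrite fres1 // scale1r.
Qed.
Lemma shf_scaleE c s x W (u : P W) : W `<=` U -> s x W u ->
  shf_scale c s x W (fres U W c *: u).
Proof.
move=> hW hu; rewrite -[_ *: _]addr0; apply: shf_linE => //.
by apply: shf_zeroE => //; apply: at_dom hu.
Qed.
Lemma shf_oppE s x W (u : P W) : W `<=` U -> s x W u -> shf_opp s x W (- u).
Proof.
move=> hW hu; move: (shf_scaleE (-1) hW hu).
by rewrite -(fresmE hW) rmorphN1 scaleN1r.
Qed.

Lemma shf_addA : associative shf_add.
Proof.
move=> s t r; apply: shf_ext => x Ux.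
have [W [u [v [w [hW hu hv hw]]]]] := shf_common3 s t r Ux.
exists W, (u + (v + w)); first by do !apply: shf_addE.
by rewrite addrA; do !apply: shf_addE.
Qed.
Lemma shf_addC : commutative shf_add.
Proof.
move=> s t; apply: shf_ext => x Ux; have [W [u [v [hW hu hv]]]] := shf_common s t Ux.
by exists W, (u + v); [|rewrite addrC]; apply: shf_addE.
Qed.
Lemma shf_add0 : left_id shf_zero shf_add.
Proof.
move=> s; apply: shf_ext => x Ux; have [W [u hW hu]] := at_ex s Ux.
exists W, u => //; rewrite -[u]add0r; apply: shf_addE => //.
by apply: shf_zeroE => //; apply: at_dom hu.
Qed.
Lemma shf_addN : left_inverse shf_zero shf_opp shf_add.
Proof.
move=> s; apply: shf_ext => x Ux; have [W [u hW hu]] := at_ex s Ux.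
exists W, 0; last by apply: shf_zeroE => //; apply: at_dom hu.
by rewrite -(addNr u); apply: shf_addE => //; apply: shf_oppE.
Qed.
HB.instance Definition _ :=
  GRing.isZmodule.Build (shf U) shf_addA shf_addC shf_add0 shf_addN.

Lemma shf_scaleA a b s : shf_scale a (shf_scale b s) = shf_scale (a * b) s.
Proof.
apply: shf_ext => x Ux; have [W [u hW hu]] := at_ex s Ux.
exists W, (fres U W (a * b) *: u); last exact: shf_scaleE.
by rewrite fresM // -scalerA; do !apply: shf_scaleE.
Qed.
Lemma shf_scale1 : left_id 1 shf_scale.
Proof.
move=> s; apply: shf_ext => x Ux; have [W [u hW hu]] := at_ex s Ux.
by exists W, u => //; rewrite -[u]scale1r -(fres1 hW); apply: shf_scaleE.
Qed.
Lemma shf_scaleDr : right_distributive shf_scale +%R.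
Proof.
move=> a s t; apply: shf_ext => x Ux; have [W [u [v [hW hu hv]]]] := shf_common s t Ux.
exists W, (fres U W a *: (u + v)).
  by apply: shf_scaleE => //; apply: shf_addE.
by rewrite scalerDr; apply: shf_addE => //; apply: shf_scaleE.
Qed.
Lemma shf_scaleDl s : {morph shf_scale^~ s : a b / a + b}.
Proof.
move=> a b; apply: shf_ext => x Ux; have [W [u hW hu]] := at_ex s Ux.
exists W, (fres U W (a + b) *: u); first exact: shf_scaleE.
by rewrite fresD // scalerDl; apply: shf_addE => //; apply: shf_scaleE.
Qed.
HB.instance Definition _ := GRing.Zmodule_isLmodule.Build (fn X U) (shf U)
  shf_scaleA shf_scale1 shf_scaleDr shf_scaleDl.
End Mod.

Section Restrict.
Variables (U V : opens X) (h : V `<=` U) (s : shf U).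
Definition res_at x W (a : P W) : Prop := oset V x /\ s x W a.
Lemma res_mem x W (a : P W) : res_at x a -> oset V x. Proof. by case. Qed.
Lemma res_ex x : oset V x -> exists W, exists2 a : P W, W `<=` V & res_at x a.
Proof.
move=> Vx; have [W [a hW ha]] := at_ex s (h Vx).
exists (oI V W), (rs _ _ a); first exact: oIl.
split=> //; apply: at_rs => //; first exact: oIr.
by split=> //; apply: at_dom ha.
Qed.
Lemma res_geq x W (a : P W) W' (b : P W') : res_at x a -> (res_at x b <-> germ_eq x a b).
Proof.
move=> [Vx ha]; split=> [[_ hb]|hb]; first exact/(at_geq _ ha).
by split=> //; apply/(at_geq _ ha).
Qed.
Lemma res_near x W (a : P W) : res_at x a ->
  exists O : opens X, oset O x /\ forall y, oset O y -> oset V y -> res_at y a.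
Proof.
move=> [Vx ha]; have [O [Ox hO]] := at_near ha.
by exists O; split=> // y Oy Vy; split=> //; apply: hO => //; apply: h.
Qed.
Definition shf_res : shf V := Shf res_mem res_ex res_geq res_near.
End Restrict.

Definition shf_rs (U V : opens X) (s : shf U) : shf V :=
  match pselect (V `<=` U) with left h => shf_res h s | right _ => 0 end.

Lemma shf_rsE U V (h : V `<=` U) (s : shf U) x W (a : P W) :
  shf_rs V s x W a <-> oset V x /\ s x W a.
Proof. by rewrite /shf_rs; case: pselect. Qed.
Arguments shf_rsE {U V} h {s x W a}.

Lemma shf_rs_lin U V c (s t : shf U) : V `<=` U ->
  @shf_rs U V (c *: s + t) = fres U V c *: shf_rs V s + shf_rs V t.
Proof.
move=> h; apply: shf_ext => x Vx.
have [W [u [v [hW hu hv]]]] := shf_common s t (h _ Vx).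
pose O := oI V W; have Ox : oset O x by split=> //; apply: at_dom hu.
have {}hu := at_rs (@oIr _ _ _ : O `<=` _) Ox hu.
have {}hv := at_rs (@oIr _ _ _ : O `<=` _) Ox hv.
have hOV : O `<=` V by exact: oIl.
have hOU : O `<=` U by exact: subset_trans h.
exists O, (fres U O c *: rs W O u + rs W O v).
  apply/(shf_rsE h); split=> //.
  by apply: shf_addE => //; apply: shf_scaleE.
rewrite -(psh_comp (fn_psh X) _ h hOV).
apply: shf_addE => //; last exact/(shf_rsE h).
by apply: shf_scaleE => //; apply/(shf_rsE h).
Qed.

Lemma shf_is_presheaf : is_presheaf shf_rs.
Proof.
split=> [U s|U V W s hV hW]; apply: shf_eqP => x O a.
  have hU := @subset_refl _ (oset U).
  split=> [/(shf_rsE hU) [//]|h]; apply/(shf_rsE hU).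
  by split=> //; apply: at_mem h.
have hWU := subset_trans hW hV.
split=> [/(shf_rsE hW) [Wx /(shf_rsE hV) [Vx h]]|/(shf_rsE hWU) [Wx h]].
  by apply/(shf_rsE hWU).
apply/(shf_rsE hW); split=> //; apply/(shf_rsE hV); split=> //.
exact: hW.
Qed.

Lemma shf_is_gluing : is_gluing shf_rs.
Proof.
split=> [U s t h|U V s hV hc].
  apply: shf_ext => x Ux; have [V [Vx hV e]] := h x Ux.
  have [W [a _ ha]] := at_ex s Ux; exists W, a => //.
  have : shf_rs V s x W a by apply/(shf_rsE hV).
  by rewrite e => /(shf_rsE hV) [].
pose a x := projT2 (rep (s x) x); pose W x := projT1 (rep (s x) x).
have sa x : oset U x ->
    [/\ oset (W x) x, W x `<=` V x & forall y, oset (W x) y -> s x y (W x) (a x)].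
  by move=> Ux; apply: repP; case: (hV x Ux).
have m x : oset U x -> oset (W x) x /\ W x `<=` U.
  by move=> Ux; have [? h1 _] := sa x Ux; split=> //; apply: subset_trans h1 _; case: (hV x Ux).
have cc x y z O (b : P O) : oset U x -> oset U y -> oset (V x) z -> oset (V y) z ->
    s x z O b -> s y z O b.
  move=> Ux Uy Vxz Vyz hb.
  have : shf_rs (oI (V x) (V y)) (s x) z O b.
    by apply/(shf_rsE (@oIl _ _ _)).
  by rewrite hc // => /(shf_rsE (@oIr _ _ _)) [].
have n x : oset U x -> exists O : opens X, oset O x /\
    forall y, oset O y -> oset U y -> germ_eq y (a x) (a y).
  move=> Ux; have [Wx h1 h2] := sa x Ux; exists (W x); split=> // y Wy Uy.
  have [Wyy _ h] := sa y Uy.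
  have := cc x y y _ (a x) Ux Uy (h1 _ Wy) (proj1 (hV y Uy)) (h2 y Wy).
  by move=> /(at_geq (a y)) [+ _]; apply; apply: h.
exists (mk_shf m n) => x Ux; have hVx := proj2 (hV x Ux).
apply: shf_ext => z Vxz; have Uz := hVx _ Vxz.
have [Wz _ h] := sa z Uz; exists (W z), (a z).
  by apply/(shf_rsE hVx); split=> //; apply: mk_shfE.
by apply: (cc z x) => //; [case: (hV z Uz)|apply: h].
Qed.

Definition sheafify : omod X := Omod (opsh := Psh shf_rs_lin shf_is_presheaf) shf_is_gluing.

Lemma shf_unit_lin U a (s t : P U) :
  shf_unit (a *: s + t) = a *: shf_unit s + shf_unit t :> sheafify U.
Proof.
apply: shf_ext => x Ux; exists U, (a *: s + t); first exact: shf_unitE.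
apply: shf_addE => //; last exact: shf_unitE.
rewrite -[X in X *: s](psh_id (fn_psh X)).
by apply: shf_scaleE => //; apply: shf_unitE.
Qed.
Lemma shf_unit_rs U V (s : P U) : V `<=` U ->
  shf_unit (rs U V s) = @rs _ _ sheafify U V (shf_unit s).
Proof.
move=> h; apply: shf_ext => x Vx; exists V, (rs U V s); first exact: shf_unitE.
apply/(shf_rsE h); split=> //; apply: at_rs => //.
by apply: shf_unitE; apply: h.
Qed.
Definition sheafify_unit : ohom P sheafify := Hom shf_unit_lin shf_unit_rs.

Section Lift.
Variables (N : omod X) (f : ohom P N).

Lemma lift_ex U (s : sheafify U) : exists t : N U, forall V (a : P V),
  V `<=` U -> (forall y, oset V y -> s y V a) -> rs U V t = f V a.
Proof.
pose W x := projT1 (rep s x); pose c x := projT2 (rep s x).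
have loc V (a : P V) V' (b : P V') : V `<=` U -> V' `<=` U ->
    (forall y, oset V y -> s y V a) -> (forall y, oset V' y -> s y V' b) ->
    rs V (oI V V') (f V a) = rs V' (oI V V') (f V' b).
  move=> hV hV' ha hb; apply: (sheaf_sep (omodP N)) => z [zV zV'].
  have /(at_geq b (ha z zV)) [O [Oz OV OV' e]] := hb z zV'.
  have OI : O `<=` oI V V' by exact: oIs.
  exists O; split=> //; rewrite !rs_comp //; try exact: oIl; try exact: oIr.
  by rewrite -!hf_rs // e.
have hW x : oset U x -> oset (W x) x /\ W x `<=` U by move=> /(repP s) [].
have [|t ht] := sheaf_glue (omodP N) (s := fun x => f (W x) (c x)) hW.
  by move=> x y /(repP s) [? ? ?] /(repP s) [? ? ?]; apply: loc.
exists t => V a hV ha; apply: (sheaf_sep (omodP N)) => x Vx.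
have Ux := hV _ Vx; have [Wx hWU hc] := repP s Ux.
exists (oI V (W x)); split; [by []|exact: oIl|].
rewrite rs_comp //; last exact: oIl.
rewrite (loc _ a _ (c x)) // -ht // rs_comp //; exact: oIr.
Qed.
Definition lift_fun U (s : sheafify U) : N U := projT1 (cid (lift_ex s)).
Lemma lift_funE U (s : sheafify U) V (a : P V) :
  V `<=` U -> (forall y, oset V y -> s y V a) -> rs U V (lift_fun s) = f V a.
Proof. exact: (projT2 (cid (lift_ex s))). Qed.

Lemma shf_commonW U (s t : shf U) x : oset U x -> exists W : opens X,
  exists u v : P W, [/\ oset W x, W `<=` U,
    forall y, oset W y -> s y W u & forall y, oset W y -> t y W v].
Proof.
move=> Ux; have [sx hs1 hs2] := repP s Ux; have [tx ht1 ht2] := repP t Ux.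
exists (oI (projT1 (rep s x)) (projT1 (rep t x))), (rs _ _ (projT2 (rep s x))),
  (rs _ _ (projT2 (rep t x))); split=> //.
- exact: subset_trans (@oIl _ _ _) hs1.
- by move=> y [h h']; apply: at_rs (hs2 y h) => //; exact: oIl.
- by move=> y [h h']; apply: at_rs (ht2 y h') => //; exact: oIr.
Qed.

Lemma lift_lin U a (s t : sheafify U) :
  lift_fun (a *: s + t) = a *: lift_fun s + lift_fun t.
Proof.
apply: (sheaf_sep (omodP N)) => x Ux.
have [W [u [v [Wx hW hu hv]]]] := shf_commonW s t Ux.
exists W; split=> //; rewrite rs_lin // (lift_funE hW hu) (lift_funE hW hv).
rewrite (lift_funE (a := fres U W a *: u + v)) ?hf_lin // => y Wy.
by apply: shf_addE => //; [apply: shf_scaleE => //; apply: hu|apply: hv].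
Qed.
Lemma lift_rs U V (s : sheafify U) : V `<=` U ->
  lift_fun (rs U V s) = rs U V (lift_fun s).
Proof.
move=> h; apply: (sheaf_sep (omodP N)) => x Vx; have Ux := h _ Vx.
have [Wx hW hu] := repP s Ux; set W := projT1 _ in Wx hW hu.
exists (oI V W); split=> //; first exact: oIl.
have hl := @oIl _ V W; have hr := @oIr _ V W.
rewrite rs_comp // (lift_funE (a := rs _ _ (projT2 (rep s x)))) //; last first.
  move=> y [Vy Wy]; apply/(shf_rsE h); split=> //.
  by apply: at_rs => //; apply: hu.
symmetry; apply: lift_funE; first exact: subset_trans h.
by move=> y [Vy Wy]; apply: at_rs => //; apply: hu.
Qed.
Definition sheafify_lift : ohom sheafify N := Hom lift_lin lift_rs.

Lemma sheafify_liftE U (s : P U) : sheafify_lift U (sheafify_unit U s) = f U s.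
Proof.
rewrite -[LHS]rs_id; apply: lift_funE => // y Uy; exact: shf_unitE.
Qed.
Lemma sheafify_uniq (g h : ohom sheafify N) :
  (forall U s, g U (sheafify_unit U s) = h U (sheafify_unit U s)) ->
  forall U s, g U s = h U s.
Proof.
move=> e U s; apply: (sheaf_sep (omodP N)) => x Ux.
have [Wx hW hu] := repP s Ux; exists (projT1 (rep s x)); split=> //.
rewrite -!hf_rs //.
suff -> : rs U (projT1 (rep s x)) s = sheafify_unit _ (projT2 (rep s x)) by [].
apply: shf_ext => y Wy; exists (projT1 (rep s x)), (projT2 (rep s x)).
  by apply/(shf_rsE hW); split=> //; apply: hu.
exact: shf_unitE.
Qed.
End Lift.
End Sheafify.

Section HomOps.
Variables (k : fieldType) (X : rspace k).
Lemma hid_lin (M : psh X) U a (s t : M U) : id (a *: s + t) = a *: id s + id t.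
Proof. by []. Qed.
Lemma hid_rs (M : psh X) (U V : opens X) (s : M U) : V `<=` U ->
  id (rs U V s) = rs U V (id s).
Proof. by []. Qed.
Definition hid (M : psh X) : ohom M M := Hom (@hid_lin M) (@hid_rs M).

Variables (M N Q : psh X) (g : ohom N Q) (f : ohom M N).
Lemma hcomp_lin U a (s t : M U) :
  g U (f U (a *: s + t)) = a *: g U (f U s) + g U (f U t).
Proof. by rewrite !hf_lin. Qed.
Lemma hcomp_rs (U V : opens X) (s : M U) : V `<=` U ->
  g V (f V (rs U V s)) = rs U V (g U (f U s)).
Proof. by move=> h; rewrite !hf_rs. Qed.
Definition hcomp : ohom M Q := Hom hcomp_lin hcomp_rs.
End HomOps.

Definition rscal (A B : pzRingType) (f : {rmorphism A -> B}) (M : lmodType B) : Type := M.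
Section Rscal.
Variables (A B : pzRingType) (f : {rmorphism A -> B}) (M : lmodType B).
Local Notation rscal := (rscal f M).
HB.instance Definition _ := GRing.Zmodule.copy rscal M.
Definition rscal_scale (a : A) (m : rscal) : rscal := f a *: (m : M).
Lemma rscalA a b m : rscal_scale a (rscal_scale b m) = rscal_scale (a * b) m.
Proof. by rewrite /rscal_scale scalerA rmorphM. Qed.
Lemma rscal1 : left_id 1 rscal_scale.
Proof. by move=> m; rewrite /rscal_scale rmorph1 scale1r. Qed.
Lemma rscalDr : right_distributive rscal_scale +%R.
Proof. by move=> a m n; rewrite /rscal_scale scalerDr. Qed.
Lemma rscalDl m : {morph rscal_scale^~ m : a b / a + b}.
Proof. by move=> a b; rewrite /rscal_scale rmorphD scalerDl. Qed.
HB.instance Definition _ := GRing.Zmodule_isLmodule.Build A rscal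
  rscalA rscal1 rscalDr rscalDl.
End Rscal.

Section PresentedPresheaf.
Variables (k : fieldType) (X : rspace k) (G : opens X -> choiceType).
Variable gr : forall U V : opens X, G U -> G V.
Arguments gr : clear implicits.
Hypothesis gr_psh : is_presheaf gr.
Variable Phi : forall U (P : lmodType (fn X U)), (G U -> P) -> Prop.
Hypothesis Phi_gen : forall U, Phi (@pgen (fn X U) (G U) (@Phi U)).
Hypothesis Phi_res : forall (U V : opens X) (h : V `<=` U)
  (P : lmodType (fn X V)) (g : G V -> P), Phi g ->
  Phi (fun x : G U => g (gr U V x) : rscal (fresm h) P).

Definition pp U : lmodType (fn X U) := pres (@Phi U).
Definition pp_rs (U V : opens X) (u : pp U) : pp V :=
  match pselect (V `<=` U) with
  | left h => @pres_ev _ _ (@Phi U) (rscal (fresm h) (pp V)) (fun x => pgen (@Phi V) (gr U V x)) u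
  | right _ => 0
  end.
Lemma pp_rsE (U V : opens X) (h : V `<=` U) (u : pp U) : pp_rs V u =
  @pres_ev _ _ (@Phi U) (rscal (fresm h) (pp V)) (fun x => pgen (@Phi V) (gr U V x)) u.
Proof. by rewrite /pp_rs; case: pselect => // h'; rewrite (Prop_irrelevance h h'). Qed.
Lemma pp_rs_lin (U V : opens X) a (s t : pp U) : V `<=` U ->
  pp_rs V (a *: s + t) = fres U V a *: pp_rs V s + pp_rs V t.
Proof.
move=> h; rewrite !(pp_rsE h) pres_ev_lin //.
exact: (Phi_res h (Phi_gen V)).
Qed.
Lemma pp_rs_gen (U V : opens X) (h : V `<=` U) x :
  pp_rs V (pgen (@Phi U) x) = pgen (@Phi V) (gr U V x).
Proof. by rewrite (pp_rsE h) pres_ev_gen //; apply: (Phi_res h (Phi_gen V)). Qed.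

Lemma pp_eq (U V : opens X) (f g : pp U -> pp V) :
  (forall x, f (pgen _ x) = g (pgen _ x)) ->
  (forall a s t, f (a *: s + t) = fres U V a *: f s + f t) ->
  (forall a s t, g (a *: s + t) = fres U V a *: g s + g t) ->
  V `<=` U -> f =1 g.
Proof.
move=> e hf hg h u.
have z (f' : pp U -> pp V) :
    (forall a s t, f' (a *: s + t) = fres U V a *: f' s + f' t) -> f' 0 = 0.
  move=> hf'; apply: (addrI (f' 0)).
  by rewrite -[X in X + _ = _]scale1r -(fres1 h) -hf' scale1r !addr0.
rewrite (pres_span u); elim: (repr u) => [|p s IH]; first by rewrite big_nil !z.
by rewrite big_cons hf hg IH e.
Qed.

Lemma pp_is_presheaf : is_presheaf pp_rs.
Proof.
split=> [U s|U V W s hV hW].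
  have h := @subset_refl _ (oset U).
  apply: (@pp_eq U U (pp_rs U) id) => // [x|a s' t'|a s' t'].
  - by rewrite pp_rs_gen // (psh_id gr_psh).
  - exact: pp_rs_lin.
  - by rewrite (psh_id (fn_psh X)).
have hWU := subset_trans hW hV.
apply: (@pp_eq U W (fun s => pp_rs W (pp_rs V s)) (pp_rs W)) => // [x|a s' t'|a s' t'].
- by rewrite !pp_rs_gen // (psh_comp gr_psh).
- by rewrite !pp_rs_lin // (psh_comp (fn_psh X)).
- exact: pp_rs_lin.
Qed.

Definition pp_psh : psh X := Psh pp_rs_lin pp_is_presheaf.

Section Hom.
Variables (N : psh X) (g : forall U, G U -> N U).
Hypothesis g_Phi : forall U, Phi (@g U).
Hypothesis g_rs : forall (U V : opens X) x, V `<=` U -> g (gr U V x) = rs U V (g x).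
Lemma pp_hom_lin U a (s t : pp_psh U) :
  pres_ev (@g U) (a *: s + t) = a *: pres_ev (@g U) s + pres_ev (@g U) t.
Proof. exact: pres_ev_lin. Qed.
Lemma pp_hom_rs (U V : opens X) (s : pp_psh U) : V `<=` U ->
  pres_ev (@g V) (rs U V s) = rs U V (pres_ev (@g U) s).
Proof.
move=> h; rewrite (pres_span s); elim: (repr s) => [|p l IH].
  by rewrite big_nil !rs0 // pres_ev_zero // pres_ev_zero // rs0.
rewrite big_cons !rs_lin // !pres_ev_lin // IH rs_lin //; congr (_ *: _ + _).
by rewrite /= pp_rs_gen // !pres_ev_gen // g_rs.
Qed.
Definition pp_hom : ohom pp_psh N := Hom pp_hom_lin pp_hom_rs.
End Hom.
End PresentedPresheaf.

Record bilin (A : comPzRingType) (M N P : lmodType A) (g : M * N -> P) : Prop := Bilin {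
  bilin_l : forall a m m' n, g (a *: m + m', n) = a *: g (m, n) + g (m', n);
  bilin_r : forall a m n n', g (m, a *: n + n') = a *: g (m, n) + g (m, n') }.
Arguments bilin {A M N} P g.

(* The tensor product: the sheaf associated with U |-> M(U) (x) N(U). *)
Section Tensor.
Variables (k : fieldType) (X : rspace k) (M N : psh X).

Let G (U : opens X) : choiceType := (M U * N U)%type.
Definition tens_gr (U V : opens X) (p : G U) : G V := (rs U V p.1, rs U V p.2).
Lemma tens_gr_psh : is_presheaf tens_gr.
Proof.
by split=> [U [m n]|U V W [m n] hV hW]; rewrite /tens_gr /= ?rs_id // !rs_comp.
Qed.
Definition tens_Phi U (P : lmodType (fn X U)) (g : G U -> P) : Prop := bilin P g.
Lemma tens_gen U : tens_Phi (@pgen (fn X U) (G U) (@tens_Phi U)).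
Proof.
split=> a m n n'; apply: pres_ext => P g hg; rewrite pres_ev_lin // !pres_ev_gen //.
  exact: bilin_l.
exact: bilin_r.
Qed.
Lemma tens_res (U V : opens X) (h : V `<=` U)
  (P : lmodType (fn X V)) (g : G V -> P) : tens_Phi g ->
  tens_Phi (fun x : G U => g (tens_gr V x) : rscal (fresm h) P).
Proof.
move=> [hl hr]; split=> a m n n'; rewrite /tens_gr /= rs_lin //.
all: by [exact: hl|exact: hr].
Qed.
Definition tensor_psh : psh X := pp_psh tens_gr_psh tens_gen tens_res.
Definition tensor : omod X := sheafify tensor_psh.
Definition tpure U (m : M U) (n : N U) : tensor U :=
  sheafify_unit tensor_psh U (pgen (@tens_Phi U) (m, n)).

Section Lift.
Variables (Q : omod X) (g : forall U, M U -> N U -> Q U).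
Hypothesis g_l : forall U a m m' n, @g U (a *: m + m') n = a *: g m n + g m' n.
Hypothesis g_r : forall U a m n n', @g U m (a *: n + n') = a *: g m n + g m n'.
Hypothesis g_rs : forall (U V : opens X) (m : M U) (n : N U), V `<=` U ->
  g (rs U V m) (rs U V n) = rs U V (g m n).
Let g' U (p : G U) : Q U := g p.1 p.2.
Lemma tlift_Phi U : tens_Phi (@g' U).
Proof. by split=> a m n n'; [apply: g_l|apply: g_r]. Qed.
Lemma tlift_rs (U V : opens X) x : V `<=` U -> g' (tens_gr V x) = rs U V (g' x).
Proof. by move=> h; apply: g_rs. Qed.
Definition tlift : ohom tensor Q := sheafify_lift
  (pp_hom tens_gr_psh tens_gen tens_res tlift_Phi tlift_rs).
Lemma tliftE U m n : tlift U (tpure m n) = @g U m n.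
Proof. by rewrite sheafify_liftE /= pres_ev_gen //; apply: tlift_Phi. Qed.
End Lift.

Lemma tpure_l U a m m' n :
  @tpure U (a *: m + m') n = a *: tpure m n + tpure m' n.
Proof. by rewrite /tpure (bilin_l (tens_gen U)) hf_lin. Qed.
Lemma tpure_r U a m n n' :
  @tpure U m (a *: n + n') = a *: tpure m n + tpure m n'.
Proof. by rewrite /tpure (bilin_r (tens_gen U)) hf_lin. Qed.
Lemma tpure_rs (U V : opens X) (m : M U) (n : N U) : V `<=` U ->
  tpure (rs U V m) (rs U V n) = rs U V (tpure m n).
Proof. by move=> h; rewrite /tpure -hf_rs //= (pp_rs_gen tens_gen tens_res). Qed.
End Tensor.
Arguments tpure {k X M N U} m n.

Section TensorMap.
Variables (k : fieldType) (X : rspace k) (M M' N N' : psh X).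
Variables (f : ohom M M') (g : ohom N N').
Let p U (m : M U) (n : N U) : tensor M' N' U := tpure (f U m) (g U n).
Lemma tmap_l U a m m' n : @p U (a *: m + m') n = a *: p m n + p m' n.
Proof. by rewrite /p hf_lin tpure_l. Qed.
Lemma tmap_r U a m n n' : @p U m (a *: n + n') = a *: p m n + p m n'.
Proof. by rewrite /p hf_lin tpure_r. Qed.
Lemma tmap_rs (U V : opens X) (m : M U) (n : N U) : V `<=` U ->
  p (rs U V m) (rs U V n) = rs U V (p m n).
Proof. by move=> h; rewrite /p !hf_rs // tpure_rs. Qed.
Definition tmap : ohom (tensor M N) (tensor M' N') := tlift tmap_l tmap_r tmap_rs.
End TensorMap.

Record derivation (A : comPzRingType) (C : set A) (P : lmodType A) (D : A -> P) : Prop := Deriv {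
  derivD : forall a b, D (a + b) = D a + D b;
  derivM : forall a b, D (a * b) = a *: D b + b *: D a;
  deriv_cst : forall c, C c -> D c = 0 }.
Arguments derivation {A} C P D.

(* Kaehler differentials relative to a sheaf of constants C: the sheaf
   associated with U |-> Omega_(O(U)/C(U)). *)
Section Kaehler.
Variables (k : fieldType) (X : rspace k) (C : forall U : opens X, set (fn X U)).
Hypothesis C_res : forall (U V : opens X) c, V `<=` U -> C c -> C (fres U V c).

Let G (U : opens X) : choiceType := fn X U.
Definition kah_Phi U (P : lmodType (fn X U)) (D : G U -> P) : Prop := derivation (@C U) P D.
Lemma kah_gen U : kah_Phi (@pgen (fn X U) (G U) (@kah_Phi U)).
Proof.
split=> [a b|a b|c hc]; apply: pres_ext => P g hg.
- by rewrite [RHS](pres_ev_add hg) !pres_ev_gen // (derivD hg).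
- rewrite [RHS](pres_ev_add hg) !(pres_ev_scale hg) !pres_ev_gen //.
  exact: (derivM hg).
- by rewrite [RHS](pres_ev_zero hg) pres_ev_gen // (deriv_cst hg).
Qed.
Lemma kah_res (U V : opens X) (h : V `<=` U)
  (P : lmodType (fn X V)) (D : G V -> P) : kah_Phi D ->
  kah_Phi (fun x : G U => D (fres U V x) : rscal (fresm h) P).
Proof.
move=> [hD hM hc]; split=> [a b|a b|c Cc].
- by rewrite fresD // hD.
- by rewrite fresM // hM.
- by apply: hc; apply: C_res.
Qed.
Definition kaehler_psh : psh X :=
  @pp_psh _ X G (@fres k X) (fn_psh X) kah_Phi kah_gen kah_res.
Definition kaehler : omod X := sheafify kaehler_psh.
Definition kd U (f : fn X U) : kaehler U :=
  sheafify_unit kaehler_psh U (pgen (@kah_Phi U) f).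

Lemma kd_deriv U : derivation (@C U) (kaehler U) (@kd U).
Proof.
split=> [a b|a b|c hc]; rewrite /kd.
- by rewrite (derivD (kah_gen U)) hfD.
- by rewrite (derivM (kah_gen U)) hfD !hfZ.
- by rewrite (deriv_cst (kah_gen U)) // hf0.
Qed.
Lemma kd_rs (U V : opens X) f : V `<=` U -> kd (fres U V f) = rs U V (kd f).
Proof. by move=> h; rewrite /kd -hf_rs //= (pp_rs_gen kah_gen kah_res). Qed.

Section Lift.
Variables (Q : omod X) (D : forall U, fn X U -> Q U).
Hypothesis D_deriv : forall U, derivation (@C U) (Q U) (@D U).
Hypothesis D_rs : forall (U V : opens X) f, V `<=` U -> D (fres U V f) = rs U V (D f).
Definition klift : ohom kaehler Q := sheafify_lift
  (pp_hom (G := G) (fn_psh X) kah_gen kah_res D_deriv D_rs).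
Lemma kliftE U f : klift U (kd f) = @D U f.
Proof. by rewrite sheafify_liftE /= pres_ev_gen //; apply: D_deriv. Qed.
End Lift.
End Kaehler.

Section Omega.
Variables (k : fieldType) (X : rspace k).
Definition kcst (U : opens X) : set (fn X U) := range (@cst k X U).
Lemma kcst_res (U V : opens X) c : V `<=` U -> kcst c -> kcst (fres U V c).
Proof. by move=> h [a _ <-]; exists a; rewrite ?fres_cst. Qed.
Definition Omega : omod X := kaehler kcst_res.
Definition dd U (f : fn X U) : Omega U := kd kcst_res f.
End Omega.
Arguments Omega {k} X.

Section StructureModule.
Variables (k : fieldType) (X : rspace k).
Definition Osec (U : opens X) : lmodType (fn X U) := (fn X U)^o.
Definition Ors (U V : opens X) (s : Osec U) : Osec V := fres U V s.
Lemma Ors_lin (U V : opens X) a (s t : Osec U) : V `<=` U ->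
  Ors V (a *: s + t) = fres U V a *: Ors V s + Ors V t.
Proof. by move=> h; rewrite /Ors fresD // fresM. Qed.
Definition Omodule : omod X :=
  Omod (opsh := @Psh k X Osec Ors Ors_lin (fn_psh X)) (fn_glue X).
End StructureModule.
Arguments Omodule {k} X.

Section SheafHom.
Variables (k : fieldType) (X : rspace k) (M : psh X) (N : omod X).

Record shom (U : opens X) := Shom {
  shf_fun :> forall V : opens X, V `<=` U -> M V -> N V;
  shom_lin : forall (V : opens X) (h : V `<=` U) a s t,
    shf_fun h (a *: s + t) = a *: shf_fun h s + shf_fun h t;
  shom_rs : forall (V W : opens X) (h : V `<=` U) (h' : W `<=` U) s, W `<=` V ->
    shf_fun h' (rs V W s) = rs V W (shf_fun h s) }.
HB.instance Definition _ U := gen_eqMixin (shom U).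
HB.instance Definition _ U := gen_choiceMixin (shom U).

Lemma shom_ext U (f g : shom U) : (forall V h s, f V h s = g V h s) -> f = g.
Proof.
case: f g => [f f1 f2] [g g1 g2] /= h.
have e : f = g.
  apply: functional_extensionality_dep => V; apply: functional_extensionality_dep => hV.
  by apply/funext => s; apply: h.
by case: _ / e in g1 g2 *; congr Shom; apply: Prop_irrelevance.
Qed.

Section Ops.
Variable U : opens X.
Implicit Types f g : shom U.
Section Lin.
Variables (c : fn X U) (f g : shom U).
Definition shom_comb (V : opens X) (h : V `<=` U) (s : M V) : N V :=
  fres U V c *: f V h s + g V h s.
Lemma shom_comb_lin (V : opens X) (h : V `<=` U) a s t :
  shom_comb h (a *: s + t) = a *: shom_comb h s + shom_comb h t.
Proof.
rewrite /shom_comb !shom_lin !scalerDr !scalerA [fres U V c * a]mulrC -!addrA.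
by congr (_ + _); rewrite addrCA.
Qed.
Lemma shom_comb_rs (V W : opens X) (h : V `<=` U) (h' : W `<=` U) s : W `<=` V ->
  shom_comb h' (rs V W s) = rs V W (shom_comb h s).
Proof.
by move=> hW; rewrite /shom_comb rs_lin // (psh_comp (fn_psh X)) // -!shom_rs.
Qed.
Definition shom_linc : shom U := Shom shom_comb_lin shom_comb_rs.
End Lin.
Lemma shom0_lin (V : opens X) (h : V `<=` U) a (s t : M V) : 0 = a *: 0 + 0 :> N V.
Proof. by rewrite scaler0 addr0. Qed.
Lemma shom0_rs (V W : opens X) (h : V `<=` U) (h' : W `<=` U) (s : M V) : W `<=` V ->
  0 = rs V W (0 : N V).
Proof. by move=> hW; rewrite rs0. Qed.
Definition shom0 : shom U := Shom shom0_lin shom0_rs.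
Definition shom_add f g := shom_linc 1 f g.
Definition shom_scale c f := shom_linc c f shom0.
Definition shom_opp f := shom_scale (-1) f.
Lemma shom_addE f g V h s : shom_add f g V h s = f V h s + g V h s.
Proof. by rewrite /= /shom_comb fres1 // scale1r. Qed.
Lemma shom_scaleE c f V h s : shom_scale c f V h s = fres U V c *: f V h s.
Proof. by rewrite /= /shom_comb addr0. Qed.
Lemma shom_oppE f V h s : shom_opp f V h s = - f V h s.
Proof. by rewrite shom_scaleE -(fresmE h) rmorphN1 scaleN1r. Qed.
Lemma shom_addA : associative shom_add.
Proof. by move=> f g e; apply: shom_ext => V h s; rewrite !shom_addE addrA. Qed.
Lemma shom_addC : commutative shom_add.
Proof. by move=> f g; apply: shom_ext => V h s; rewrite !shom_addE addrC. Qed.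
Lemma shom_add0 : left_id shom0 shom_add.
Proof. by move=> f; apply: shom_ext => V h s; rewrite !shom_addE add0r. Qed.
Lemma shom_addN : left_inverse shom0 shom_opp shom_add.
Proof.
by move=> f; apply: shom_ext => V h s; rewrite !shom_addE shom_oppE addNr.
Qed.
HB.instance Definition _ :=
  GRing.isZmodule.Build (shom U) shom_addA shom_addC shom_add0 shom_addN.
Lemma shom_scaleA a b f : shom_scale a (shom_scale b f) = shom_scale (a * b) f.
Proof.
by apply: shom_ext => V h s; rewrite !shom_scaleE scalerA -fresM.
Qed.
Lemma shom_scale1 : left_id 1 shom_scale.
Proof. by move=> f; apply: shom_ext => V h s; rewrite !shom_scaleE fres1 // scale1r. Qed.
Lemma shom_scaleDr : right_distributive shom_scale +%R.
Proof.
move=> a f g; apply: shom_ext => V h s.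
by rewrite !(shom_scaleE, shom_addE) scalerDr.
Qed.
Lemma shom_scaleDl f : {morph shom_scale^~ f : a b / a + b}.
Proof.
move=> a b; apply: shom_ext => V h s.
by rewrite !(shom_scaleE, shom_addE) fresD // scalerDl.
Qed.
HB.instance Definition _ := GRing.Zmodule_isLmodule.Build (fn X U) (shom U)
  shom_scaleA shom_scale1 shom_scaleDr shom_scaleDl.
End Ops.

Section Restrict.
Variables (U U' : opens X) (h : U' `<=` U) (f : shom U).
Definition shom_res_fun (V : opens X) (hV : V `<=` U') : M V -> N V :=
  f V (subset_trans hV h).
Lemma shom_res_lin (V : opens X) (hV : V `<=` U') a s t :
  shom_res_fun hV (a *: s + t) = a *: shom_res_fun hV s + shom_res_fun hV t.
Proof. exact: shom_lin. Qed.
Lemma shom_res_rs (V W : opens X) (hV : V `<=` U') (h' : W `<=` U') s : W `<=` V ->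
  shom_res_fun h' (rs V W s) = rs V W (shom_res_fun hV s).
Proof. exact: shom_rs. Qed.
Definition shom_res : shom U' := Shom shom_res_lin shom_res_rs.
End Restrict.

Definition shom_r (U U' : opens X) (f : shom U) : shom U' :=
  match pselect (U' `<=` U) with left h => shom_res h f | right _ => 0 end.
Lemma shom_rE (U U' : opens X) (f : shom U) (V : opens X) (hU : U' `<=` U)
  (h : V `<=` U') (h' : V `<=` U) s : shom_r U' f V h s = f V h' s.
Proof.
rewrite /shom_r; case: pselect => // h1 /=; rewrite /shom_res_fun.
by congr (shf_fun f _ s); apply: Prop_irrelevance.
Qed.

Lemma shom_r_lin (U V : opens X) a (f g : shom U) : V `<=` U ->
  shom_r V (a *: f + g) = fres U V a *: shom_r V f + shom_r V g.
Proof.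
move=> hV; apply: shom_ext => W h s; have h' := subset_trans h hV.
rewrite (shom_rE _ hV h h') !(shom_addE, shom_scaleE) !(shom_rE _ hV h h').
by rewrite (psh_comp (fn_psh X)).
Qed.
Lemma shom_is_presheaf : is_presheaf shom_r.
Proof.
split=> [U f|U V W f hV hW]; apply: shom_ext => O h s; first exact: shom_rE.
have hOV := subset_trans h hW; have hOU := subset_trans hOV hV.
by rewrite (shom_rE _ hW h hOV) (shom_rE _ hV hOV hOU) (shom_rE _ _ h hOU) //;
   apply: subset_trans hV.
Qed.

Lemma shom_is_gluing : is_gluing shom_r.
Proof.
split=> [U f g e|U V f hV hc].
  apply: shom_ext => W h s; apply: (sheaf_sep (omodP N)) => x Wx.
  have [V [Vx hV eV]] := e x (h _ Wx).
  have hl := @oIl _ W V; have hr := @oIr _ W V; have hU := subset_trans hl h.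
  exists (oI W V); split=> //.
  by rewrite -!(shom_rs _ _ hU) // -(shom_rE f hV hr hU) -(shom_rE g hV hr hU) eV.
pose p (W : opens X) (h : W `<=` U) (s : M W) (t : N W) := forall x, oset U x ->
  forall (O : opens X) (hO : O `<=` V x), O `<=` W -> rs W O t = f x O hO (rs W O s).
have ex (W : opens X) (h : W `<=` U) s : exists t, p W h s t.
  pose V' x := oI W (V x).
  have hV' x : oset W x -> oset (V' x) x /\ V' x `<=` W.
    by move=> Wx; split; [split=> //; case: (hV x (h _ Wx))|exact: oIl].
  have agree x y (O : opens X) (hx : O `<=` V x) (hy : O `<=` V y) u : oset U x -> oset U y ->
      f x O hx u = f y O hy u.
    move=> Ux Uy; have hO : O `<=` oI (V x) (V y) by exact: oIs.
    by rewrite -(shom_rE (f x) (@oIl _ _ _) hO hx) hc //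
               (shom_rE (f y) (@oIr _ _ _) hO hy).
  have [|t ht] := sheaf_glue (omodP N)
      (s := fun x => f x (V' x) (@oIr _ _ _) (rs W (V' x) s)) hV'.
    move=> x y Wx Wy; have hx := @oIl _ (V' x) (V' y); have hy := @oIr _ (V' x) (V' y).
    have hx' := subset_trans hx (@oIr _ W (V x)).
    have hy' := subset_trans hy (@oIr _ W (V y)).
    rewrite -(shom_rs _ _ hx' _ hx) -(shom_rs _ _ hy' _ hy).
    rewrite !rs_comp //; try exact: oIl.
    by apply: agree; apply: h.
  exists t => x Ux O hO hOW; apply: (sheaf_sep (omodP N)) => y Oy.
  have Wy := hOW _ Oy.
  pose O' := oI O (V' y); have hl : O' `<=` O by exact: oIl.
  have hr : O' `<=` V' y by exact: oIr.
  exists O'; split=> //; first by split=> //; case: (hV' y Wy).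
  rewrite rs_comp // -(rs_comp t (@oIl _ W (V y)) hr) ht //.
  have hOy := subset_trans hr (@oIr _ W (V y)); have hOx := subset_trans hl hO.
  rewrite -(shom_rs _ _ hOy _ hr) -(shom_rs _ _ hOx _ hl) !rs_comp //; try exact: oIl.
  by apply: agree => //; apply: h.
have un (W : opens X) (h : W `<=` U) s t t' : p W h s t -> p W h s t' -> t = t'.
  move=> ht ht'; apply: (sheaf_sep (omodP N)) => x Wx; have Ux := h _ Wx.
  exists (oI W (V x)); split; [by split=> //; case: (hV x Ux)|exact: oIl|].
  by rewrite (ht x Ux _ (@oIr _ _ _) (@oIl _ _ _))
             (ht' x Ux _ (@oIr _ _ _) (@oIl _ _ _)).
pose F (W : opens X) (h : W `<=` U) s := projT1 (cid (ex W h s)).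
have FP (W : opens X) (h : W `<=` U) s : p W h s (F W h s) by exact: (projT2 (cid (ex W h s))).
have Fl (W : opens X) (h : W `<=` U) a s t : F W h (a *: s + t) = a *: F W h s + F W h t.
  apply: (un W h _ _ _ (FP W h (a *: s + t))) => x Ux O hO hOW.
  by rewrite !rs_lin // (FP W h s x Ux O hO hOW) (FP W h t x Ux O hO hOW) shom_lin.
have Fr (W W' : opens X) (h : W `<=` U) (h' : W' `<=` U) s : W' `<=` W ->
    F W' h' (rs W W' s) = rs W W' (F W h s).
  move=> hW; apply: (un W' h' _ _ _ (FP W' h' _)) => x Ux O hO hOW.
  rewrite !rs_comp //; apply: FP => //; exact: subset_trans hW.
exists (Shom Fl Fr) => x Ux; have [_ hVx] := hV x Ux.
apply: shom_ext => W h s; have hU := subset_trans h hVx.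
rewrite (shom_rE _ hVx h hU) /=.
by rewrite -[LHS]rs_id (FP W hU s x Ux W h) // rs_id.
Qed.

Definition sHom : omod X := Omod (opsh := Psh shom_r_lin shom_is_presheaf) shom_is_gluing.
End SheafHom.

Notation sEnd E := (sHom (opsh E) E).

Section Submodule.
Variables (k : fieldType) (X : rspace k) (M : omod X).
Variable S : forall U, M U -> Prop.
Hypothesis S0 : forall U, S (0 : M U).
Hypothesis S_lin : forall U a (s t : M U), S s -> S t -> S (a *: s + t).
Hypothesis S_rs : forall (U V : opens X) (s : M U), V `<=` U -> S s -> S (rs U V s).
Hypothesis S_loc : forall (U : opens X) (s : M U), (forall x, oset U x ->
  exists V : opens X, [/\ oset V x, V `<=` U & S (rs U V s)]) -> S s.

Record subm (U : opens X) := Subm { subm_val : M U; subm_in : S subm_val }.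
HB.instance Definition _ U := gen_eqMixin (subm U).
HB.instance Definition _ U := gen_choiceMixin (subm U).
Lemma subm_ext U (s t : subm U) : subm_val s = subm_val t -> s = t.
Proof.
case: s t => [s hs] [t ht] /= e; case: _ / e in ht *.
by congr Subm; apply: Prop_irrelevance.
Qed.
Definition subm_comb U a (s t : subm U) : subm U :=
  Subm (S_lin a (subm_in s) (subm_in t)).
Definition subm_zero U : subm U := Subm (S0 U).
Definition subm_add U (s t : subm U) := subm_comb 1 s t.
Definition subm_scale U a (s : subm U) := subm_comb a s (subm_zero U).
Definition subm_opp U (s : subm U) := subm_scale (-1) s.
Lemma subm_addA U : associative (@subm_add U).
Proof. by move=> s t r; apply: subm_ext; rewrite /= !scale1r addrA. Qed.
Lemma subm_addC U : commutative (@subm_add U).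
Proof. by move=> s t; apply: subm_ext; rewrite /= !scale1r addrC. Qed.
Lemma subm_add0 U : left_id (subm_zero U) (@subm_add U).
Proof. by move=> s; apply: subm_ext; rewrite /= scale1r add0r. Qed.
Lemma subm_addN U : left_inverse (subm_zero U) (@subm_opp U) (@subm_add U).
Proof. by move=> s; apply: subm_ext; rewrite /= scale1r addr0 scaleN1r addNr. Qed.
HB.instance Definition _ U := GRing.isZmodule.Build (subm U)
  (@subm_addA U) (@subm_addC U) (@subm_add0 U) (@subm_addN U).
Lemma subm_scaleA U a b (s : subm U) :
  subm_scale a (subm_scale b s) = subm_scale (a * b) s.
Proof. by apply: subm_ext; rewrite /= !addr0 scalerA. Qed.
Lemma subm_scale1 U : left_id 1 (@subm_scale U).
Proof. by move=> s; apply: subm_ext; rewrite /= addr0 scale1r. Qed.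
Lemma subm_scaleDr U : right_distributive (@subm_scale U) +%R.
Proof. by move=> a s t; apply: subm_ext; rewrite /= !addr0 !scale1r scalerDr. Qed.
Lemma subm_scaleDl U (s : subm U) : {morph (@subm_scale U)^~ s : a b / a + b}.
Proof. by move=> a b; apply: subm_ext; rewrite /= !addr0 scale1r scalerDl. Qed.
HB.instance Definition _ U := GRing.Zmodule_isLmodule.Build (fn X U) (subm U)
  (@subm_scaleA U) (@subm_scale1 U) (@subm_scaleDr U) (@subm_scaleDl U).
Lemma subm_valD U (s t : subm U) : subm_val (s + t) = subm_val s + subm_val t.
Proof. by rewrite /= scale1r. Qed.
Lemma subm_valZ U a (s : subm U) : subm_val (a *: s) = a *: subm_val s.
Proof. by rewrite /= addr0. Qed.

Definition subm_rs (U V : opens X) (s : subm U) : subm V :=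
  match pselect (V `<=` U) with
  | left h => Subm (S_rs h (subm_in s)) | right _ => 0 end.
Lemma subm_rsE (U V : opens X) (s : subm U) : V `<=` U ->
  subm_val (subm_rs V s) = rs U V (subm_val s).
Proof. by rewrite /subm_rs; case: pselect. Qed.
Lemma subm_rs_lin (U V : opens X) a (s t : subm U) : V `<=` U ->
  subm_rs V (a *: s + t) = fres U V a *: subm_rs V s + subm_rs V t.
Proof.
move=> h; apply: subm_ext.
by rewrite !(subm_rsE, subm_valD, subm_valZ) // rs_lin.
Qed.
Lemma subm_is_presheaf : is_presheaf subm_rs.
Proof.
split=> [U s|U V W s hV hW]; apply: subm_ext; first by rewrite subm_rsE // rs_id.
by rewrite !subm_rsE ?rs_comp //; apply: subset_trans hV.
Qed.
Lemma subm_is_gluing : is_gluing subm_rs.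
Proof.
split=> [U s t e|U V s hV hc].
  apply: subm_ext; apply: (sheaf_sep (omodP M)) => x Ux.
  by have [V [Vx hV eV]] := e x Ux; exists V; split=> //; rewrite -!subm_rsE // eV.
have [|t ht] := sheaf_glue (omodP M) (s := fun x => subm_val (s x)) hV.
  move=> x y Ux Uy; rewrite -!subm_rsE; [|exact: oIr|exact: oIl].
  by rewrite hc.
have St : S t.
  apply: S_loc => x Ux; have [Vx hVx] := hV x Ux.
  by exists (V x); split=> //; rewrite ht //; apply: subm_in.
exists (Subm St) => x Ux; apply: subm_ext.
by rewrite subm_rsE /= ?ht //; case: (hV x Ux).
Qed.
Definition submod : omod X :=
  Omod (opsh := Psh subm_rs_lin subm_is_presheaf) subm_is_gluing.

Lemma subm_incl_lin U a (s t : submod U) :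
  subm_val (a *: s + t) = a *: subm_val s + subm_val t.
Proof. by rewrite subm_valD subm_valZ. Qed.
Lemma subm_incl_rs (U V : opens X) (s : submod U) : V `<=` U ->
  subm_val (rs U V s) = rs U V (subm_val s).
Proof. exact: subm_rsE. Qed.
Definition submod_incl : ohom submod M := Hom subm_incl_lin subm_incl_rs.

Section Corestrict.
Variables (N : psh X) (f : ohom N M) (hf_in : forall U s, S (f U s)).
Definition cores_fun U (s : N U) : submod U := Subm (hf_in s).
Lemma cores_lin U a (s t : N U) :
  cores_fun (a *: s + t) = a *: cores_fun s + cores_fun t.
Proof. by apply: subm_ext; rewrite subm_valD subm_valZ /= hf_lin. Qed.
Lemma cores_rs (U V : opens X) (s : N U) : V `<=` U ->
  cores_fun (rs U V s) = rs U V (cores_fun s).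
Proof. by move=> h; apply: subm_ext; rewrite subm_rsE //= hf_rs. Qed.
Definition submod_cores : ohom N submod := Hom cores_lin cores_rs.
End Corestrict.
End Submodule.

Definition inv_at (k : fieldType) (X : rspace k) (U : opens X) (f : fn X U) (x : X) : Prop :=
  exists V : opens X, [/\ oset V x, V `<=` U & exists g : fn X V, fres U V f * g = 1].

Record mor (k : fieldType) (Y X : rspace k) := Mor {
  mf :> Y -> X;
  mfc : continuous mf;
  msharp : forall U : opens X, {rmorphism fn X U -> fn Y (opre mfc U)};
  msharp_cst : forall U c, msharp U (cst U c) = cst (opre mfc U) c;
  msharp_res : forall (U V : opens X) f, V `<=` U ->
    msharp V (fres U V f) = fres (opre mfc U) (opre mfc V) (msharp U f);
  msharp_local : forall (U : opens X) f y, oset U (mf y) ->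
    inv_at (msharp U f) y -> inv_at f (mf y) }.

Definition preimo (k : fieldType) (Y X : rspace k) (p : mor Y X) (U : opens X) : opens Y :=
  opre (@mfc _ _ _ p) U.

Section Pushforward.
Variables (k : fieldType) (Y X : rspace k) (p : mor Y X) (F : omod Y).
Lemma preimS (U V : opens X) : V `<=` U -> preimo p V `<=` preimo p U.
Proof. by move=> h y; apply: h. Qed.
Definition psec (U : opens X) : lmodType (fn X U) := rscal (msharp p U) (F (preimo p U)).
Definition pf_rs (U V : opens X) (s : psec U) : psec V := rs (preimo p U) (preimo p V) s.
Lemma pf_rs_lin (U V : opens X) a (s t : psec U) : V `<=` U ->
  pf_rs V (a *: s + t) = fres U V a *: pf_rs V s + pf_rs V t.
Proof.
move=> h; rewrite /pf_rs [LHS]rs_lin; last exact: preimS.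
by rewrite -msharp_res.
Qed.
Lemma pf_is_presheaf : is_presheaf pf_rs.
Proof.
split=> [U s|U V W s hV hW]; first exact: rs_id.
by apply: rs_comp; apply: preimS.
Qed.
Lemma pf_is_gluing : is_gluing pf_rs.
Proof.
split=> [U s t e|U V s hV hc].
  apply: (sheaf_sep (omodP F)) => y Uy; have [V [Vy hV eV]] := e _ Uy.
  by exists (preimo p V); split=> //; apply: preimS.
have hV' y : oset (preimo p U) y ->
    oset (preimo p (V (p y))) y /\ preimo p (V (p y)) `<=` preimo p U.
  by move=> Uy; have [h1 h2] := hV _ Uy; split=> //; apply: preimS.
have agree x x' (O : opens Y) (h : O `<=` preimo p (V x)) (h' : O `<=` preimo p (V x')) :
    oset U x -> oset U x' -> rs _ O (s x : F _) = rs _ O (s x' : F _).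
  move=> Ux Ux'; have hO : O `<=` preimo p (oI (V x) (V x')).
    by move=> y Oy; split; [apply: h|apply: h'].
  have hl := preimS (@oIl _ (V x) (V x')); have hr := preimS (@oIr _ (V x) (V x')).
  rewrite -(rs_comp (s x : F _) hl hO) -(rs_comp (s x' : F _) hr hO).
  by congr (rs _ O _); exact: hc.
have [|t ht] := sheaf_glue (omodP F)
    (s := fun y => s (p y) : F (preimo p (V (p y)))) hV'.
  by move=> y y' Uy Uy'; apply: agree => //; [exact: oIl|exact: oIr].
exists t => x Ux; apply: (sheaf_sep (omodP F)) => y Vy.
have [_ hVU] := hV x Ux; have Uy : oset U (p y) by exact: hVU.
have hU := preimS hVU; pose O := oI (preimo p (V x)) (preimo p (V (p y))).
exists O; split; [by split=> //; case: (hV' y Uy)|exact: oIl|].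
rewrite [pf_rs _ _]/pf_rs rs_comp //; last exact: oIl.
have hr : O `<=` preimo p (V (p y)) by exact: oIr.
rewrite -(rs_comp t (proj2 (hV' y Uy)) hr) ht //.
by apply: agree => //; exact: oIl.
Qed.
Definition pushf : omod X := Omod (opsh := Psh pf_rs_lin pf_is_presheaf) pf_is_gluing.
End Pushforward.

Section PushforwardMap.
Variables (k : fieldType) (Y X : rspace k) (p : mor Y X) (F G : omod Y) (f : ohom F G).
Definition pushf_fun (U : opens X) (s : pushf p F U) : pushf p G U := f (preimo p U) s.
Lemma pushf_map_lin U a (s t : pushf p F U) :
  pushf_fun (a *: s + t) = a *: pushf_fun s + pushf_fun t.
Proof. exact: (hf_lin f (msharp p U a) s t). Qed.
Lemma pushf_map_rs (U V : opens X) (s : pushf p F U) : V `<=` U ->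
  pushf_fun (rs U V s) = rs U V (pushf_fun s).
Proof. by move=> h; exact: (hf_rs f s (preimS h)). Qed.
Definition pushf_map : ohom (pushf p F) (pushf p G) := Hom pushf_map_lin pushf_map_rs.
End PushforwardMap.

Section OpenPushforward.
Variables (k : fieldType) (X : rspace k) (W : opens X) (M : omod X).
Lemma oIS (U V : opens X) : V `<=` U -> oI V W `<=` oI U W.
Proof. by move=> h x [Vx Wx]; split=> //; apply: h. Qed.
Definition jsec (U : opens X) : lmodType (fn X U) :=
  rscal (fresm (@oIl _ U W)) (M (oI U W)).
Definition j_rs (U V : opens X) (s : jsec U) : jsec V := rs (oI U W) (oI V W) s.
Lemma j_rs_lin (U V : opens X) a (s t : jsec U) : V `<=` U ->
  j_rs V (a *: s + t) = fres U V a *: j_rs V s + j_rs V t.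
Proof.
move=> h; rewrite /j_rs [LHS]rs_lin; last exact: oIS.
rewrite fresmE (psh_comp (fn_psh X)); [|exact: oIl|exact: oIS].
congr (_ + _); rewrite -(psh_comp (fn_psh X) _ h) //; exact: oIl.
Qed.
Lemma j_is_presheaf : is_presheaf j_rs.
Proof.
split=> [U s|U V V' s hV hW]; first exact: rs_id.
by apply: rs_comp; apply: oIS.
Qed.
Lemma j_is_gluing : is_gluing j_rs.
Proof.
split=> [U s t e|U V s hV hc].
  apply: (sheaf_sep (omodP M)) => x [Ux Wx]; have [V [Vx hV eV]] := e _ Ux.
  by exists (oI V W); split=> //; apply: oIS.
have hV' x : oset (oI U W) x -> oset (oI (V x) W) x /\ oI (V x) W `<=` oI U W.
  by move=> [Ux Wx]; have [h1 h2] := hV _ Ux; split=> //; apply: oIS.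
have agree x x' (O : opens X) (h : O `<=` oI (V x) W) (h' : O `<=` oI (V x') W) :
    oset U x -> oset U x' -> rs _ O (s x : M _) = rs _ O (s x' : M _).
  move=> Ux Ux'; have hO : O `<=` oI (oI (V x) (V x')) W.
    by move=> z Oz; have [? ?] := h _ Oz; have [? ?] := h' _ Oz.
  have hl := oIS (@oIl _ (V x) (V x')); have hr := oIS (@oIr _ (V x) (V x')).
  rewrite -(rs_comp (s x : M _) hl hO) -(rs_comp (s x' : M _) hr hO).
  by congr (rs _ O _); exact: hc.
have [|t ht] := sheaf_glue (omodP M) (s := fun x => s x : M (oI (V x) W)) hV'.
  by move=> x y [Ux _] [Uy _]; apply: agree => //; [exact: oIl|exact: oIr].
exists t => x Ux; apply: (sheaf_sep (omodP M)) => y [Vy Wy].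
have [_ hVU] := hV x Ux; have Uy : oset U y by exact: hVU.
have hU := oIS hVU; pose O := oI (oI (V x) W) (oI (V y) W).
have m : oset (oI U W) y by [].
exists O; split; [by split=> //; case: (hV' y m)|exact: oIl|].
rewrite [j_rs _ _]/j_rs rs_comp //; last exact: oIl.
have hr : O `<=` oI (V y) W by exact: oIr.
rewrite -(rs_comp t (proj2 (hV' y m)) hr) ht //.
by apply: agree => //; exact: oIl.
Qed.
Definition jpush : omod X := Omod (opsh := Psh j_rs_lin j_is_presheaf) j_is_gluing.
End OpenPushforward.

(* First Cech cohomology of the restriction of M to the open set W, as the
   colimit over the coverings of W.  Every covering is refined by one of the
   form (cov x) with x in cov x, so only those are used.  Only the set H^1 and
   its base point are needed here. *)
Section Cohomology.
Variables (k : fieldType) (X : rspace k).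

Record cocycle (W : opens X) (M : psh X) := Cocycle {
  cov : X -> opens X;
  cval : forall x y, M (oI (cov x) (cov y));
  cov_in : forall x, oset W x -> oset (cov x) x /\ cov x `<=` W;
  cocycleP : forall x y z, oset W x -> oset W y -> oset W z ->
    forall O : opens X, O `<=` cov x -> O `<=` cov y -> O `<=` cov z ->
    rs _ O (cval x y) + rs _ O (cval y z) = rs _ O (cval x z) }.
HB.instance Definition _ W M := gen_eqMixin (cocycle W M).
HB.instance Definition _ W M := gen_choiceMixin (cocycle W M).

Section H1.
Variables (W : opens X) (M : psh X).
Implicit Types c : cocycle W M.

Definition cohomologous c c' : bool := `[< exists (V : X -> opens X) (b : forall x, M (V x)),
  (forall x, oset W x -> [/\ oset (V x) x, V x `<=` cov c x & V x `<=` cov c' x]) /\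
  (forall x y, oset W x -> oset W y ->
    forall O : opens X, O `<=` V x -> O `<=` V y ->
    rs _ O (cval c' x y) - rs _ O (cval c x y) = rs _ O (b y) - rs _ O (b x)) >].

Lemma cohomologous_refl : reflexive cohomologous.
Proof.
move=> c; apply/asboolP; exists (cov c), (fun=> 0); split.
  by move=> x Wx; have [? ?] := cov_in c Wx; split.
by move=> x y _ _ O hx hy; rewrite !rs0 // !subrr.
Qed.
Lemma cohomologous_sym : symmetric cohomologous.
Proof.
suff h c c' : cohomologous c c' -> cohomologous c' c.
  by move=> c c'; apply/idP/idP; apply: h.
move=> /asboolP[V [b [hV hb]]]; apply/asboolP; exists V, (fun x => - b x); split.
  by move=> x Wx; have [? ? ?] := hV x Wx; split.
move=> x y Wx Wy O hx hy.
by rewrite !rsN // -opprB (hb x y) // opprB opprK addrC.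
Qed.
Lemma cohomologous_trans : transitive cohomologous.
Proof.
move=> c' c c'' /asboolP[V [b [hV hb]]] /asboolP[V' [b' [hV' hb']]].
apply/asboolP; exists (fun x => oI (V x) (V' x)), (fun x => rs _ _ (b x) + rs _ _ (b' x)).
have hl x := @oIl _ (V x) (V' x); have hr x := @oIr _ (V x) (V' x).
split=> [x Wx|x y Wx Wy O hx hy].
  have [? h _] := hV x Wx; have [? _ h'] := hV' x Wx.
  by split=> //; [apply: subset_trans h|apply: subset_trans h'].
rewrite !rsD // !rs_comp //.
have e := hb x y Wx Wy O (subset_trans hx (hl x)) (subset_trans hy (hl y)).
have e' := hb' x y Wx Wy O (subset_trans hx (hr x)) (subset_trans hy (hr y)).
by rewrite opprD addrACA -e -e' addrC addrA subrK.
Qed.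
Canonical cohomologous_equiv := EquivRel cohomologous
  cohomologous_refl cohomologous_sym cohomologous_trans.
Definition H1 := {eq_quot cohomologous_equiv}%qT.
HB.instance Definition _ := Choice.on H1.
HB.instance Definition _ := Quotient.on H1.

Lemma zero_in x : oset W x -> oset W x /\ W `<=` W. Proof. by split. Qed.
Lemma zeroP (O : opens X) : O `<=` W -> O `<=` W -> O `<=` W ->
  rs _ O (0 : M (oI W W)) + rs _ O (0 : M (oI W W)) = rs _ O (0 : M (oI W W)).
Proof. by move=> h _ _; rewrite rs0 ?addr0 //; apply: oIs. Qed.
Definition zero_cocycle : cocycle W M :=
  @Cocycle W M (fun=> W) (fun _ _ => 0) zero_in (fun _ _ _ _ _ _ => zeroP).
Definition H1_zero : H1 := \pi_H1 zero_cocycle.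
End H1.

Section Push.
Variables (W : opens X) (M N : psh X) (f : ohom M N).
Section Cocycle.
Variable c : cocycle W M.
Definition push_val x y : N (oI (cov c x) (cov c y)) := f _ (cval c x y).
Lemma push_cocycleP x y z : oset W x -> oset W y -> oset W z ->
  forall O : opens X, O `<=` cov c x -> O `<=` cov c y -> O `<=` cov c z ->
  rs _ O (push_val x y) + rs _ O (push_val y z) = rs _ O (push_val x z).
Proof.
move=> Wx Wy Wz O hx hy hz; rewrite /push_val -!hf_rs; try exact: oIs.
by rewrite -hfD cocycleP.
Qed.
Definition push_cocycle : cocycle W N := Cocycle (@cov_in _ _ c) push_cocycleP.
End Cocycle.
Definition push (a : H1 W M) : H1 W N := \pi_(H1 W N) (push_cocycle (repr a)).
End Push.

Section Restriction.
Variables (W W' : opens X) (h : W' `<=` W) (M : psh X).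
Section Cocycle.
Variable c : cocycle W M.
Definition restr_cov x : opens X := oI (cov c x) W'.
Definition restr_val x y : M (oI (restr_cov x) (restr_cov y)) := rs _ _ (cval c x y).
Lemma restr_in x : oset W' x -> oset (restr_cov x) x /\ restr_cov x `<=` W'.
Proof.
move=> Wx; split; last exact: oIr.
by split=> //; case: (cov_in c (h Wx)).
Qed.
Lemma restr_cocycleP x y z : oset W' x -> oset W' y -> oset W' z ->
  forall O : opens X, O `<=` restr_cov x -> O `<=` restr_cov y -> O `<=` restr_cov z ->
  rs _ O (restr_val x y) + rs _ O (restr_val y z) = rs _ O (restr_val x z).
Proof.
move=> Wx Wy Wz O hx hy hz.
have s u v : oI (restr_cov u) (restr_cov v) `<=` oI (cov c u) (cov c v).
  by move=> t [[? _] [? _]].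
rewrite /restr_val !rs_comp //; try exact: oIs.
by apply: cocycleP; [exact: h|exact: h|exact: h| | |];
  apply: subset_trans (@oIl _ _ _); eassumption.
Qed.
Definition restr_cocycle : cocycle W' M := Cocycle restr_in restr_cocycleP.
End Cocycle.
Definition restr (a : H1 W M) : H1 W' M := \pi_(H1 W' M) (restr_cocycle (repr a)).
End Restriction.
End Cohomology.
Arguments H1 {k X} W M.
Arguments H1_zero {k X} W M.
Arguments push {k X} W {M N} f a.
Arguments restr {k X W W'} h {M} a.

(* H^1(W, p_* F) -> H^1(p^-1 W, F) and, when it is bijective, its inverse. *)
Section Pullback.
Variables (k : fieldType) (Y X : rspace k) (p : mor Y X) (F : omod Y) (W : opens X).
Section Cocycle.
Variable c : cocycle W (pushf p F).
Definition pull_cov y : opens Y := preimo p (cov c (p y)).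
Definition pull_val y y' : F (oI (pull_cov y) (pull_cov y')) :=
  rs (preimo p (oI (cov c (p y)) (cov c (p y')))) _ (cval c (p y) (p y') : F _).
Lemma pull_in y : oset (preimo p W) y -> oset (pull_cov y) y /\ pull_cov y `<=` preimo p W.
Proof.
by move=> Wy; have [h1 h2] := cov_in c (Wy : oset W (p y)); split=> //; apply: preimS.
Qed.
Lemma pull_cocycleP x y z :
  oset (preimo p W) x -> oset (preimo p W) y -> oset (preimo p W) z ->
  forall O : opens Y, O `<=` pull_cov x -> O `<=` pull_cov y -> O `<=` pull_cov z ->
  rs _ O (pull_val x y) + rs _ O (pull_val y z) = rs _ O (pull_val x z).
Proof.
move=> Wx Wy Wz O hx hy hz.
pose T := oI (cov c (p x)) (oI (cov c (p y)) (cov c (p z))).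
have hO : O `<=` preimo p T.
  by move=> t Ot; split; [exact: hx|split; [exact: hy|exact: hz]].
have hTx : T `<=` cov c (p x) by exact: oIl.
have hTy : T `<=` cov c (p y) by move=> t [_ []].
have hTz : T `<=` cov c (p z) by move=> t [_ []].
have s u v : oI (pull_cov u) (pull_cov v) `<=` preimo p (oI (cov c (p u)) (cov c (p v))).
  by [].
have r u v : O `<=` pull_cov u -> O `<=` pull_cov v ->
    T `<=` cov c (p u) -> T `<=` cov c (p v) ->
    rs _ O (pull_val u v) =
    rs (preimo p T) O (rs (oI (cov c (p u)) (cov c (p v))) T (cval c (p u) (p v)) : F _).
  move=> hu hv hTu hTv; rewrite /pull_val rs_comp //; last exact: oIs.
  by rewrite -(rs_comp _ (preimS (oIs hTu hTv)) hO).
rewrite !r // -rsD //; congr (rs _ _ _).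
exact: (@cocycleP _ _ _ _ c (p x) (p y) (p z) Wx Wy Wz T hTx hTy hTz).
Qed.
Definition pull_cocycle : cocycle (preimo p W) F := Cocycle pull_in pull_cocycleP.
End Cocycle.
Definition pull (a : H1 W (pushf p F)) : H1 (preimo p W) F :=
  \pi_(H1 (preimo p W) F) (pull_cocycle (repr a)).
Definition pull_inv (a : H1 (preimo p W) F) : H1 W (pushf p F) :=
  xget (H1_zero W (pushf p F)) [set b | pull b = a].
End Pullback.
Arguments pull {k Y X} p F W a.
Arguments pull_inv {k Y X} p F W a.

Section TensorTheory.
Variables (k : fieldType) (X : rspace k) (M N : psh X) (U : opens X).
Implicit Types (m : M U) (n : N U).
Lemma tpureDl m m' n : tpure (m + m') n = tpure m n + tpure m' n.
Proof. by rewrite -[m in LHS]scale1r tpure_l !scale1r. Qed.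
Lemma tpureDr m n n' : tpure m (n + n') = tpure m n + tpure m n'.
Proof. by rewrite -[n in LHS]scale1r tpure_r !scale1r. Qed.
Lemma tpure0l n : tpure (0 : M U) n = 0.
Proof. by apply: (addrI (tpure 0 n)); rewrite -tpureDl !addr0. Qed.
Lemma tpure0r m : tpure m (0 : N U) = 0.
Proof. by apply: (addrI (tpure m 0)); rewrite -tpureDr !addr0. Qed.
Lemma tpureZl a m n : tpure (a *: m) n = a *: tpure m n.
Proof. by rewrite -[a *: m]addr0 tpure_l tpure0l addr0. Qed.
Lemma tpureZr a m n : tpure m (a *: n) = a *: tpure m n.
Proof. by rewrite -[a *: n]addr0 tpure_r tpure0r addr0. Qed.
End TensorTheory.

(* First-order jets of F: pairs (s, w) with a . (s, w) = (a s, a w + da (x) s),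
   so that O-linear splittings of J^1(F) -> F are connections on F. *)
Definition jet_sec (k : fieldType) (X : rspace k) (F : omod X) (U : opens X) : Type :=
  (F U * tensor (Omega X) F U)%type.

Section Jets.
Variables (k : fieldType) (X : rspace k) (F : omod X).
Local Notation OF := (tensor (Omega X) F).
HB.instance Definition _ U := GRing.Zmodule.copy (jet_sec F U) (F U * OF U)%type.
Definition jscale U (a : fn X U) (j : jet_sec F U) : jet_sec F U :=
  (a *: j.1, a *: j.2 + tpure (dd a) j.1).
Let hd U := kd_deriv (kcst_res (X := X)) U.
Lemma jscaleA U a b (j : jet_sec F U) : jscale a (jscale b j) = jscale (a * b) j.
Proof.
case: j => s w; rewrite /jscale /= scalerA; congr pair.
rewrite scalerDr scalerA -addrA; congr (_ + _).
by rewrite /dd (derivM (hd U)) tpureDl !tpureZl tpureZr.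
Qed.
Lemma jscale1 U : left_id 1 (@jscale U).
Proof.
case=> s w; rewrite /jscale /= !scale1r /dd -(rmorph1 (@cst k X U)).
by rewrite (deriv_cst (hd U)) ?tpure0l ?addr0 //; exists 1.
Qed.
Lemma jscaleDr U : right_distributive (@jscale U) +%R.
Proof.
move=> a [s w] [s' w']; rewrite /jscale /= scalerDr; congr pair.
by rewrite scalerDr tpureDr addrACA.
Qed.
Lemma jscaleDl U (j : jet_sec F U) : {morph (@jscale U)^~ j : a b / a + b}.
Proof.
case: j => s w a b; rewrite /jscale /= scalerDl; congr pair.
by rewrite scalerDl /dd (derivD (hd U)) tpureDl addrACA.
Qed.
HB.instance Definition _ U := GRing.Zmodule_isLmodule.Build (fn X U) (jet_sec F U)
  (@jscaleA U) (@jscale1 U) (@jscaleDr U) (@jscaleDl U).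

Definition jets_rs (U V : opens X) (j : jet_sec F U) : jet_sec F V :=
  (rs U V j.1, rs U V j.2).
Lemma jets_rs_lin (U V : opens X) a (s t : jet_sec F U) : V `<=` U ->
  jets_rs V (a *: s + t) = fres U V a *: jets_rs V s + jets_rs V t.
Proof.
case: s t => [s w] [s' w'] h; congr pair; first exact: rs_lin.
transitivity (rs U V (a *: w + tpure (dd a) s) + rs U V w'); first exact: rsD.
by rewrite rsD // rsZ // -tpure_rs // /dd -kd_rs.
Qed.
Lemma jets_is_presheaf : is_presheaf jets_rs.
Proof.
split=> [U [s w]|U V W [s w] hV hW]; congr pair.
- exact: rs_id.
- exact: rs_id.
- exact: rs_comp.
- exact: rs_comp.
Qed.
Lemma jets_is_gluing : is_gluing jets_rs.
Proof.
split=> [U [s w] [s' w'] e|U V j hV hc].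
  by congr pair; [apply: (sheaf_sep (omodP F))|apply: (sheaf_sep (omodP OF))];
    move=> x Ux; have [V [Vx hV [e1 e2]]] := e x Ux; exists V.
have [|s hs] := sheaf_glue (omodP F) (s := fun x => (j x).1) hV.
  by move=> x y Ux Uy; case: (hc x y Ux Uy).
have [|w hw] := sheaf_glue (omodP OF) (s := fun x => (j x).2) hV.
  by move=> x y Ux Uy; case: (hc x y Ux Uy).
exists (s, w) => x Ux; rewrite [RHS]surjective_pairing -(hs x Ux) -(hw x Ux).
by [].
Qed.
Definition jets : omod X := Omod (opsh := Psh jets_rs_lin jets_is_presheaf) jets_is_gluing.

Definition jets_in_fun U (w : OF U) : jets U := (0, w).
Lemma jets_in_lin U a (s t : OF U) :
  jets_in_fun (a *: s + t) = a *: jets_in_fun s + jets_in_fun t.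
Proof. by congr pair; rewrite /= ?scaler0 ?addr0 // tpure0r addr0. Qed.
Lemma jets_in_rs (U V : opens X) (s : OF U) : V `<=` U ->
  jets_in_fun (rs U V s) = rs U V (jets_in_fun s).
Proof. by move=> h; congr pair; rewrite /= rs0. Qed.
Definition jets_in : ohom OF jets := Hom jets_in_lin jets_in_rs.

Definition jets_pr_fun U (j : jets U) : F U := j.1.
Lemma jets_pr_lin U a (s t : jets U) :
  jets_pr_fun (a *: s + t) = a *: jets_pr_fun s + jets_pr_fun t.
Proof. by []. Qed.
Lemma jets_pr_rs (U V : opens X) (s : jets U) : V `<=` U ->
  jets_pr_fun (rs U V s) = rs U V (jets_pr_fun s).
Proof. by []. Qed.
Definition jets_pr : ohom jets F := Hom jets_pr_lin jets_pr_rs.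
End Jets.

(* The class in H^1(W, Hom(F, A)) of an extension 0 -> A -> J -> F -> 0 which
   splits locally on W: the image of id_F under the connecting map, that is
   the differences of local splittings. *)
Section Extension.
Variables (k : fieldType) (X : rspace k) (A J F : omod X) (i : ohom A J) (p : ohom J F).
Variable W : opens X.

Definition represents_ext (c : cocycle W (sHom F A)) : Prop :=
  exists sigma : forall x, sHom F J (cov c x),
    (forall x, oset W x -> forall (V : opens X) (h : V `<=` cov c x) (s : F V),
       p V ((sigma x : shom F J _) V h s) = s) /\
    (forall x y, oset W x -> oset W y ->
     forall (V : opens X) (hx : V `<=` cov c x) (hy : V `<=` cov c y) (s : F V),
       i V ((cval c x y : shom F A _) V (oIs hx hy) s) =
       (sigma y : shom F J _) V hy s - (sigma x : shom F J _) V hx s).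

Definition ext_class : H1 W (sHom F A) :=
  xget (H1_zero W (sHom F A))
    [set a | exists2 c, represents_ext c & a = \pi_(H1 W (sHom F A)) c].
End Extension.

(* M (x) End(F) -> Hom(F, M (x) F) *)
Section Evaluation.
Variables (k : fieldType) (X : rspace k) (M F : omod X).
Section Fun.
Variables (U : opens X) (m : M U) (f : shom F F U).
Definition tev_fun (V : opens X) (h : V `<=` U) (s : F V) : tensor M F V :=
  tpure (rs U V m) (f V h s).
Lemma tev_fun_lin (V : opens X) (h : V `<=` U) a s t :
  tev_fun h (a *: s + t) = a *: tev_fun h s + tev_fun h t.
Proof. by rewrite /tev_fun shom_lin tpure_r. Qed.
Lemma tev_fun_rs (V V' : opens X) (h : V `<=` U) (h' : V' `<=` U) s : V' `<=` V ->
  tev_fun h' (rs V V' s) = rs V V' (tev_fun h s).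
Proof.
by move=> hV; rewrite /tev_fun (shom_rs _ h h') // -tpure_rs // rs_comp.
Qed.
Definition tev_val : sHom F (tensor M F) U := Shom tev_fun_lin tev_fun_rs.
End Fun.
Let g U (m : M U) (f : sEnd F U) : sHom F (tensor M F) U := tev_val m f.
Lemma tev_l U a m m' f : @g U (a *: m + m') f = a *: g m f + g m' f.
Proof.
apply: shom_ext => V h s; rewrite shom_addE shom_scaleE /= /tev_fun.
by rewrite rs_lin // tpure_l.
Qed.
Lemma tev_r U a m f f' : @g U m (a *: f + f') = a *: g m f + g m f'.
Proof.
apply: shom_ext => V h s; rewrite shom_addE shom_scaleE /= /tev_fun.
by rewrite shom_addE shom_scaleE tpure_r.
Qed.
Lemma tev_rs (U V : opens X) (m : M U) (f : sEnd F U) : V `<=` U ->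
  g (rs U V m) (rs U V f) = rs U V (g m f).
Proof.
move=> hV; apply: shom_ext => W h s; have h' := subset_trans h hV.
by rewrite (shom_rE _ hV h h') /= /tev_fun (shom_rE _ hV h h') rs_comp.
Qed.
Definition tev : ohom (tensor M (sEnd F)) (sHom F (tensor M F)) := tlift tev_l tev_r tev_rs.
End Evaluation.

(* For F locally free, H^1(Omega (x) End(F)) -> H^1(Hom(F, Omega (x) F)) is
   bijective, and At F is the preimage of the class of the jet extension. *)
Definition At (k : fieldType) (X : rspace k) (W : opens X) (F : omod X) :
    H1 W (tensor (Omega X) (sEnd F)) :=
  xget (H1_zero W _)
    [set a | push W (tev (Omega X) F) a = ext_class (jets_in F) (jets_pr F) W].

(* For a line bundle L, Omega = Omega (x) End(L) by w |-> w (x) id. *)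
Section LineBundle.
Variables (k : fieldType) (X : rspace k) (L : omod X).
Lemma sid_lin (U V : opens X) (h : V `<=` U) a (s t : L V) : a *: s + t = a *: s + t.
Proof. by []. Qed.
Lemma sid_rs (U V W : opens X) (h : V `<=` U) (h' : W `<=` U) (s : L V) :
  W `<=` V -> rs V W s = rs V W s.
Proof. by []. Qed.
Definition sid U : sEnd L U := @Shom _ _ _ _ U (fun _ _ s => s) (@sid_lin U) (@sid_rs U).
Let g U (w : Omega X U) : tensor (Omega X) (sEnd L) U := tpure w (sid U).
Lemma tid_lin U a s t : @g U (a *: s + t) = a *: g s + g t.
Proof. exact: tpure_l. Qed.
Lemma tid_rs (U V : opens X) (s : Omega X U) : V `<=` U -> g (rs U V s) = rs U V (g s).
Proof.
move=> h; rewrite /g -tpure_rs //; congr tpure.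
by apply: shom_ext => W hW t; rewrite (shom_rE _ h hW (subset_trans hW h)).
Qed.
Definition tid : ohom (Omega X) (tensor (Omega X) (sEnd L)) := Hom tid_lin tid_rs.

Definition AtL (W : opens X) : H1 W (Omega X) :=
  xget (H1_zero W _) [set a | push W tid a = At W L].
End LineBundle.

Section Differentials.
Variables (k : fieldType) (Y X : rspace k) (p : mor Y X).

Definition dpull_d U (f : fn X U) : pushf p (Omega Y) U := dd (msharp p U f).
Lemma dpull_deriv U : derivation (@kcst k X U) (pushf p (Omega Y) U) (@dpull_d U).
Proof.
have hd := kd_deriv (kcst_res (X := Y)) (preimo p U).
split=> [a b|a b|c [a _ <-]]; rewrite /dpull_d /dd.
- by rewrite rmorphD (derivD hd).
- by rewrite rmorphM (derivM hd).
- by rewrite msharp_cst (deriv_cst hd) //; exists a.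
Qed.
Lemma dpull_rs (U V : opens X) f : V `<=` U ->
  dpull_d (fres U V f) = rs U V (dpull_d f).
Proof.
by move=> h; rewrite /dpull_d msharp_res // /dd kd_rs //; apply: preimS.
Qed.
Definition dpull : ohom (Omega X) (pushf p (Omega Y)) :=
  klift (kcst_res (X := X)) dpull_deriv dpull_rs.

(* Omega_X (x) p_* O_Y -> p_* Omega_Y, w (x) b |-> b p^*w *)
Local Notation B := (pushf p (Omodule Y)).
Let g U (w : Omega X U) (b : B U) : pushf p (Omega Y) U :=
  (b : fn Y (preimo p U)) *: (dpull U w : Omega Y (preimo p U)).
Lemma kappa_l U a w w' b : @g U (a *: w + w') b = a *: g w b + g w' b.
Proof.
by rewrite /g hf_lin scalerDr [in LHS]scalerA mulrC -scalerA.
Qed.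
Lemma kappa_r U a w b b' : @g U w (a *: b + b') = a *: g w b + g w b'.
Proof. by rewrite /g scalerDl -scalerA. Qed.
Lemma kappa_rs (U V : opens X) (w : Omega X U) (b : B U) : V `<=` U ->
  g (rs U V w) (rs U V b) = rs U V (g w b).
Proof.
move=> h; rewrite /g hf_rs //; symmetry.
exact: (rsZ (b : fn Y (preimo p U)) (dpull U w : Omega Y _) (preimS h)).
Qed.
Definition kappa : ohom (tensor (Omega X) B) (pushf p (Omega Y)) :=
  tlift kappa_l kappa_r kappa_rs.

Definition rel_cst (V : opens Y) : set (fn Y V) :=
  [set f | exists (U : opens X) (g : fn X U),
     V `<=` preimo p U /\ f = fres (preimo p U) V (msharp p U g)].
Lemma rel_cst_res (U V : opens Y) c : V `<=` U -> rel_cst c -> rel_cst (fres U V c).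
Proof.
move=> h [W [g0 [hW ->]]]; exists W, g0; split; first exact: subset_trans hW.
by rewrite (psh_comp (fn_psh Y)).
Qed.
Definition OmegaRel : omod Y := kaehler rel_cst_res.
End Differentials.

(* The zeroth Fitting ideal: locally, if M is generated by m_1, ..., m_n, the
   ideal generated by the determinants of the n x n matrices of relations
   between the m_j. *)
Section Fitting.
Variables (k : fieldType) (X : rspace k) (M : omod X).
Definition generates (V : opens X) n (m : 'I_n -> M V) : Prop :=
  forall (W : opens X) (s : M W) x, W `<=` V -> oset W x ->
  exists O : opens X, [/\ oset O x, O `<=` W &
    exists a : 'I_n -> fn X O, rs W O s = \sum_j a j *: rs V O (m j)].
Definition fitting0 (U : opens X) (f : fn X U) : Prop :=
  forall x, oset U x -> exists V : opens X, [/\ oset V x, V `<=` U &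
  exists n (m : 'I_n -> M V) r (c : 'I_r -> fn X V) (A : 'I_r -> 'M[fn X V]_n),
    [/\ generates m,
        forall l i, \sum_j A l i j *: m j = 0 &
        fres U V f = \sum_l c l * \det (A l)]].
End Fitting.

Section Ideals.
Variables (k : fieldType) (X : rspace k) (I : forall U : opens X, fn X U -> Prop).

Definition cosupp_set : set X := \bigcup_(V in [set V : opens X | I (1 : fn X V)]) oset V.
Lemma cosupp_open : open cosupp_set.
Proof. by apply: bigcup_open => V _; apply: osetP. Qed.
(* The complement of the zero locus of I. *)
Definition cosupp : opens X := Opens cosupp_open.

Definition reduced_ideal : Prop := forall (U : opens X) (f : fn X U) n, I (f ^+ n) -> I f.
End Ideals.

(* Omega_X(log D) on a curve, for the divisor D with ideal I and complement W:
   the forms w on W such that f w is regular for every local section f of I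
   (dw = 0 imposes no further condition). *)
Section LogForms.
Variables (k : fieldType) (X : rspace k) (I : forall U : opens X, fn X U -> Prop).
Hypothesis I_res : forall (U V : opens X) f, V `<=` U -> I f -> I (fres U V f).
Local Notation W := (cosupp I).

Definition is_log (U : opens X) (w : jpush W (Omega X) U) : Prop :=
  forall (V : opens X) (f : fn X V) x, V `<=` U -> I f -> oset V x ->
  exists O : opens X, [/\ oset O x, O `<=` V & exists eta : Omega X O,
    rs O (oI O W) eta = fres V (oI O W) f *: rs (oI U W) (oI O W) (w : Omega X _)].

Lemma is_log0 U : is_log (0 : jpush W (Omega X) U).
Proof.
move=> V f x hV If Vx; exists V; split=> //; exists 0.
rewrite rs0; last exact: oIl.
by rewrite rs0 ?scaler0 //; apply: oIS.
Qed.
Lemma is_log_lin U a (s t : jpush W (Omega X) U) :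
  is_log s -> is_log t -> is_log (a *: s + t).
Proof.
move=> hs ht V f x hV If Vx.
have [O [Ox OV [eta e]]] := hs V f x hV If Vx.
have [O' [Ox' OV' [eta' e']]] := ht V f x hV If Vx.
pose T := oI O O'; have hl : T `<=` O by exact: oIl.
have hr : T `<=` O' by exact: oIr.
have TU : T `<=` U by apply: subset_trans hV; apply: subset_trans OV.
exists T; split=> //; first exact: subset_trans OV.
exists (fres U T a *: rs O T eta + rs O' T eta').
have hT : oI T W `<=` T by exact: oIl.
have TWU : oI T W `<=` oI U W by exact: oIS.
have TWO : oI T W `<=` oI O W by exact: oIS.
have TWO' : oI T W `<=` oI O' W by exact: oIS.
have TV : oI T W `<=` V by apply: subset_trans OV; apply: subset_trans hl.
have -> : rs (oI U W) (oI T W) (a *: s + t : jpush W (Omega X) U) =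
    fres U (oI T W) a *: rs (oI U W) (oI T W) (s : Omega X (oI U W)) +
    rs (oI U W) (oI T W) (t : Omega X (oI U W)) :> Omega X (oI T W).
  rewrite [LHS]rs_lin // fresmE (psh_comp (fn_psh X)) //; exact: oIl.
rewrite rs_lin // !rs_comp // (psh_comp (fn_psh X)) //.
rewrite -(rs_comp eta (@oIl _ O W) TWO) e rsZ // (psh_comp (fn_psh X)) //; last first.
  by apply: subset_trans OV; apply: oIl.
rewrite -(rs_comp eta' (@oIl _ O' W) TWO') e' rsZ // (psh_comp (fn_psh X)) //; last first.
  by apply: subset_trans OV'; apply: oIl.
rewrite !rs_comp //; try exact: oIS; try (by apply: oIS; apply: subset_trans hV).
by rewrite scalerDr !scalerA mulrC.
Qed.
Lemma is_log_rs (U V : opens X) (s : jpush W (Omega X) U) : V `<=` U ->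
  is_log s -> is_log (rs U V s).
Proof.
move=> h hs V' f x hV' If Vx.
have [O [Ox OV [eta e]]] := hs V' f x (subset_trans hV' h) If Vx.
exists O; split=> //; exists eta; rewrite e; congr (_ *: _); symmetry.
by apply: rs_comp; apply: oIS => //; apply: subset_trans OV _.
Qed.
Lemma is_log_loc (U : opens X) (s : jpush W (Omega X) U) :
  (forall x, oset U x ->
    exists V : opens X, [/\ oset V x, V `<=` U & is_log (rs U V s)]) -> is_log s.
Proof.
move=> h V f x hV If Vx; have [V' [Vx' hV' hs]] := h x (hV _ Vx).
have hl := @oIl _ V V'; have hr := @oIr _ V V'.
have [O [Ox OV [eta e]]] := hs (oI V V') _ x hr (I_res hl If) (conj Vx Vx').
exists O; split=> //; first exact: subset_trans hl.
exists eta; rewrite e (psh_comp (fn_psh X)) //; last by apply: subset_trans OV; apply: oIl.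
congr (_ *: _); apply: rs_comp; first exact: oIS.
by apply: oIS; apply: subset_trans hr.
Qed.
Definition OmegaLog : omod X := submod is_log0 is_log_lin is_log_rs is_log_loc.

Definition klog_fun U (w : Omega X U) : jpush W (Omega X) U := rs U (oI U W) w.
Lemma klog_lin U a (s t : Omega X U) :
  klog_fun (a *: s + t) = a *: klog_fun s + klog_fun t.
Proof. exact: (rs_lin a s t (@oIl _ U W)). Qed.
Lemma klog_rs (U V : opens X) (s : Omega X U) : V `<=` U ->
  klog_fun (rs U V s) = rs U V (klog_fun s).
Proof.
move=> h; rewrite /klog_fun rs_comp //; last exact: oIl.
symmetry; exact: (rs_comp s (@oIl _ U W) (@oIS _ _ W U V h)).
Qed.
Definition klog_hom : ohom (Omega X) (jpush W (Omega X)) := Hom klog_lin klog_rs.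
Lemma klog_in U (s : Omega X U) : is_log (klog_hom U s).
Proof.
move=> V f x hV If Vx; exists V; split=> //; exists (f *: rs U V s).
rewrite rsZ; last exact: oIl.
rewrite rs_comp //; last exact: oIl.
by congr (_ *: _); symmetry; apply: rs_comp; [exact: oIl|exact: oIS].
Qed.
Definition klog : ohom (Omega X) OmegaLog :=
  submod_cores is_log0 is_log_lin is_log_rs is_log_loc klog_in.
End LogForms.

(* The saturation of the image of m in M: the kernel of
   M -> (M / m(N)) / torsion. *)
Section Saturation.
Variables (k : fieldType) (X : rspace k) (N : psh X) (M : omod X) (m : ohom N M).

Definition nzd (V : opens X) (a : fn X V) : Prop :=
  forall (W : opens X) (c : fn X W), W `<=` V -> fres V W a * c = 0 -> c = 0.
Definition in_sat (U : opens X) (s : M U) : Prop :=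
  forall x, oset U x -> exists V : opens X, [/\ oset V x, V `<=` U &
    exists (a : fn X V) (b : N V), nzd a /\ a *: rs U V s = m V b].

Lemma nzd_rs (V V' : opens X) (a : fn X V) : V' `<=` V -> nzd a -> nzd (fres V V' a).
Proof.
move=> h ha W c hW; rewrite (psh_comp (fn_psh X)) //.
by apply: ha; apply: subset_trans h.
Qed.
Lemma nzdM (V : opens X) (a b : fn X V) : nzd a -> nzd b -> nzd (a * b).
Proof. by move=> ha hb W c hW; rewrite fresM // -mulrA => /ha-/(_ hW)/hb; apply. Qed.
Lemma nzd1 (V : opens X) : nzd (1 : fn X V).
Proof. by move=> W c hW; rewrite fres1 // mul1r. Qed.

Lemma in_sat0 U : in_sat (0 : M U).
Proof.
move=> x Ux; exists U; split=> //; exists 1, 0; split; first exact: nzd1.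
by rewrite rs0 // scaler0 hf0.
Qed.
Lemma in_sat_lin U c (s t : M U) : in_sat s -> in_sat t -> in_sat (c *: s + t).
Proof.
move=> hs ht x Ux; have [V [Vx hV [a [b [ha e]]]]] := hs x Ux.
have [V' [Vx' hV' [a' [b' [ha' e']]]]] := ht x Ux.
pose O := oI V V'; have hl : O `<=` V by exact: oIl.
have hr : O `<=` V' by exact: oIr.
have OU : O `<=` U by exact: subset_trans hV.
exists O; split=> //.
exists (fres V O a * fres V' O a'),
  ((fres V' O a' * fres U O c) *: rs V O b + fres V O a *: rs V' O b').
split; first by apply: nzdM; exact: nzd_rs.
rewrite hf_lin hfZ !hf_rs // -e -e' rs_lin // !rsZ // !rs_comp //.
rewrite scalerDr !scalerA; congr (_ *: _ + _).
by rewrite -!mulrA mulrC mulrA.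
Qed.
Lemma in_sat_rs (U U' : opens X) (s : M U) : U' `<=` U -> in_sat s -> in_sat (rs U U' s).
Proof.
move=> h hs x Ux; have [V [Vx hV [a [b [ha e]]]]] := hs x (h _ Ux).
pose O := oI V U'; have hl : O `<=` V by exact: oIl.
have hr : O `<=` U' by exact: oIr.
exists O; split=> //; exists (fres V O a), (rs V O b).
split; first exact: nzd_rs.
by rewrite hf_rs // -e rsZ // !rs_comp.
Qed.
Lemma in_sat_loc (U : opens X) (s : M U) : (forall x, oset U x ->
  exists V : opens X, [/\ oset V x, V `<=` U & in_sat (rs U V s)]) -> in_sat s.
Proof.
move=> h x Ux; have [V [Vx hV hs]] := h x Ux.
have [V' [Vx' hV' [a [b [ha e]]]]] := hs x Vx.
exists V'; split=> //; first exact: subset_trans hV.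
by exists a, b; split=> //; rewrite -e rs_comp.
Qed.
Definition saturation : omod X := submod in_sat0 in_sat_lin in_sat_rs in_sat_loc.
Definition sat_incl : ohom saturation M := submod_incl in_sat0 in_sat_lin in_sat_rs in_sat_loc.
Lemma sat_image U (b : N U) : in_sat (m U b).
Proof.
move=> x Ux; exists U; split=> //; exists 1, b; split; first exact: nzd1.
by rewrite rs_id scale1r.
Qed.
Definition sat_cores : ohom N saturation :=
  submod_cores in_sat0 in_sat_lin in_sat_rs in_sat_loc sat_image.
End Saturation.

Section FittingRes.
Variables (k : fieldType) (X : rspace k) (M : omod X).
Lemma fitting0_res (U U' : opens X) (f : fn X U) : U' `<=` U ->
  @fitting0 _ _ M U f -> @fitting0 _ _ M U' (fres U U' f).
Proof.
move=> h hf x Ux; have [V [Vx hV [n [m [r [c [A [hg hr hd]]]]]]]] := hf x (h _ Ux).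
pose O := oI V U'; have hl : O `<=` V by exact: oIl.
have hr' : O `<=` U' by exact: oIr.
exists O; split=> //; exists n, (fun j => rs V O (m j)), r, (fun l => fres V O (c l)).
exists (fun l => map_mx (fresm hl) (A l)); split.
- move=> W s y hW Wy; have [O' [Oy hO' [a e]]] := hg W s y (subset_trans hW hl) Wy.
  exists O'; split=> //; exists a; rewrite e; apply: eq_bigr => j _.
  by rewrite rs_comp //; apply: subset_trans hW.
- move=> l i; transitivity (rs V O (\sum_j A l i j *: m j)); last by rewrite hr rs0.
  apply: (big_rec2 (fun u v => u = rs V O v)); first by rewrite rs0.
  by move=> j u v _ ->; rewrite rsD // rsZ // mxE.
rewrite (psh_comp (fn_psh X)) // -(psh_comp (fn_psh X) _ hV hl) hd -(fresmE hl) rmorph_sum.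
by apply: eq_bigr => l _; rewrite rmorphM det_map_mx.
Qed.
End FittingRes.

(* The ring A seen as a nontrivial ring, as needed for polynomials over A. *)
Definition nzring (A : comPzRingType) (h : (1 : A) != 0) : comNzRingType :=
  HB.pack (GRing.ComPzRing.sort A) (GRing.PzSemiRing_isNonZero.Build A h).

Definition disc (A : comNzRingType) (q : {poly A}) : A := resultant q q^`().

(* [affine U] says that U is, with the restricted structure
   sheaf, the spectrum of O(U). *)
Section Schemes.
Variables (k : fieldType) (X : rspace k).

Definition prime_ideal (A : comPzRingType) (P : set A) : Prop :=
  [/\ P 0, forall a b, P a -> P b -> P (a + b), forall a b, P b -> P (a * b), ~ P 1 &
      forall a b, P (a * b) -> P a \/ P b].

Definition principal_open (U : opens X) (f : fn X U) (D : opens X) : Prop :=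
  forall x, oset D x <-> oset U x /\ inv_at f x.

Record affine (U : opens X) : Prop := Affine {
  affine_prime : forall x, oset U x -> prime_ideal [set f : fn X U | ~ inv_at f x];
  affine_point : forall P : set (fn X U), prime_ideal P ->
    exists! x, oset U x /\ P = [set f : fn X U | ~ inv_at f x];
  affine_basis : forall (V : opens X) x, oset U x -> oset V x ->
    exists (f : fn X U) (D : opens X), [/\ principal_open f D, oset D x & D `<=` V];
  affine_frac : forall (f : fn X U) (D : opens X), principal_open f D ->
    forall s : fn X D, exists n (g : fn X U), fres U D f ^+ n * s = fres U D g;
  affine_zero : forall (f : fn X U) (D : opens X), principal_open f D ->
    forall g : fn X U, fres U D g = 0 -> exists n, f ^+ n * g = 0 }.

Definition scheme : Prop := forall x : X, exists U : opens X, oset U x /\ affine U.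

Definition mev (U : opens X) n (v : 'I_n -> fn X U) (q : mpoly.mpoly n k) : fn X U :=
  \sum_(m <- mpoly.msupp q) cst U (mpoly.mcoeff m q) * \prod_i v i ^+ mpoly.fun_of_multinom m i.

(* Closed immersion in P^n, on the standard charts: U i is the preimage of
   {T_i <> 0} and r i j that of T_j / T_i. *)
Definition projective : Prop :=
  exists n (U : 'I_n.+1 -> opens X) (r : forall i, 'I_n.+1 -> fn X (U i)),
  [/\ forall x, exists i, oset (U i) x,
      forall i, affine (U i),
      forall i j, principal_open (r i j) (oI (U i) (U j)),
      forall i j l, r i i = 1 /\
        fres (U i) (oI (U i) (U j)) (r i j) * fres (U j) (oI (U i) (U j)) (r j l) =
        fres (U i) (oI (U i) (U j)) (r i l) &
      forall i (s : fn X (U i)), exists q, s = mev (r i) q].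

(* Smooth of relative dimension 1: locally the spectrum of
   k[x_0, ..., x_n] / (f_0, ..., f_(n-1)) with det(d f_i / d x_j)_(i, j < n)
   invertible. *)
Definition smooth1 : Prop := forall x : X, exists U : opens X, [/\ oset U x, affine U &
  exists n (f : 'I_n -> mpoly.mpoly n.+1 k) (v : 'I_n.+1 -> fn X U),
  [/\ forall s, exists q, s = mev v q,
      forall q, mev v q = 0 <->
        exists c : 'I_n -> mpoly.mpoly n.+1 k, q = \sum_i c i * f i &
      exists g, g * \det (\matrix_(i < n, j < n)
        mev v (mpoly.mderiv (widen_ord (leqnSn n) j) (f i))) = 1]].

Definition irreducible_space : Prop := (exists x : X, True) /\
  forall U V : opens X, U !=set0 -> V !=set0 -> oI U V !=set0.

Definition smooth_projective_curve : Prop :=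
  [/\ scheme, projective, smooth1 & irreducible_space].
End Schemes.

Section VectorBundles.
Variables (k : fieldType) (X : rspace k).

Definition is_frame (E : omod X) (U : opens X) n (e : 'I_n -> E U) : Prop :=
  forall (V : opens X) (s : E V), V `<=` U ->
  exists! a : 'rV[fn X V]_n, s = \sum_j a 0 j *: rs U V (e j).

Definition locally_free n (E : omod X) : Prop :=
  forall x : X, exists U : opens X, oset U x /\ exists e : 'I_n -> E U, is_frame e.

(* e is a frame of E, w a generator of Omega and theta(e_j) = sum_i A_ij w (x) e_i. *)
Definition higgs_matrix n (E : omod X) (theta : ohom E (tensor (Omega X) E)) (U : opens X)
    (e : 'I_n -> E U) (w : Omega X U) (A : 'M[fn X U]_n) : Prop :=
  [/\ is_frame e, is_frame (fun _ : 'I_1 => w) &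
      forall j, theta U (e j) = \sum_i A i j *: tpure w (e i)].

Definition hchar (U : opens X) (h : (1 : fn X U) != 0) n (A : 'M[fn X U]_n) :
  {poly nzring h} := char_poly (A : 'M[nzring h]_n).

Definition regular_semisimple n (E : omod X) (theta : ohom E (tensor (Omega X) E)) : Prop :=
  exists (U : opens X) (e : 'I_n -> E U) w A (h : (1 : fn X U) != 0),
    higgs_matrix theta e w A /\ disc (hchar h A) != 0.
End VectorBundles.

Section Spectral.
Variables (k : fieldType) (Y X : rspace k) (p : mor Y X).
Local Notation B := (pushf p (Omodule Y)).

Definition spec_ev (U : opens X) (h : (1 : fn X U) != 0) (t : fn Y (preimo p U))
    (q : {poly nzring h}) : fn Y (preimo p U) :=
  \sum_(i < size q) msharp p U q`_i * t ^+ i.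

(* p : Y -> X is the spectral curve of theta: over an affine open set U with
   Omega_X generated by w, Tot(Omega_X) is the spectrum of O(U)[t], and Y is
   the spectrum of O(U)[t] / (char. polynomial of theta / w).  The
   tautological section of p^* Omega_X, seen as a section tau of
   Omega_X (x) p_* O_Y, is w (x) t. *)
Definition spectral_curve n (E : omod X) (theta : ohom E (tensor (Omega X) E))
    (tau : tensor (Omega X) B (oT X)) : Prop :=
  forall (U : opens X) (e : 'I_n -> E U) w A, affine U -> higgs_matrix theta e w A ->
  affine (preimo p U) /\
  exists t : fn Y (preimo p U), rs (oT X) U tau = tpure w (t : B U) /\
    forall h : (1 : fn X U) != 0,
      (forall b, exists q, b = @spec_ev U h t q) /\
      (forall q, @spec_ev U h t q = 0 <-> exists r, q = r * hchar h A).

Section Mult.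
Variables (L : omod Y) (E : omod X) (e : ohom E (pushf p L)) (e' : ohom (pushf p L) E).

(* The action of p_* O_Y on E through e : E -> p_* L with inverse e'. *)
Section Fun.
Variables (U : opens X) (b : B U).
Definition mult_fun (V : opens X) (h : V `<=` U) (s : E V) : E V :=
  e' V ((rs U V b : fn Y (preimo p V)) *: (e V s : L (preimo p V))).
Lemma mult_lin (V : opens X) (h : V `<=` U) a s t :
  mult_fun h (a *: s + t) = a *: mult_fun h s + mult_fun h t.
Proof.
rewrite /mult_fun -hf_lin hf_lin; congr (e' V _).
by rewrite scalerDr [in LHS]scalerA mulrC -scalerA.
Qed.
Lemma mult_rs (V W : opens X) (h : V `<=` U) (h' : W `<=` U) s : W `<=` V ->
  mult_fun h' (rs V W s) = rs V W (mult_fun h s).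
Proof.
move=> hW; rewrite /mult_fun -hf_rs //; congr (e' W _).
rewrite hf_rs // -(rs_comp b h hW); symmetry.
exact: (rsZ (rs U V b : fn Y (preimo p V)) (e V s : L (preimo p V)) (preimS hW)).
Qed.
Definition mult_val : sEnd E U := Shom mult_lin mult_rs.
End Fun.
Lemma mult_hom_lin U a (b b' : B U) :
  mult_val (a *: b + b') = a *: mult_val b + mult_val b'.
Proof.
apply: shom_ext => V h s; rewrite shom_addE shom_scaleE /= /mult_fun -hf_lin.
congr (e' V _); rewrite rs_lin // [LHS]scalerDl; congr (_ + _).
by rewrite -scalerA.
Qed.
Lemma mult_hom_rs (U V : opens X) (b : B U) : V `<=` U ->
  mult_val (rs U V b) = rs U V (mult_val b).
Proof.
move=> hV; apply: shom_ext => W h s.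
by rewrite (shom_rE _ hV h (subset_trans h hV)) /= /mult_fun rs_comp.
Qed.
Definition mult : ohom B (sEnd E) := Hom mult_hom_lin mult_hom_rs.
End Mult.

(* L is the spectral line bundle: e : E -> p_* L is an isomorphism with
   inverse e', transporting theta to the multiplication by tau. *)
Definition spectral_bundle (E : omod X) (theta : ohom E (tensor (Omega X) E))
    (tau : tensor (Omega X) B (oT X)) (L : omod Y)
    (e : ohom E (pushf p L)) (e' : ohom (pushf p L) E) : Prop :=
  [/\ locally_free 1 L,
      forall U, cancel (e U) (e' U), forall U, cancel (e' U) (e U) &
      forall (U : opens X) (h : U `<=` oT X) (s : E U),
        theta U s =
        (tev (Omega X) E (oT X) (tmap (hid (Omega X)) (mult e e') (oT X) tau)
           : shom E (tensor (Omega X) E) (oT X)) U h s].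

Definition discr_ideal : forall U : opens X, fn X U -> Prop :=
  @fitting0 _ _ (pushf p (OmegaRel p)).
Definition discr_ideal_res (U V : opens X) (f : fn X U) :
  V `<=` U -> discr_ideal f -> discr_ideal (fres U V f) := @fitting0_res _ _ _ U V f.
Definition Xo : opens X := cosupp discr_ideal.
Definition OmegaXlog : omod X := OmegaLog discr_ideal_res.
Definition klogX : ohom (Omega X) OmegaXlog := klog discr_ideal_res.

(* The restriction of lambda to Xo is the inverse of the isomorphism kappa,
   Omega_X(log) being identified with Omega_X there by klogX. *)
Definition etale_identification (lambda : ohom (pushf p (Omega Y)) (tensor OmegaXlog B)) : Prop :=
  forall (U : opens X) (w : pushf p (Omega Y) U) (v : tensor (Omega X) B U),
    U `<=` Xo -> lambda U w = tmap klogX (hid B) U v <-> kappa p U v = w.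

Section Classes.
Variables (L : omod Y) (E : omod X) (e : ohom E (pushf p L)) (e' : ohom (pushf p L) E).

Definition centralizer : omod X := saturation (mult e e').
Definition centr_incl : ohom centralizer (sEnd E) := sat_incl (mult e e').

(* (mu_p)_* (p_* At(L)), with mu_p = (id (x) m) o lambda; preimo p (oT X) is
   the whole of Y. *)
Definition Atlog (lambda : ohom (pushf p (Omega Y)) (tensor OmegaXlog B)) :
    H1 (oT X) (tensor OmegaXlog centralizer) :=
  push (oT X) (hcomp (tmap (hid OmegaXlog) (sat_cores (mult e e'))) lambda)
    (pull_inv p (Omega Y) (oT X) (AtL L (preimo p (oT X)))).

(* The class corresponding to At(L|Yo) under H^1(Yo, Omega_Y) =
   H^1(Xo, p_* Omega_Y) = H^1(Xo, Omega_X (x) p_* O_Y). *)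
Definition beta_spec : H1 Xo (tensor (Omega X) B) :=
  xget (H1_zero Xo _)
    [set b | push Xo (kappa p) b = pull_inv p (Omega Y) Xo (AtL L (preimo p Xo))].
End Classes.

(* The identification H^1(Xo, Omega_X(log) (x) M) = H^1(Xo, Omega_X (x) M). *)
Definition unlog (M : omod X) (a : H1 Xo (tensor OmegaXlog M)) : H1 Xo (tensor (Omega X) M) :=
  xget (H1_zero Xo _) [set b | push Xo (tmap klogX (hid M)) b = a].

Lemma Xo_sub : Xo `<=` oT X. Proof. by []. Qed.
End Spectral.

(* Main.v *)
(** Let [(phi_i, m_i)] be a dual basis of [F] over an open set: sections [m_i]
    of [F] and [phi_i] of its dual with [s = sum_i phi_i(s) m_i].  Then
    [s |-> sum_i d(phi_i(s)) (x) m_i] is a connection on [F], and the Atiyah class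
    of [F] is represented by the differences of such local connections.  A frame
    of [E] is a dual basis.  The line bundle [L] has a dual basis over every
    affine open set, in particular over [p^-1(U)] for a suitable neighbourhood [U]
    of any point of [X]; so [At(L)] comes from a cocycle [c_xy] on [X] with
    values in [p_* Omega_Y].

    Pushing the connection on [L] forward through [lambda] gives the logarithmic
    connection [s |-> sum_i lambda(d(phi_i(s))) m_i] on [E].  Its Leibniz rule
    follows from [lambda o kappa = k (x) id] and from the linearity of [lambda]
    over [p_* O_Y]; both hold over the complement of the discriminant, hence
    everywhere, because a section of [Omega(log) (x) E] vanishing there is zero.
    The differences of these logarithmic connections are [lambda(c_xy)], while
    those of holomorphic connections represent [At(E)]; over each chart the two
    connections differ by a linear map, so the two cocycles are cohomologous.
    Over the complement of the discriminant, [k (x) id] and [kappa] are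
    isomorphisms, and the remaining equalities follow by restriction. *)
Require Import Defs.
From HB Require Import structures.
From mathcomp Require Import all_boot all_order all_algebra.
From mathcomp Require Import boolp classical_sets functions topology reals.
From mathcomp Require Import complex.
From mathcomp Require Import ring.
From mathcomp Require mpoly.
Import (canonicals) mpoly.
Import GRing.Theory.
Set Implicit Arguments.
Unset Strict Implicit.
Unset Printing Implicit Defensive.
Local Open Scope classical_set_scope.
Local Open Scope ring_scope.

(** * Affine open sets *)

(** The classes [At], [AtL], [pull_inv], [beta_spec] and [unlog] are preimages picked by choice,
    with the zero class as default. Such a class can be used only once a preimage is known to exist,
    and identified only where the map is injective. Hence isomorphisms of sheaves are turned into
    bijections on [H1], [pull] is shown to be injective, and a preimage of the class of [L] under
    [pull] is exhibited as an explicit cocycle on [X].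

    That cocycle needs connections on [L] over whole preimages [p^-1(U)], where [L] has no obvious
    frame. A dual basis suffices, and it exists over affine open sets because the values of
    functionals on sections of [L] generate the unit ideal. The preimage of [U] is known to be
    affine only if [U] is affine and carries both a frame of [E] and a generator of [Omega_X]; so
    the Jacobian criterion must first be turned into a frame of [Omega_X].

    Identities away from the discriminant are extended after acting on [E]: in a frame of [E] they
    become identities between logarithmic forms, which by definition are forms on the complement. *)

Section GlueUnique.
Variables (k : fieldType) (X : rspace k) (M : omod X).

(** A condition with at most one solution over each open set: local solutions agree on overlaps and
    glue. [P] is not assumed local, so the conclusion is that [t] restricts to every solution, not
    that [t] is one. *)
Lemma glue_unique (U : opens X) (P : forall V : opens X, M V -> Prop) :
  (forall (V W : opens X) (s : M V), V `<=` U -> W `<=` V -> P V s -> P W (rs V W s)) ->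
  (forall (V : opens X) (s t : M V), V `<=` U -> P V s -> P V t -> s = t) ->
  (forall x, oset U x -> exists V : opens X,
     [/\ oset V x, V `<=` U & exists s : M V, P V s]) ->
  exists t : M U, forall (V : opens X) (s : M V), V `<=` U -> P V s -> rs U V t = s.
Proof.
move=> P_rs P_un P_ex.
have ex x : exists p : {V : opens X & M V}, oset U x ->
    [/\ oset (projT1 p) x, projT1 p `<=` U & P (projT1 p) (projT2 p)].
  (* Gluing data are indexed by all points of [X]; outside [U] an arbitrary pair is supplied. *)
  have [Ux|nUx] := pselect (oset U x); last by exists (existT (fun V => M V : Type) U (0 : M U)).
  have [V [Vx hV [s hs]]] := P_ex x Ux.
  by exists (existT (fun V => M V : Type) V s).
pose p x := projT1 (cid (ex x)).
have pP x : oset U x ->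
    [/\ oset (projT1 (p x)) x, projT1 (p x) `<=` U & P (projT1 (p x)) (projT2 (p x))].
  exact: (projT2 (cid (ex x))).
have [||t ht] := sheaf_glue (omodP M) (U := U) (V := fun x => projT1 (p x))
    (s := fun x => projT2 (p x)).
- by move=> x /pP [].
- move=> x y Ux Uy; have [xx hx Px] := pP x Ux; have [yy hy Py] := pP y Uy.
  have hl := @oIl _ (projT1 (p x)) (projT1 (p y)).
  have hr := @oIr _ (projT1 (p x)) (projT1 (p y)).
  apply: P_un; first exact: subset_trans hx.
    exact: P_rs.
  exact: P_rs.
exists t => V s hV Ps; apply: (sheaf_sep (omodP M)) => x Vx.
have Ux := hV _ Vx; have [xx hx Px] := pP x Ux.
have hl := @oIl _ V (projT1 (p x)); have hr := @oIr _ V (projT1 (p x)).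
exists (oI V (projT1 (p x))); split=> //.
rewrite rs_comp // -(rs_comp t hx hr) ht //.
apply: P_un; first exact: subset_trans hV.
  exact: P_rs.
exact: P_rs.
Qed.
End GlueUnique.

Section PrimeIdeals.
Variable A : comPzRingType.

Definition is_ideal (J : set A) : Prop :=
  [/\ J 0, forall a b, J a -> J b -> J (a + b) & forall a b, J b -> J (a * b)].

(* Zorn's lemma for the sets S such that J `|` S is a proper ideal: adjoining J
   also takes care of the empty chain. *)
Lemma prime_ideal_exists (J : set A) : is_ideal J -> ~ J 1 ->
  exists2 P, prime_ideal P & J `<=` P.
Proof.
move=> [J0 JD JM] J1.
pose Q (S : set A) := is_ideal (J `|` S) /\ ~ (J `|` S) 1.
have [F hF tot|S [[[I0 ID IM] I1] max]] := @Zorn_bigcup A Q.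
  split; last by case=> // -[S FS S1]; case: (hF S FS) => _; apply; right.
  split; first by left.
    move=> a b [Ja|[S FS Sa]] [Jb|[T FT Tb]].
    - by left; apply: JD.
    - have [[_ h _] _] := hF T FT.
      by case: (h a b (or_introl Ja) (or_intror Tb)) => ?; [left|right; exists T].
    - have [[_ h _] _] := hF S FS.
      by case: (h a b (or_intror Sa) (or_introl Jb)) => ?; [left|right; exists S].
    have [sST|sTS] := tot S T FS FT.
      have [[_ h _] _] := hF T FT.
      by case: (h a b (or_intror (sST _ Sa)) (or_intror Tb)) => ?; [left|right; exists T].
    have [[_ h _] _] := hF S FS.
    by case: (h a b (or_intror Sa) (or_intror (sTS _ Tb))) => ?; [left|right; exists S].
  move=> a b [Jb|[S FS Sb]]; first by left; apply: JM.
  have [[_ _ h] _] := hF S FS.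
  by case: (h a b (or_intror Sb)) => ?; [left|right; exists S].
pose I := J `|` S.
(* Maximality: [I + (a)] is strictly larger than [I], hence is not proper. *)
have big a : ~ I a -> exists i r, I i /\ 1 = i + r * a.
  move=> nIa; pose K : set A := [set c | exists i r, I i /\ c = i + r * a].
  have IK : I `<=` K by move=> i Ii; exists i, 0; rewrite mul0r addr0.
  have Ka : K a by exists 0, 1; rewrite mul1r add0r.
  apply: contrapT => nK1.
  have JK : J `|` K = K by apply/seteqP; split=> [c [Jc|//]|c Kc]; [apply: IK; left|right].
  apply: (max K).
    split; first by move=> c Sc; apply: IK; right.
    by move=> eKS; apply: nIa; right; apply: eKS.
  split; rewrite JK //; split.
  - exact: IK.
  - move=> _ _ [i [r [Ii ->]]] [j [s [Ij ->]]]; exists (i + j), (r + s).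
    by split; [apply: ID|rewrite mulrDl addrACA].
  - move=> c _ [i [r [Ii ->]]]; exists (c * i), (c * r).
    by split; [apply: IM|rewrite mulrDr mulrA].
exists I; last by move=> c Jc; left.
split=> // a b Iab; apply: contrapT => /not_orP [/big [i [r [Ii ei]]] /big [j [s [Ij ej]]]].
(* This is [(i + r a)(j + s b)] expanded; each of the four terms lies in [I]. *)
apply: I1; have -> : (1 : A) = j * i + (s * b) * i + (r * a) * j + (r * s) * (a * b).
  by transitivity ((i + r * a) * (j + s * b)); [rewrite -ei -ej mulr1|ring].
apply: (ID); last exact: IM.
apply: (ID); last exact: IM.
by apply: (ID); apply: (IM).
Qed.
End PrimeIdeals.

Section Opens.
Variable X : topologicalType.
Lemma opens_eq (U V : opens X) : U `<=` V -> V `<=` U -> U = V.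
Proof.
case: U V => [U oU] [V oV] /= h h'; have e : U = V by apply/seteqP.
by case: _ / e in oV *; congr Opens; apply: Prop_irrelevance.
Qed.
Lemma oI_sub (U V : opens X) : V `<=` U -> V `<=` oI V U.
Proof. by move=> h; apply: oIs. Qed.
End Opens.

Section Functions.
Variables (k : fieldType) (X : rspace k).
Implicit Types (U V W D : opens X) (x : X).

Lemma fres_id U (a : fn X U) : fres U U a = a.
Proof. exact: (psh_id (fn_psh X)). Qed.
Lemma fres_comp U V W (a : fn X U) : V `<=` U -> W `<=` V ->
  fres V W (fres U V a) = fres U W a.
Proof. exact: (psh_comp (fn_psh X)). Qed.
Lemma fres0 U V : V `<=` U -> fres U V (0 : fn X U) = 0.
Proof. by move=> h; rewrite -(fresmE h) rmorph0. Qed.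
Lemma fresB U V (a b : fn X U) : V `<=` U -> fres U V (a - b) = fres U V a - fres U V b.
Proof. by move=> h; rewrite -!(fresmE h) rmorphB. Qed.
Lemma fresX U V (a : fn X U) n : V `<=` U -> fres U V (a ^+ n) = fres U V a ^+ n.
Proof. by move=> h; rewrite -!(fresmE h) rmorphXn. Qed.

Lemma inv_at_in U (f : fn X U) x : inv_at f x -> oset U x.
Proof. by case=> V [Vx h _]; apply: h. Qed.
Lemma inv_at_rs U V (f : fn X U) x : V `<=` U -> oset V x ->
  inv_at (fres U V f) x <-> inv_at f x.
Proof.
move=> hV Vx; split=> -[W [Wx hW [g e]]].
  exists W; split=> //; first exact: subset_trans hV.
  by exists g; rewrite -e fres_comp.
have hl := @oIl _ V W; have hr := @oIr _ V W.
exists (oI V W); split=> //; exists (fres W (oI V W) g).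
by rewrite fres_comp // -(fres_comp f hW hr) -fresM // e fres1.
Qed.
Lemma inv_atM U (f g : fn X U) x : inv_at (f * g) x <-> inv_at f x /\ inv_at g x.
Proof.
split=> [[V [Vx hV [h e]]]|[[V [Vx hV [h e]]] [W [Wx hW [l e']]]]].
  split; exists V; split=> //.
    by exists (fres U V g * h); rewrite mulrA -fresM.
  by exists (fres U V f * h); rewrite mulrA [_ * fres U V f]mulrC -fresM.
have hl := @oIl _ V W; have hr := @oIr _ V W.
exists (oI V W); split=> //; first exact: subset_trans hV.
exists (fres V (oI V W) h * fres W (oI V W) l).
rewrite fresM; last exact: subset_trans hV.
rewrite -(fres_comp f hV hl) -(fres_comp g hW hr) mulrACA -!fresM // e e'.
by rewrite !fres1 // mulr1.
Qed.
Lemma inv_at1 U x : oset U x -> inv_at (1 : fn X U) x.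
Proof. by move=> Ux; exists U; split=> //; exists 1; rewrite fres1 // mulr1. Qed.
Lemma inv_atX U (f : fn X U) n x : inv_at f x -> inv_at (f ^+ n) x.
Proof.
move=> hf; elim: n => [|n IH]; first by rewrite expr0; apply: inv_at1; apply: inv_at_in hf.
by rewrite exprS; apply/inv_atM.
Qed.

(** Inverses are unique, so the local ones glue. *)
Lemma unit_global U (f : fn X U) : (forall x, oset U x -> inv_at f x) ->
  exists g, g * f = 1.
Proof.
move=> h; pose P V (s : Omodule X V) := (s : fn X V) * fres U V f = 1.
have [|||g hg] := @glue_unique k X (Omodule X) U P.
- move=> V W s hV hW e; change (fres V W (s : fn X V) * fres U W f = 1).
  by rewrite -(fres_comp f hV hW) -fresM // e fres1.
- move=> V s t hV es et.
  by rewrite -[LHS]mulr1 -et mulrCA es mulr1.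
- move=> x /h [V [Vx hV [g e]]]; exists V; split=> //; exists g.
  by rewrite /P mulrC.
exists g; apply: (sheaf_sep (fn_glue X)) => x /h [V [Vx hV [l e]]].
exists V; split=> //; rewrite fres1 // fresM // -e mulrC; congr (_ * _).
by apply: hg => //; rewrite /P mulrC.
Qed.

Definition Dset U (f : fn X U) : set X := [set x | inv_at f x].
Lemma Dset_open U (f : fn X U) : open (Dset f).
Proof.
have -> : Dset f = \bigcup_(V in [set V : opens X | V `<=` U /\
    exists g, fres U V f * g = 1]) oset V.
  apply/seteqP; split=> [x [V [Vx hV h]]|x [V [hV h] Vx]]; first by exists V.
  by exists V.
by apply: bigcup_open => V _; apply: osetP.
Qed.
Definition Dopen U (f : fn X U) : opens X := Opens (Dset_open f).

Lemma Dopen_sub U (f : fn X U) : Dopen f `<=` U.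
Proof. by move=> x /inv_at_in. Qed.
Lemma Dopen_principal U (f : fn X U) : principal_open f (Dopen f).
Proof. by move=> x; split=> [h|[]]//; split=> //; apply: inv_at_in h. Qed.
Lemma principalE U (f : fn X U) D : principal_open f D -> D = Dopen f.
Proof.
move=> h; apply: opens_eq => [x /h []//|x hx]; apply/h; split=> //.
exact: inv_at_in hx.
Qed.
Lemma DopenM U (f g : fn X U) : Dopen (f * g) = oI (Dopen f) (Dopen g).
Proof. by apply: opens_eq => x; [move=> /inv_atM|move=> [? ?]; apply/inv_atM]. Qed.
Lemma Dopen1 U : Dopen (1 : fn X U) = U.
Proof. by apply: opens_eq => x; [move=> /inv_at_in|move=> /inv_at1]. Qed.
Lemma Dopen_unit U (f : fn X U) V : V `<=` Dopen f -> exists g, g * fres U V f = 1.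
Proof.
move=> h; have hV : V `<=` U by apply: subset_trans (@Dopen_sub _ f).
by apply: unit_global => x Vx; apply/inv_at_rs => //; apply: h.
Qed.
End Functions.

Section Affine.
Variables (k : fieldType) (X : rspace k) (U : opens X).
Hypothesis affU : affine U.
Implicit Types (V W D : opens X) (x : X) (f g h : fn X U).

Lemma affine_frac_D f (s : fn X (Dopen f)) :
  exists n g, fres U (Dopen f) f ^+ n * s = fres U (Dopen f) g.
Proof. exact: (affine_frac affU (Dopen_principal f)). Qed.
Lemma affine_zero_D f g : fres U (Dopen f) g = 0 -> exists n, f ^+ n * g = 0.
Proof. exact: (affine_zero affU (Dopen_principal f)). Qed.
Lemma affine_basis_D V x : oset U x -> oset V x ->
  exists f, inv_at f x /\ Dopen f `<=` V.
Proof.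
move=> Ux Vx; have [f [D [hD Dx DV]]] := affine_basis affU Ux Vx.
by exists f; rewrite -(principalE hD); split=> //; case/hD: Dx.
Qed.
Lemma inv_at0 x : ~ inv_at (0 : fn X U) x.
Proof.
by move=> h; have [h0 _ _ _ _] := affine_prime affU (inv_at_in h); apply: h0 h.
Qed.
Lemma inv_atD f g x : inv_at (f + g) x -> inv_at f x \/ inv_at g x.
Proof.
move=> h; apply: contrapT => /not_orP [nf ng].
by have [_ hD _ _ _] := affine_prime affU (inv_at_in h); apply: (hD f g).
Qed.

(* Quasi-compactness of U. *)
Lemma affine_ideal1 (J : set (fn X U)) : is_ideal J ->
  (forall x, oset U x -> exists f, J f /\ inv_at f x) -> J 1.
Proof.
move=> Jid h; apply: contrapT => /(prime_ideal_exists Jid) [P pP JP].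
have [x [[Ux e] _]] := affine_point affU pP.
by have [f [/JP]] := h x Ux; rewrite e.
Qed.

(** Everything over [D(f)] is brought back to [U] by writing [f^n s = g], with [f] a unit on [D(f)]:
    [s] is invertible at a point exactly when [g] is, a prime ideal of the functions on [D(f)] is
    recovered from its contraction [Q], and [D(s) = D(f g)]. *)
Lemma affine_D f : affine (Dopen f).
Proof.
have hD := @Dopen_sub _ _ _ f.
have frac s : exists n g, fres U (Dopen f) f ^+ n * s = fres U (Dopen f) g.
  exact: affine_frac_D.
have inv_frac n s g x : oset (Dopen f) x ->
    fres U (Dopen f) f ^+ n * s = fres U (Dopen f) g -> inv_at s x <-> inv_at g x.
  move=> Dx e; rewrite -(inv_at_rs g hD Dx) -e inv_atM; split=> [|[]]//.
  by split=> //; apply: inv_atX; apply/inv_at_rs.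
split.
- move=> x Dx; split.
  + have [n [g e]] := frac 0; move/(inv_frac _ _ _ _ Dx e).
    by move/inv_at_rs => /(_ (Dopen f) hD Dx); rewrite -e mulr0 -(fres0 hD) inv_at_rs // => /inv_at0.
  + move=> s t ns nt; have [n [g eg]] := frac s; have [m [h eh]] := frac t.
    move=> hst.
    have e : fres U (Dopen f) f ^+ (n + m) * (s + t) = fres U (Dopen f) (f ^+ m * g + f ^+ n * h).
      rewrite fresD // !fresM // !fresX // -eg -eh exprD; ring.
    have /inv_atD := (inv_frac _ _ _ _ Dx e).1 hst.
    case=> /inv_atM [_]; last by move/(inv_frac _ _ _ _ Dx eh).
    by move/(inv_frac _ _ _ _ Dx eg).
  + by move=> s t nt /inv_atM [].
  + by move=> /= h; apply: h; apply: inv_at1.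
  + by move=> s t /= nst; apply: contrapT => /not_orP [/contrapT hs /contrapT ht];
      apply: nst; apply/inv_atM.
- move=> P [P0 PD PM P1 Ppr].
  have [u hu] : exists u, u * fres U (Dopen f) f = 1 by apply: Dopen_unit.
  pose Q : set (fn X U) := [set g | P (fres U (Dopen f) g)].
  have pQ : prime_ideal Q.
    split; rewrite /Q /=.
    + by rewrite fres0.
    + by move=> a b; rewrite fresD //; apply: PD.
    + by move=> a b; rewrite fresM //; apply: PM.
    + by rewrite fres1.
    + by move=> a b; rewrite fresM //; apply: Ppr.
  have PQ n s g : fres U (Dopen f) f ^+ n * s = fres U (Dopen f) g -> P s <-> Q g.
    move=> e; rewrite /Q /= -e; split; first exact: PM.
    by move=> /(PM (u ^+ n)); rewrite mulrA -exprMn hu expr1n mul1r.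
  have [x [[Ux eQ] unx]] := affine_point affU pQ.
  have Dx : oset (Dopen f) x.
    apply: contrapT => nx; have : Q f by rewrite eQ.
    by rewrite /Q /= => /(PM u); rewrite hu.
  exists x; split.
    split=> //; apply/seteqP; split=> s; have [n [g e]] := frac s.
      by move/(PQ _ _ _ e); rewrite eQ /= => nh /(inv_frac _ _ _ _ Dx e).
    move=> /= nh; apply/(PQ _ _ _ e); rewrite eQ /=.
    by move/(inv_frac _ _ _ _ Dx e).
  move=> y [Dy eP]; apply: unx; split; first exact: hD.
  by apply/seteqP; split=> g; rewrite /Q /= eP /= inv_at_rs.
- move=> V x Dx Vx.
  have Ux : oset U x by exact: hD.
  have [g [gx hg]] := affine_basis_D Ux (conj Dx Vx : oset (oI (Dopen f) V) x).
  exists (fres U (Dopen f) g), (Dopen g); split=> //.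
    move=> y; split=> [gy|[Dy]]; last by move/inv_at_rs; apply.
    by have [Dy _] := hg _ gy; split=> //; apply/inv_at_rs.
  by apply: subset_trans hg _; apply: oIr.
- move=> s D /principalE -> {D}; have [n [g e]] := frac s.
  have eD : Dopen s = Dopen (f * g).
    apply: opens_eq => x.
      move=> sx; have Dx : oset (Dopen f) x by apply: inv_at_in sx.
      by apply/inv_atM; split=> //; apply/(inv_frac _ _ _ _ Dx e).
    by move=> /inv_atM [Dx gx]; apply/(inv_frac _ _ _ _ Dx e).
  rewrite eD => t; have [m [a ea]] := affine_frac_D t.
  have [u hu] : exists u, u * fres U (Dopen f) f = 1 by apply: Dopen_unit.
  have hE : Dopen (f * g) `<=` Dopen f by rewrite DopenM; apply: oIl.
  have hEU := subset_trans hE hD.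
  (* On [D(f g)] one has [f g = f^(n+1) s] and [(f g)^m t = a], hence [s^m t = u^(m + n m) a]. *)
  exists m, (u ^+ (m + n * m) * fres U (Dopen f) a).
  rewrite fresM // fres_comp // -ea !fresX //.
  rewrite -(fres_comp _ hD hE) fresM // -e !(fresM, fresX) //.
  have hu' : fres (Dopen f) (Dopen (f * g)) u * fres (Dopen f) (Dopen (f * g)) (fres U (Dopen f) f) = 1.
    by rewrite -fresM // hu fres1.
  set F := fres _ _ (fres _ _ f) in hu' *; set u' := fres _ _ u in hu' *.
  rewrite !exprMn exprD -!exprM.
  transitivity ((u' * F) ^+ m * (u' * F) ^+ (n * m) * (fres (Dopen f) (Dopen (f * g)) s ^+ m * t)).
    by rewrite hu' !expr1n !mul1r.
  by rewrite !exprMn; ring.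
- move=> s D /principalE -> t e0; have [n [g e]] := frac s; have [m [a ea]] := frac t.
  have eD : Dopen s = Dopen (f * g).
    apply: opens_eq => x.
      move=> sx; have Dx : oset (Dopen f) x by apply: inv_at_in sx.
      by apply/inv_atM; split=> //; apply/(inv_frac _ _ _ _ Dx e).
    by move=> /inv_atM [Dx gx]; apply/(inv_frac _ _ _ _ Dx e).
  have [u hu] : exists u, u * fres U (Dopen f) f = 1 by apply: Dopen_unit.
  have hE : Dopen (f * g) `<=` Dopen f by rewrite DopenM; apply: oIl.
  have [|l el] := @affine_zero_D (f * g) a.
    by rewrite -(fres_comp _ hD hE) -ea fresM // -eD e0 mulr0.
  exists l; have := congr1 (fres U (Dopen f)) el.
  rewrite fresM // fresX // fresM // fres0 // -ea -e.
  set F := fres U (Dopen f) f in hu *.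
  move=> z; transitivity ((u * F) ^+ (l + n * l + m) * (s ^+ l * t)).
    by rewrite hu expr1n mul1r.
  transitivity (u ^+ (l + n * l + m) * ((F * (F ^+ n * s)) ^+ l * (F ^+ m * t))).
    by rewrite !exprMn !exprD -!exprM; ring.
  by rewrite z mulr0.
Qed.
End Affine.

(** * Frames and dual bases *)

Section EmptyOpen.
Variables (k : fieldType) (X : rspace k) (M : omod X).
Lemma sec_empty (U : opens X) (s t : M U) : (forall x, ~ oset U x) -> s = t.
Proof. by move=> h; apply: (sheaf_sep (omodP M)) => x /h. Qed.
End EmptyOpen.

Section RsSum.
Variables (k : fieldType) (X : rspace k) (M N : psh X).
Lemma rsB (U V : opens X) (s t : M U) : V `<=` U -> rs U V (s - t) = rs U V s - rs U V t.
Proof. by move=> h; rewrite rsD // rsN. Qed.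
Lemma rs_sum (U V : opens X) I (r : seq I) (P : pred I) (s : I -> M U) : V `<=` U ->
  rs U V (\sum_(i <- r | P i) s i) = \sum_(i <- r | P i) rs U V (s i).
Proof.
move=> h; apply: (big_rec2 (fun u v => rs U V u = v)); first by rewrite rs0.
by move=> i u v _ <-; rewrite rsD.
Qed.
Lemma hfN (f : ohom M N) U (s : M U) : f U (- s) = - f U s.
Proof. by apply: (addrI (f U s)); rewrite -hfD !subrr hf0. Qed.
Lemma hfB (f : ohom M N) U (s t : M U) : f U (s - t) = f U s - f U t.
Proof. by rewrite hfD hfN. Qed.
Lemma hf_sum (f : ohom M N) U I (r : seq I) (P : pred I) (s : I -> M U) :
  f U (\sum_(i <- r | P i) s i) = \sum_(i <- r | P i) f U (s i).
Proof.
apply: (big_rec2 (fun u v => f U u = v)); first by rewrite hf0.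
by move=> i u v _ <-; rewrite hfD.
Qed.
End RsSum.

Section ShomTheory.
Variables (k : fieldType) (X : rspace k) (M : psh X) (N : omod X) (U : opens X).
Variable f : shom M N U.
Lemma shom_irr (V : opens X) (h h' : V `<=` U) s : f V h s = f V h' s.
Proof. by rewrite (Prop_irrelevance h h'). Qed.
Lemma shomD (V : opens X) (h : V `<=` U) s t : f V h (s + t) = f V h s + f V h t.
Proof. by rewrite -[s]scale1r shom_lin !scale1r. Qed.
Lemma shom_0 (V : opens X) (h : V `<=` U) : f V h 0 = 0.
Proof. by apply: (addrI (f V h 0)); rewrite -shomD !addr0. Qed.
Lemma shomZ (V : opens X) (h : V `<=` U) a s : f V h (a *: s) = a *: f V h s.
Proof. by rewrite -[a *: s]addr0 shom_lin shom_0 addr0. Qed.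
Lemma shom_sum (V : opens X) (h : V `<=` U) n (s : 'I_n -> M V) :
  f V h (\sum_i s i) = \sum_i f V h (s i).
Proof.
apply: (big_rec2 (fun u v => f V h u = v)); first by rewrite shom_0.
by move=> i u v _ <-; rewrite shomD.
Qed.
End ShomTheory.

Section Frames.
Variables (k : fieldType) (X : rspace k).

Section One.
Variables (E : omod X) (U : opens X) (n : nat) (e : 'I_n -> E U).
Hypothesis he : is_frame e.

Lemma frame_inj (V : opens X) (a b : 'I_n -> fn X V) : V `<=` U ->
  \sum_j a j *: rs U V (e j) = \sum_j b j *: rs U V (e j) -> forall j, a j = b j.
Proof.
move=> hV eab j; have [c [ec uc]] := he (\sum_j a j *: rs U V (e j)) hV.
have ca : c = \row_j a j by apply: uc; apply: eq_bigr => i _; rewrite mxE.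
have cb : c = \row_j b j by apply: uc; rewrite eab; apply: eq_bigr => i _; rewrite mxE.
by move: (congr1 (fun u : 'rV_n => u 0 j) (etrans (esym ca) cb)); rewrite !mxE.
Qed.

Definition fcoord (V : opens X) (h : V `<=` U) (s : E V) : 'rV[fn X V]_n :=
  projT1 (cid (he s h)).
Lemma fcoordE (V : opens X) (h : V `<=` U) (s : E V) :
  s = \sum_j fcoord h s 0 j *: rs U V (e j).
Proof. by case: (projT2 (cid (he s h))). Qed.
Lemma fcoord_uniq (V : opens X) (h : V `<=` U) (s : E V) (a : 'I_n -> fn X V) :
  s = \sum_j a j *: rs U V (e j) -> forall j, fcoord h s 0 j = a j.
Proof. by move=> es; apply: frame_inj => //; rewrite -fcoordE. Qed.

Section Coord.
Variable j : 'I_n.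
Definition frame_coord_fun (V : opens X) (h : V `<=` U) (s : E V) : Omodule X V := fcoord h s 0 j.
Lemma frame_coord_lin (V : opens X) (h : V `<=` U) a s t :
  frame_coord_fun h (a *: s + t) = a *: frame_coord_fun h s + frame_coord_fun h t.
Proof.
apply: (@fcoord_uniq V h _ (fun j => a * fcoord h s 0 j + fcoord h t 0 j)).
rewrite {1}(fcoordE h s) {1}(fcoordE h t) scaler_sumr -big_split /=.
by apply: eq_bigr => i _; rewrite scalerDl scalerA.
Qed.
Lemma frame_coord_rs (V W : opens X) (h : V `<=` U) (h' : W `<=` U) s : W `<=` V ->
  frame_coord_fun h' (rs V W s) = rs V W (frame_coord_fun h s).
Proof.
move=> hW; apply: (@fcoord_uniq W h' _ (fun j => fres V W (fcoord h s 0 j))).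
rewrite {1}(fcoordE h s) rs_sum //.
by apply: eq_bigr => i _; rewrite rsZ // rs_comp.
Qed.
Definition frame_coord : shom E (Omodule X) U := Shom frame_coord_lin frame_coord_rs.
End Coord.

Lemma frame_coordE (V : opens X) (h : V `<=` U) (s : E V) :
  s = \sum_j (frame_coord j V h s : fn X V) *: rs U V (e j).
Proof. exact: fcoordE. Qed.
Lemma frame_coord_uniq (V : opens X) (h : V `<=` U) (s : E V) (a : 'I_n -> fn X V) :
  s = \sum_j a j *: rs U V (e j) -> forall j, frame_coord j V h s = a j.
Proof. exact: fcoord_uniq. Qed.
Lemma frame_coord_frame (V : opens X) (h : V `<=` U) i j :
  frame_coord j V h (rs U V (e i)) = (j == i)%:R.
Proof.
apply: (@frame_coord_uniq V h _ (fun j => (j == i)%:R)).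
rewrite (bigD1 i) //= eqxx scale1r big1 ?addr0 // => l /negbTE ->.
by rewrite scale0r.
Qed.

Lemma frame_rs (W : opens X) : W `<=` U -> is_frame (fun j => rs U W (e j)).
Proof.
move=> hW V s hV; have [a [ea ua]] := he s (subset_trans hV hW).
exists a; split=> [|b eb].
  by rewrite ea; apply: eq_bigr => j _; rewrite rs_comp.
by apply: ua; rewrite eb; apply: eq_bigr => j _; rewrite rs_comp.
Qed.
End One.

Lemma frame_near n (E : omod X) : locally_free n E -> forall (U : opens X) x, oset U x ->
  exists V : opens X, [/\ oset V x, V `<=` U & exists e : 'I_n -> E V, is_frame e].
Proof.
move=> hE U x Ux; have [V [Vx [e he]]] := hE x.
exists (oI U V); split=> //; first exact: oIl.
by exists (fun j => rs V (oI U V) (e j)); apply: frame_rs => //; apply: oIr.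
Qed.
End Frames.

Section RankOne.
Variables (k : fieldType) (X : rspace k) (F : omod X).
Hypothesis hF : locally_free 1 F.

Section Line.
Variables (U : opens X) (l : F U).
Hypothesis hl : is_frame (fun _ : 'I_1 => l).
Lemma line_frame (V : opens X) (s : F V) : V `<=` U -> exists a : fn X V, s = a *: rs U V l.
Proof.
by move=> hV; have [a [ea _]] := hl s hV; exists (a 0 0); rewrite {1}ea big_ord1.
Qed.
Lemma line_frame0 (V : opens X) (a : fn X V) : V `<=` U -> a *: rs U V l = 0 -> a = 0.
Proof.
move=> hV e.
apply: (@frame_inj _ _ _ _ _ _ hl V (fun=> a) (fun=> 0) hV _ 0).
by rewrite !big_ord1 scale0r.
Qed.
End Line.

Lemma near_affine (U : opens X) (x : X) : affine U -> oset U x -> exists f : fn X U,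
  inv_at f x /\ exists l : F (Dopen f), is_frame (fun _ : 'I_1 => l).
Proof.
move=> affU Ux; have [V [Vx hV [e he]]] := frame_near hF Ux.
have [f [fx hf]] := affine_basis_D affU Ux Vx; exists f; split=> //.
exists (rs V (Dopen f) (e 0)).
move: (frame_rs he hf); congr (is_frame _).
by apply/funext => j; rewrite (ord1 j).
Qed.

(** The functions [h] such that some [f^n t] vanishes on [D(h)] form an ideal, and near every point
    one of them is invertible: there [t = a l] for a frame [l] on the affine set [D(h)], and a power
    of [f] kills [a]. Quasi-compactness then puts 1 in the ideal. *)
Lemma section_zero_pow (U : opens X) (f : fn X U) (t : F U) : affine U ->
  rs U (Dopen f) t = 0 -> exists n, f ^+ n *: t = 0.
Proof.
move=> affU t0; pose J : set (fn X U) := [set h | exists n, rs U (Dopen h) (f ^+ n *: t) = 0].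
suff [n] : J 1 by rewrite Dopen1 rs_id; exists n.
apply: affine_ideal1 => //; first split.
- by exists 0%N; apply: sec_empty => x /(inv_at0 affU).
(* [D(h + h')] is covered by [D(h)] and [D(h')], since the functions not invertible at a point form
   an ideal. *)
- move=> h h' [n en] [n' en']; exists (n + n')%N.
  apply: (sheaf_sep (omodP F)) => x hx.
  have hU := @Dopen_sub _ _ _ (h + h').
  case: (inv_atD affU hx) => gx.
    have hl := @oIl _ (Dopen (h + h')) (Dopen h); have hr := @oIr _ (Dopen (h + h')) (Dopen h).
    exists (oI (Dopen (h + h')) (Dopen h)); split=> //.
    rewrite rs_comp // -(rs_comp _ (@Dopen_sub _ _ _ h) hr) exprD mulrC -scalerA rsZ; last exact: Dopen_sub.
    by rewrite en scaler0 !rs0.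
  have hl := @oIl _ (Dopen (h + h')) (Dopen h'); have hr := @oIr _ (Dopen (h + h')) (Dopen h').
  exists (oI (Dopen (h + h')) (Dopen h')); split=> //.
  rewrite rs_comp // -(rs_comp _ (@Dopen_sub _ _ _ h') hr) exprD -scalerA rsZ; last exact: Dopen_sub.
  by rewrite en' scaler0 !rs0.
- move=> c h [n en]; exists n; rewrite DopenM.
  have hr := @oIr _ (Dopen c) (Dopen h).
  by rewrite -(rs_comp _ (@Dopen_sub _ _ _ h) hr) en rs0.
move=> x Ux; have [h [hx [l hl]]] := near_affine affU Ux; exists h; split=> //.
have hU := @Dopen_sub _ _ _ h.
have [a ea] := line_frame hl (rs U (Dopen h) t) (@opens_refl _ _).
have [|n en] := @affine_zero_D _ _ _ (affine_D affU h) (fres U (Dopen h) f) a.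
  have hD := @Dopen_sub _ _ _ (fres U (Dopen h) f).
  apply: (line_frame0 hl) => //.
  move: (congr1 (rs (Dopen h) (Dopen (fres U (Dopen h) f))) ea).
  rewrite rs_id rsZ // rs_comp // => <-.
  have hDf : Dopen (fres U (Dopen h) f) `<=` Dopen f.
    by move=> y fy; apply/(inv_at_rs f hU); [apply: hD fy|].
  by rewrite -(rs_comp t (@Dopen_sub _ _ _ f) hDf) t0 rs0.
exists n; rewrite rsZ // ea rs_id fresX // scalerA.
by rewrite en scale0r.
Qed.

(** The same ideal argument, for the functions [h] such that some [f^n s] extends to [D(h)]. Closure
    under addition is the difficult point: extensions over [D(h)] and [D(h')] are only known to
    agree where [f] is invertible. *)
Lemma section_extends (U : opens X) (f : fn X U) (s : F (Dopen f)) : affine U ->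
  exists n (t : F U), rs U (Dopen f) t = fres U (Dopen f) (f ^+ n) *: s.
Proof.
move=> affU; have fU := @Dopen_sub _ _ _ f.
pose J : set (fn X U) := [set h | exists n (t : F (Dopen h)), forall O : opens X,
  O `<=` Dopen h -> O `<=` Dopen f -> rs _ O t = fres U O (f ^+ n) *: rs _ O s].
suff [n [t ht]] : J 1.
  exists n, (rs (Dopen 1) U t); rewrite rs_comp ?Dopen1 // ht ?Dopen1 ?rs_id //.
apply: affine_ideal1 => //; first split.
- exists 0%N, 0 => O h0 _; apply: sec_empty => x /h0; exact: inv_at0.
- move=> h h' [n [t ht]] [n' [t' ht']].
  have hU := @Dopen_sub _ _ _ h; have hU' := @Dopen_sub _ _ _ h'.
  pose G := Dopen (h * h').
  have Gh : G `<=` Dopen h by rewrite /G DopenM; apply: oIl.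
  have Gh' : G `<=` Dopen h' by rewrite /G DopenM; apply: oIr.
  have GU := subset_trans Gh hU.
  pose fG := fres U G f.
  have hfG := @Dopen_sub _ _ _ fG.
  have hfGf : Dopen fG `<=` Dopen f.
    by move=> y fy; apply/(inv_at_rs f GU); [apply: hfG fy|].
  (* Both extensions are brought to the common exponent [n + n']. *)
  pose u := fres U (Dopen h) (f ^+ n') *: t; pose u' := fres U (Dopen h') (f ^+ n) *: t'.
  have hu (O : opens X) : O `<=` Dopen h -> O `<=` Dopen f ->
      rs _ O u = fres U O (f ^+ (n + n')) *: rs _ O s.
    move=> h1 h2; rewrite rsZ // fres_comp // ht // scalerA -fresM; last exact: subset_trans hU.
    by rewrite -exprD addnC.
  have hu' (O : opens X) : O `<=` Dopen h' -> O `<=` Dopen f ->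
      rs _ O u' = fres U O (f ^+ (n + n')) *: rs _ O s.
    move=> h1 h2; rewrite rsZ // fres_comp // ht' // scalerA -fresM; last exact: subset_trans hU'.
    by rewrite -exprD.
  clearbody u u'.
  (* The difference vanishes where [f] is invertible, so [f^p] kills it on all of [D(h h')]; after
     this multiplication the extensions glue. *)
  have [|p ep] := @section_zero_pow G fG (rs _ G u - rs _ G u') (affine_D affU _).
    have h1 := subset_trans hfG Gh; have h2 := subset_trans hfG Gh'.
    by rewrite rsB // !rs_comp // hu // hu' // subrr.
  pose v := fres U (Dopen h) (f ^+ p) *: u; pose v' := fres U (Dopen h') (f ^+ p) *: u'.
  have evv : rs _ G v = rs _ G v'.
    by rewrite !rsZ // !fres_comp //; apply: subr0_eq; rewrite -scalerBr fresX.
  pose P (O : opens X) (r : F O) :=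
    (O `<=` Dopen h /\ r = rs _ O v) \/ (O `<=` Dopen h' /\ r = rs _ O v').
  have [|||w hw] := @glue_unique _ _ F (Dopen (h + h')) P.
  - move=> O O' r hO hO' [[h1 ->]|[h1 ->]]; [left|right];
      by rewrite rs_comp //; split=> //; apply: subset_trans h1.
  - have agree (O : opens X) : O `<=` Dopen h -> O `<=` Dopen h' -> rs _ O v = rs _ O v'.
      move=> h1 h2; have hG : O `<=` G by rewrite /G DopenM; apply: oIs.
      by rewrite -(rs_comp _ Gh hG) evv rs_comp.
    move=> O r r' hO [[h1 ->]|[h1 ->]] [[h2 ->]|[h2 ->]] //; first exact: agree.
    by symmetry; apply: agree.
  - move=> x hx; case: (inv_atD affU hx) => gx.
      exists (oI (Dopen (h + h')) (Dopen h)); split=> //; first exact: oIl.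
      by exists (rs _ _ v); left; split=> //; apply: oIr.
    exists (oI (Dopen (h + h')) (Dopen h')); split=> //; first exact: oIl.
    by exists (rs _ _ v'); right; split=> //; apply: oIr.
  exists (p + (n + n'))%N, w => O hO hOf; apply: (sheaf_sep (omodP F)) => x Ox.
  have OU := subset_trans hO (@Dopen_sub _ _ _ (h + h')).
  case: (inv_atD affU (hO _ Ox)) => gx.
    have hl := @oIl _ O (Dopen h); have hr := @oIr _ O (Dopen h).
    have hlU := subset_trans hl OU; have hlf := subset_trans hl hOf.
    exists (oI O (Dopen h)); split=> //.
    rewrite rs_comp // (hw _ (rs _ _ v)); [|exact: subset_trans hO|by left].
    by rewrite !rsZ // hu // scalerA !fres_comp // -fresM // -exprD rs_comp.
  have hl := @oIl _ O (Dopen h'); have hr := @oIr _ O (Dopen h').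
  have hlU := subset_trans hl OU; have hlf := subset_trans hl hOf.
  exists (oI O (Dopen h')); split=> //.
  rewrite rs_comp // (hw _ (rs _ _ v')); [|exact: subset_trans hO|by right].
  by rewrite !rsZ // hu' // scalerA !fres_comp // -fresM // -exprD rs_comp.
- move=> c h [n [t ht]]; exists n.
  have hr : Dopen (c * h) `<=` Dopen h by rewrite DopenM; apply: oIr.
  exists (rs _ _ t) => O hO hOf; rewrite rs_comp // ht //; exact: subset_trans hr.
(* Near [x], [s = a l] over [D(f h)], and [f^n a] extends to a function [b] on [D(h)]; the extension
   of [f^n s] is [b l]. *)
move=> x Ux; have [h [hx [l hl]]] := near_affine affU Ux; exists h; split=> //.
have hU := @Dopen_sub _ _ _ h; pose fh := fres U (Dopen h) f.
have hfh := @Dopen_sub _ _ _ fh.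
have hfhf : Dopen fh `<=` Dopen f.
  by move=> y fy; apply/(inv_at_rs f hU); [apply: hfh fy|].
have [a ea] := line_frame hl (rs _ (Dopen fh) s) hfh.
have [n [b eb]] := affine_frac_D (affine_D affU h) a.
exists n, (b *: l) => O hO hOf.
have hOfh : O `<=` Dopen fh.
  by move=> y Oy; apply/(inv_at_rs f hU); [apply: hO|apply: hOf].
have hOU := subset_trans hO hU.
rewrite -(rs_comp s hfhf hOfh) ea rsZ // rsZ // rs_comp // scalerA.
congr (_ *: _); rewrite -(fres_comp b hfh hOfh) -eb fresM // !fresX //.
by rewrite !fres_comp.
Qed.

Section Dual.
Variables (U : opens X) (l : F U).
Hypothesis hl : is_frame (fun _ : 'I_1 => l).
Lemma dual_frame : is_frame (fun _ : 'I_1 => frame_coord hl 0 : sHom F (Omodule X) U).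
Proof.
have coord_l (W : opens X) (h : W `<=` U) : frame_coord hl 0 W h (rs U W l) = 1 :> fn X W.
  exact: (frame_coord_frame hl h 0 0).
move=> V f hV.
pose a : fn X V := (f : shom _ _ _) V (@opens_refl _ _) (rs U V l).
exists (\row_(i < 1) a); split.
  rewrite big_ord1 mxE; apply: shom_ext => W h s.
  have hWU := subset_trans h hV.
  rewrite [RHS]shom_scaleE (shom_rE _ hV h hWU).
  rewrite {1}(frame_coordE hl hWU s) big_ord1 shomZ.
  have -> : f W h (rs U W l) = fres V W a.
    have -> : rs U W l = rs V W (rs U V l) by rewrite rs_comp.
    by rewrite (shom_rs _ (@opens_refl _ _)).
  exact: mulrC.
move=> b; rewrite big_ord1 => eb; apply/rowP => i; rewrite mxE (ord1 i).
rewrite /a eb [LHS](shom_scaleE _ _ (@opens_refl _ _)).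
by rewrite (shom_rE _ hV _ hV) coord_l fres_id [LHS]mulr1.
Qed.
End Dual.
End RankOne.

Section DualBasis.
Variables (k : fieldType) (X : rspace k).

Definition dual_basis (E : omod X) (U : opens X) r (phi : 'I_r -> shom E (Omodule X) U)
    (m : 'I_r -> E U) : Prop :=
  forall (V : opens X) (h : V `<=` U) (s : E V),
    s = \sum_i (phi i V h s : fn X V) *: rs U V (m i).

Lemma frame_dual_basis n (E : omod X) (U : opens X) (e : 'I_n -> E U) (he : is_frame e) :
  dual_basis (frame_coord he) e.
Proof. by move=> V h s; apply: frame_coordE. Qed.


Section Line.
Variable L : omod X.
Hypothesis hL : locally_free 1 L.

Lemma locally_free_dual : locally_free 1 (sHom L (Omodule X)).
Proof.
move=> x; have [U [Ux [e he]]] := hL x; exists U; split=> //.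
have hl : is_frame (fun _ : 'I_1 => e 0).
  by move: he; congr (is_frame _); apply/funext => j; rewrite (ord1 j).
by exists (fun=> frame_coord hl 0); apply: dual_frame.
Qed.

(** In rank one [s] and [t] are locally multiples of one generator [l], and both sides equal
    [phi(l)] times the product of the two coordinates times [l]. *)
Lemma line_swap (U : opens X) (phi : shom L (Omodule X) U) (V : opens X) (h : V `<=` U) (s t : L V) :
  (phi V h s : fn X V) *: t = (phi V h t : fn X V) *: s.
Proof.
apply: (sheaf_sep (omodP L)) => x Vx.
have [W [Wx hW [e he]]] := frame_near hL Vx; exists W; split=> //.
have hWU := subset_trans hW h.
have key u : fres V W (phi V h u) = phi W hWU (rs V W u) :> fn X W.
  by rewrite (shom_rs phi h hWU).
rewrite !rsZ // !key.
rewrite (frame_coordE he (@opens_refl _ _) (rs V W s)) (frame_coordE he (@opens_refl _ _) (rs V W t)).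
have rot (a b c : fn X W) : a * b * c = c * b * a by ring.
by rewrite !big_ord1 !shomZ !scalerA; congr (_ *: _); apply: rot.
Qed.

(** [J] is the trace ideal of [L]. Once [1 = sum_i phi_i(m_i)], [line_swap] gives [s = sum_i
    phi_i(m_i) s = sum_i phi_i(s) m_i]. *)
Lemma line_dual_basis (U : opens X) : affine U ->
  exists r (phi : 'I_r -> shom L (Omodule X) U) (m : 'I_r -> L U), dual_basis phi m.
Proof.
move=> affU; have hU := @opens_refl _ U.
pose J : set (fn X U) := [set f | exists l : seq (shom L (Omodule X) U * L U),
  f = \sum_(p <- l) (p.1 U hU p.2 : fn X U)].
suff [l el] : J 1.
  exists (size l), (fun i => (tnth (in_tuple l) i).1), (fun i => (tnth (in_tuple l) i).2).
  move=> V h s; transitivity (\sum_(p <- l) (p.1 V h s : fn X V) *: rs U V p.2); last first.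
    by rewrite big_tnth.
  rewrite -[LHS]scale1r -(fres1 h) el.
  transitivity (\sum_(p <- l) (p.1 V h (rs U V p.2) : fn X V) *: s); last first.
    by apply: eq_bigr => p _; apply: line_swap.
  rewrite -scaler_suml; congr (_ *: _).
  rewrite [LHS](rs_sum (M := Omodule X)) //; apply: eq_bigr => p _.
  by rewrite (shom_rs _ hU).
apply: affine_ideal1 => //; first split.
- by exists [::]; rewrite big_nil.
- by move=> a b [l ->] [l' ->]; exists (l ++ l'); rewrite big_cat.
- move=> a b [l ->]; exists [seq (p.1, a *: p.2) | p <- l].
  by rewrite big_map mulr_sumr; apply: eq_bigr => p _ /=; rewrite shomZ.
move=> x Ux; have [f [fx [l hl]]] := near_affine hL affU Ux.
have fU := @Dopen_sub _ _ _ f.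
(* After multiplication by powers of [f], the frame [l] and its dual functional extend to [m] and
   [phi] over [U]. On [D(f)] their pairing is [f^(n' + n)], which is invertible at [x]. *)
have [n [m em]] := section_extends hL l affU.
have [n' [phi ephi]] :=
  section_extends locally_free_dual (frame_coord hl 0 : sHom L (Omodule X) (Dopen f)) affU.
exists (phi U hU m : fn X U); split; first by exists [:: (phi, m)]; rewrite big_seq1.
apply/(inv_at_rs _ fU fx).
have -> : fres U (Dopen f) (phi U hU m) = fres U (Dopen f) (f ^+ n' * f ^+ n).
  transitivity (phi (Dopen f) fU (rs U (Dopen f) m) : fn X _); first by rewrite (shom_rs _ hU).
  have := congr1 (fun g : shom _ _ _ => g (Dopen f) (@opens_refl _ _) (rs U (Dopen f) m)) ephi.
  rewrite (shom_rE _ fU _ fU) => ->.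
  rewrite [LHS]shom_scaleE fres_id em shomZ -[X in frame_coord _ _ _ _ X]rs_id.
  rewrite (frame_coord_frame hl _ 0 0) fresM //.
  exact: (congr1 (fun a => _ * a) (mulr1 _)).
by apply/(inv_at_rs _ fU fx)/inv_atM; split; apply: inv_atX.
Qed.
End Line.
End DualBasis.

(** * Differentials on a smooth affine curve *)

Section PolynomialEvaluation.
Variables (k : fieldType) (X : rspace k) (U : opens X) (n : nat) (v : 'I_n -> fn X U).
Hypothesis nz : (1 : fn X U) != 0.
Notation S := (nzring nz).

Lemma mevD q q' : mev v (q + q') = mev v q + mev v q'.
Proof. exact: (mpoly.mmapD (S := S) v (Defs.cst U)). Qed.
Lemma mevM q q' : mev v (q * q') = mev v q * mev v q'.
Proof.
by have [h _] := mpoly.mmap_is_multiplicative (S := S) v (Defs.cst U); apply: h.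
Qed.
Lemma mevC c : mev v (mpoly.mpolyC n c) = Defs.cst U c.
Proof. exact: (mpoly.mmapC (S := S) v (Defs.cst U)). Qed.
Lemma mevX i : mev v (mpoly.mpolyX k (mpoly.mnm1 i)) = v i.
Proof.
rewrite -[RHS](mpoly.mmap1U (S := S) v).
exact: (mpoly.mmapX (S := S) v (Defs.cst U)).
Qed.
Lemma mev0 : mev v 0 = 0.
Proof. exact: (mpoly.mmap0 (S := S) v (Defs.cst U)). Qed.
Lemma mevB q q' : mev v (q - q') = mev v q - mev v q'.
Proof. exact: (mpoly.mmapB (S := S) v (Defs.cst U)). Qed.

Lemma mderiv_var (i j : 'I_n) :
  mpoly.mderiv i (mpoly.mpolyX k (mpoly.mnm1 j)) = mpoly.mpolyC n (j == i)%:R.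
Proof.
rewrite mpoly.mderivX mpoly.mnm1E; case: eqVneq => [->|_]; last first.
  by rewrite scale0r -mpoly.mpolyC0.
rewrite scale1r (_ : mpoly.mnm_sub _ _ = mpoly.mnm0) ?mpoly.mpolyX0 //.
by apply/mpoly.mnmP => l; rewrite mpoly.mnmBE mpoly.mnm0E subnn.
Qed.

Lemma derivation_mev (M : lmodType (fn X U)) (d : fn X U -> M) q :
  derivation (@kcst k X U) M d ->
  d (mev v q) = \sum_j mev v (mpoly.mderiv j q) *: d (v j).
Proof.
move=> hd; pose Q q := d (mev v q) = \sum_j mev v (mpoly.mderiv j q) *: d (v j).
have QC c : Q (mpoly.mpolyC n c).
  rewrite /Q mevC (deriv_cst hd); last by exists c.
  by rewrite big1 // => j _; rewrite mpoly.mderivC mev0 scale0r.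
have QM p r : Q p -> Q r -> Q (p * r).
  rewrite /Q mevM (Defs.derivM hd) => -> ->; rewrite !scaler_sumr -big_split /=.
  apply: eq_bigr => j _; rewrite mpoly.mderivM mevD !mevM !scalerA scalerDl.
  by rewrite addrC; congr (_ *: _ + _); rewrite mulrC.
have QD p r : Q p -> Q r -> Q (p + r).
  rewrite /Q mevD (Defs.derivD hd) => -> ->; rewrite -big_split /=.
  by apply: eq_bigr => j _; rewrite mpoly.mderivD mevD scalerDl.
have QX j : Q (mpoly.mpolyX k (mpoly.mnm1 j)).
  rewrite /Q mevX (bigD1 j) //= big1 ?addr0.
    by rewrite mderiv_var eqxx mevC rmorph1 scale1r.
  by move=> i /negbTE ij; rewrite mderiv_var eq_sym ij mevC rmorph0 scale0r.
have Q1 : Q 1 by rewrite -mpoly.mpolyC1; apply: QC.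
elim/mpoly.mpolyind: q => [|c m p _ _ IH].
  by rewrite -[0]mpoly.mpolyC0; apply: QC.
apply: QD => //; rewrite -mpoly.mul_mpolyC; apply: (QM); first exact: QC.
rewrite mpoly.mpolyXE_id; apply: (big_ind Q) => // i _.
elim: (mpoly.fun_of_multinom m _) => [|l IHl]; first by rewrite expr0.
by rewrite exprS; apply: (QM).
Qed.
End PolynomialEvaluation.

Section KaehlerUnique.
Variables (k : fieldType) (X : rspace k) (C : forall U : opens X, set (fn X U)).
Hypothesis C_res : forall (U V : opens X) c, V `<=` U -> C c -> C (fres U V c).
Lemma kaehler_hom_unique (N : omod X) (g h : ohom (kaehler C_res) N) :
  (forall U f, g U (kd C_res f) = h U (kd C_res f)) -> forall U s, g U s = h U s.
Proof.
move=> e; apply: sheafify_uniq => U s.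
rewrite (pres_span s) !hf_sum; apply: eq_bigr => p _.
by rewrite !hfZ; congr (_ *: _); apply: e.
Qed.
End KaehlerUnique.

(* The derivation of the coordinate ring of a smooth affine curve which is 1 on
   the coordinate singled out by the Jacobian criterion. *)
Section SmoothDerivation.
Variables (k : fieldType) (X : rspace k) (U : opens X) (n : nat).
Variables (f : 'I_n -> mpoly.mpoly n.+1 k) (v : 'I_n.+1 -> fn X U) (g : fn X U).
Hypothesis nz : (1 : fn X U) != 0.
Hypothesis v_gen : forall s, exists q, s = mev v q.
Hypothesis v_ker : forall q, mev v q = 0 <->
  exists c : 'I_n -> mpoly.mpoly n.+1 k, q = \sum_i c i * f i.
Local Notation w := (widen_ord (leqnSn n)).
Local Notation J := (\matrix_(i < n, j < n) mev v (mpoly.mderiv (w j) (f i))).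
Hypothesis g_det : g * \det J = 1.

Lemma mev_f i : mev v (f i) = 0.
Proof.
apply/v_ker; exists (fun j => (j == i)%:R).
by rewrite (bigD1 i) //= eqxx mul1r big1 ?addr0 // => j /negbTE ->; rewrite mul0r.
Qed.

Let last_col i : fn X U := mev v (mpoly.mderiv ord_max (f i)).
Let invJ : 'M_n := g *: \adj J.
(** The derivative of [v j] with respect to the last coordinate: Cramer's solution of
    [sum_j (df_i/dx_j) x_j = 0] normalized by [x_max = 1]. *)
Definition slope (j : 'I_n.+1) : fn X U :=
  if unlift ord_max j is Some i then - \sum_l invJ i l * last_col l else 1.

Lemma slope_max : slope ord_max = 1.
Proof. by rewrite /slope unlift_none. Qed.
Lemma slope_w (j : 'I_n) : slope (w j) = - \sum_l invJ j l * last_col l.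
Proof.
have -> : w j = lift ord_max j by apply: val_inj; rewrite [LHS]/= [RHS]lift_max.
by rewrite /slope liftK.
Qed.

(** Multiplying the relations by the inverse of the square block [J] expresses every unknown by the
    last one. The unknowns live in a module so that they can be the differentials [d (v j)]. *)
Lemma solve_jacobian (M : lmodType (fn X U)) (x : 'I_n.+1 -> M) :
  (forall i, \sum_j mev v (mpoly.mderiv j (f i)) *: x j = 0) ->
  forall j, x j = slope j *: x ord_max.
Proof.
move=> h.
have hw (j : 'I_n) : x (w j) = slope (w j) *: x ord_max.
  have E : \sum_i invJ j i *: (\sum_l mev v (mpoly.mderiv l (f i)) *: x l) = 0.
    by rewrite big1 // => i _; rewrite h scaler0.
  rewrite slope_w scaleNr scaler_suml; apply/eqP; rewrite -addr_eq0; apply/eqP.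
  rewrite -{}[RHS]E.
  under [RHS]eq_bigr => i _ do rewrite big_ord_recr /= scalerDr.
  rewrite big_split /=; congr (_ + _); last by apply: eq_bigr => i _; rewrite scalerA.
  under [RHS]eq_bigr => i _ do rewrite scaler_sumr.
  rewrite exchange_big /=.
  transitivity (\sum_l (j == l)%:R *: x (w l)).
    rewrite (bigD1 j) //= eqxx scale1r big1 ?addr0 // => l.
    by rewrite eq_sym => /negbTE ->; rewrite scale0r.
  apply: eq_bigr => l _.
  transitivity ((invJ *m J) j l *: x (w l)); last first.
    by rewrite mxE scaler_suml; apply: eq_bigr => i _; rewrite scalerA !mxE.
  by rewrite -scalemxAl mul_adj_mx scale_scalar_mx g_det mxE.
move=> j; case: (unliftP ord_max j) => [i ->|->]; last by rewrite slope_max scale1r.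
have -> : lift ord_max i = w i by apply: val_inj; rewrite [LHS]lift_max.
exact: hw.
Qed.

Lemma slope_f i : \sum_j mev v (mpoly.mderiv j (f i)) * slope j = 0.
Proof.
rewrite big_ord_recr /= slope_max mulr1.
under eq_bigr => j _ do rewrite slope_w mulrN.
rewrite sumrN.
under eq_bigr => j _ do rewrite mulr_sumr.
rewrite exchange_big /=.
transitivity (- (\sum_l (i == l)%:R * last_col l) + last_col i).
  congr (- _ + _); apply: eq_bigr => l _.
  transitivity ((J *m invJ) i l * last_col l); last first.
    by rewrite -scalemxAr mul_mx_adj scale_scalar_mx g_det mxE.
  by rewrite mxE mulr_suml; apply: eq_bigr => j _; rewrite mulrA !mxE.
rewrite (bigD1 i) //= eqxx mul1r big1 ?addr0 ?addNr // => l.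
by rewrite eq_sym => /negbTE ->; rewrite mul0r.
Qed.

Let dpoly q : fn X U := \sum_j mev v (mpoly.mderiv j q) * slope j.
Lemma dpolyD q q' : dpoly (q + q') = dpoly q + dpoly q'.
Proof.
by rewrite /dpoly -big_split; apply: eq_bigr => j _; rewrite mpoly.mderivD mevD // mulrDl.
Qed.
Lemma dpolyM q q' : dpoly (q * q') = mev v q * dpoly q' + mev v q' * dpoly q.
Proof.
rewrite /dpoly !mulr_sumr -big_split; apply: eq_bigr => j _ /=.
by rewrite mpoly.mderivM mevD // !mevM //; ring.
Qed.
(** What makes [dpoly] descend to the coordinate ring: by the Leibniz rule it suffices that both
    [f i] and [dpoly (f i)] evaluate to zero. *)
Lemma dpoly_ker q : mev v q = 0 -> dpoly q = 0.
Proof.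
move=> /v_ker [c ->].
apply: (big_ind (fun q => dpoly q = 0)).
- by rewrite -mpoly.mpolyC0 /dpoly big1 // => j _; rewrite mpoly.mderivC mev0 // mul0r.
- by move=> p r hp hr; rewrite dpolyD hp hr addr0.
by move=> i _; rewrite dpolyM mev_f mul0r addr0 /dpoly slope_f mulr0.
Qed.
Lemma dpoly_eq q q' : mev v q = mev v q' -> dpoly q = dpoly q'.
Proof.
move=> e; have e0 : mev v (q - q') = 0 by rewrite mevB // e subrr.
by rewrite -[q](subrK q') dpolyD (dpoly_ker e0) add0r.
Qed.

Definition lift_poly s := projT1 (cid (v_gen s)).
Lemma lift_polyE s : mev v (lift_poly s) = s.
Proof. by rewrite {2}(projT2 (cid (v_gen s))). Qed.
Definition sder s : fn X U := dpoly (lift_poly s).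
Lemma sderE q : sder (mev v q) = dpoly q.
Proof. by apply: dpoly_eq; rewrite lift_polyE. Qed.

Lemma sderD a b : sder (a + b) = sder a + sder b.
Proof. by rewrite -{1}(lift_polyE a) -{1}(lift_polyE b) -mevD // sderE dpolyD. Qed.
Lemma sderM a b : sder (a * b) = a * sder b + b * sder a.
Proof. by rewrite -{1}(lift_polyE a) -{1}(lift_polyE b) -mevM // sderE dpolyM !lift_polyE. Qed.
Lemma sder_cst c : sder (Defs.cst U c) = 0.
Proof.
rewrite -(mevC v nz) sderE /dpoly big1 // => j _.
by rewrite mpoly.mderivC mev0 // mul0r.
Qed.
Lemma sder_max : sder (v ord_max) = 1.
Proof.
rewrite -(mevX v nz) sderE /dpoly (bigD1 ord_max) //= big1.
  by rewrite mderiv_var eqxx mevC // rmorph1 slope_max mul1r addr0.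
by move=> j /negbTE jm; rewrite mderiv_var eq_sym jm mevC // rmorph0 mul0r.
Qed.
(** [d] kills [mev v (f i) = 0], so by the chain rule the [d (v j)] solve the Jacobian system and
    are the multiples [slope j] of the last one. *)
Lemma derivation_sder (M : lmodType (fn X U)) (d : fn X U -> M) s :
  derivation (@kcst k X U) M d -> d s = sder s *: d (v ord_max).
Proof.
move=> hd; have dE q : d (mev v q) = \sum_j mev v (mpoly.mderiv j q) *: d (v j).
  exact: derivation_mev.
have x j : d (v j) = slope j *: d (v ord_max).
  apply: (solve_jacobian (x := fun j => d (v j))) => i.
  rewrite -dE mev_f -(rmorph0 (Defs.cst U)) (deriv_cst hd) //.
  by exists 0.
rewrite -{1}(lift_polyE s) dE scaler_suml; apply: eq_bigr => j _.
by rewrite x scalerA.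
Qed.
End SmoothDerivation.

(* A derivation of the coordinate ring of an affine open set extends to all
   open subsets, by the quotient rule. *)
Section DerivationExtension.
Variables (k : fieldType) (X : rspace k) (U : opens X).
Hypothesis affU : affine U.
Variable D : fn X U -> fn X U.
Hypothesis D_add : forall a b, D (a + b) = D a + D b.
Hypothesis D_mul : forall a b, D (a * b) = a * D b + b * D a.
Hypothesis D_cst : forall c, D (Defs.cst U c) = 0.

Lemma D_one : D 1 = 0. Proof. by rewrite -[X in D X](rmorph1 (Defs.cst U)) D_cst. Qed.
Lemma D_zero : D 0 = 0. Proof. by rewrite -[X in D X](rmorph0 (Defs.cst U)) D_cst. Qed.
Lemma D_sub a b : D (a - b) = D a - D b.
Proof. by apply: (addIr (D b)); rewrite -D_add !subrK. Qed.

(** On a small [D(s)] the equality means [s^n (a - b) = 0]. Apply [D] and restrict: the term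
    containing [a - b] itself vanishes, and [s^n] is a unit. *)
Lemma D_local (V : opens X) a b : V `<=` U -> fres U V a = fres U V b ->
  fres U V (D a) = fres U V (D b).
Proof.
move=> hV eab; apply: (sheaf_sep (fn_glue X)) => x Vx.
have [s [sx sV]] := affine_basis_D affU (hV _ Vx) Vx.
have sU := subset_trans sV hV.
exists (Dopen s); split=> //; rewrite !fres_comp //; apply: subr0_eq; rewrite -fresB // -D_sub.
have [|n en] := affine_zero_D affU (f := s) (g := a - b).
  by rewrite fresB // -!(fres_comp _ hV sV) eab subrr.
have [t et] := @Dopen_unit _ _ _ s (Dopen s) (@opens_refl _ _).
have := congr1 (fres U (Dopen s)) (congr1 D en).
rewrite D_mul D_zero fresD // !fresM // fres0 // fresX //.
have -> : fres U (Dopen s) (a - b) = 0 by rewrite fresB // -!(fres_comp _ hV sV) eab subrr.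
rewrite mul0r addr0 => e.
by rewrite -[LHS]mul1r -(expr1n _ n) -et exprMn -mulrA e mulr0.
Qed.

(** [h] is the derivative of [g]: locally [g = a / f], and the quotient rule is stated without
    denominators as the Leibniz rule for [f g = a]. *)
Definition dquot (V : opens X) (g h : fn X V) : Prop := forall x, oset V x ->
  exists O : opens X, [/\ oset O x, O `<=` V & exists a f : fn X U,
    [/\ exists f', f' * fres U O f = 1, fres U O f * fres V O g = fres U O a &
        fres U O f * fres V O h + fres U O (D f) * fres V O g = fres U O (D a)]].

Lemma dquot_rs (V W : opens X) (g h : fn X V) : V `<=` U -> W `<=` V -> dquot g h ->
  dquot (fres V W g) (fres V W h).
Proof.
move=> hVU hW H x Wx; have [O [Ox hO [a [f [[f' e1] e2 e3]]]]] := H x (hW _ Wx).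
have hl := @oIl _ W O; have hr := @oIr _ W O.
have hOU := subset_trans hO hVU.
exists (oI W O); split=> //; exists a, f; rewrite !fres_comp //; split.
- by exists (fres _ _ f'); rewrite -(fres_comp f hOU hr) -fresM // e1 fres1.
- by rewrite -!(fres_comp _ hOU hr) -(fres_comp g hO hr) -fresM // e2.
by rewrite -!(fres_comp _ hOU hr) -!(fres_comp _ hO hr) -!fresM // -fresD // e3.
Qed.

Lemma dquot_common (V : opens X) (g h g' h' : fn X V) x : V `<=` U -> oset V x ->
  dquot g h -> dquot g' h' ->
  exists O : opens X, [/\ oset O x, O `<=` V & exists a f a' f' : fn X U,
    [/\ (exists t, t * fres U O f = 1) /\ (exists t, t * fres U O f' = 1),
        fres U O f * fres V O g = fres U O a,
        fres U O f * fres V O h + fres U O (D f) * fres V O g = fres U O (D a),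
        fres U O f' * fres V O g' = fres U O a' &
        fres U O f' * fres V O h' + fres U O (D f') * fres V O g' = fres U O (D a')]].
Proof.
move=> hVU Vx H H'.
have [W [Wx hW [a [f [[t e1] e2 e3]]]]] := H x Vx.
have [W' [Wx' hW' [a' [f' [[t' e1'] e2' e3']]]]] := H' x Vx.
have hl := @oIl _ W W'; have hr := @oIr _ W W'.
have hWU := subset_trans hW hVU; have hWU' := subset_trans hW' hVU.
exists (oI W W'); split=> //; first exact: subset_trans hW.
exists a, f, a', f'; split; first split.
- by exists (fres _ _ t); rewrite -(fres_comp f hWU hl) -fresM // e1 fres1.
- by exists (fres _ _ t'); rewrite -(fres_comp f' hWU' hr) -fresM // e1' fres1.
- by rewrite -!(fres_comp _ hWU hl) -(fres_comp g hW hl) -fresM // e2.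
- by rewrite -!(fres_comp _ hWU hl) -!(fres_comp _ hW hl) -!fresM // -fresD // e3.
- by rewrite -!(fres_comp _ hWU' hr) -(fres_comp g' hW' hr) -fresM // e2'.
by rewrite -!(fres_comp _ hWU' hr) -!(fres_comp _ hW' hr) -!fresM // -fresD // e3'.
Qed.

(** [D_local] applied to the cross products [a f' = a' f] yields [f f' h = f f' h'], where [f f'] is
    a unit. *)
Lemma dquot_uniq (V : opens X) (g h h' : fn X V) : V `<=` U ->
  dquot g h -> dquot g h' -> h = h'.
Proof.
move=> hVU H H'; apply: (sheaf_sep (fn_glue X)) => x Vx.
have [O [Ox hO [a [f [a' [f' [[[t e1] [t' e1']] e2 e3 e2' e3']]]]]]] :=
  dquot_common hVU Vx H H'.
have hOU := subset_trans hO hVU.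
exists O; split=> //.
have /(D_local hOU) : fres U O (a * f') = fres U O (a' * f).
  by rewrite !fresM // -e2 -e2'; ring.
rewrite !D_mul !fresD // !fresM // -e3 -e3' -e2 -e2' => E.
set F := fres U O f in e1 E *; set F' := fres U O f' in e1' E *.
have {}E : F * F' * fres V O h = F * F' * fres V O h'.
  move: E; set DF := fres U O (D f); set DF' := fres U O (D f'); set G := fres V O g => E.
  apply: (addIr (F * G * DF' + F' * (DF * G))).
  transitivity (F * G * DF' + F' * (F * fres V O h + DF * G)); first by ring.
  by rewrite E; ring.
rewrite -[LHS]mul1r -[RHS]mul1r -(mulr1 1) -{1 3}e1 -e1'.
transitivity (t * t' * (F * F' * fres V O h)); first by ring.
by rewrite E; ring.
Qed.

Lemma dquot_add (V : opens X) (g h g' h' : fn X V) : V `<=` U ->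
  dquot g h -> dquot g' h' -> dquot (g + g') (h + h').
Proof.
move=> hVU H H' x Vx.
have [O [Ox hO [a [f [a' [f' [[[t e1] [t' e1']] e2 e3 e2' e3']]]]]]] :=
  dquot_common hVU Vx H H'.
have hOU := subset_trans hO hVU; exists O; split=> //.
exists (f' * a + f * a'), (f * f'); rewrite !D_add !D_mul !(fresD, fresM) //; split.
- exists (t * t'); transitivity ((t * fres U O f) * (t' * fres U O f')); first by ring.
  by rewrite e1 e1' mulr1.
- by rewrite -e2 -e2'; ring.
by rewrite -e2 -e2' -e3 -e3'; ring.
Qed.

Lemma dquot_mul (V : opens X) (g h g' h' : fn X V) : V `<=` U ->
  dquot g h -> dquot g' h' -> dquot (g * g') (g * h' + g' * h).
Proof.
move=> hVU H H' x Vx.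
have [O [Ox hO [a [f [a' [f' [[[t e1] [t' e1']] e2 e3 e2' e3']]]]]]] :=
  dquot_common hVU Vx H H'.
have hOU := subset_trans hO hVU; exists O; split=> //.
exists (a * a'), (f * f'); rewrite !D_mul !(fresD, fresM)//; split.
- exists (t * t'); transitivity ((t * fres U O f) * (t' * fres U O f')); first by ring.
  by rewrite e1 e1' mulr1.
- by rewrite -e2 -e2'; ring.
by rewrite -e2 -e2' -e3 -e3'; ring.
Qed.

Lemma dquot_fres (V : opens X) a : V `<=` U -> dquot (fres U V a) (fres U V (D a)).
Proof.
move=> hV x Vx; exists V; split=> //; exists a, 1; rewrite !fres1 // !fres_id D_one fres0 //.
by split; [exists 1; rewrite mulr1|rewrite mul1r|rewrite mul1r mul0r addr0].
Qed.

Lemma dquot_ex (V : opens X) (g : fn X V) : V `<=` U -> exists h, dquot g h.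
Proof.
move=> hV; pose P (O : opens X) (h : Omodule X O) := O `<=` V /\ dquot (fres V O g) h.
have Pex x : oset V x -> exists O : opens X,
    [/\ oset O x, O `<=` V & exists h : Omodule X O, P O h].
  move=> Vx; have [s [sx sV]] := affine_basis_D affU (hV _ Vx) Vx.
  have sU := subset_trans sV hV.
  exists (Dopen s); split=> //.
  have [n [a ea]] := affine_frac_D affU (fres V (Dopen s) g).
  have [t et] := @Dopen_unit _ _ _ s (Dopen s) (@opens_refl _ _).
  have etn : t ^+ n * fres U (Dopen s) s ^+ n = 1 by rewrite -exprMn et expr1n.
  (* The quotient rule for [g = a / s^n] solved for the derivative; [t] is the inverse of [s]. *)
  exists (t ^+ n * (fres U (Dopen s) (D a) - fres U (Dopen s) (D (s ^+ n)) * fres V (Dopen s) g)).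
  split=> // y Dy; exists (Dopen s); split=> //; exists a, (s ^+ n).
  rewrite !fres_id fresX //; split=> //; first by exists (t ^+ n).
  by rewrite mulrA [_ * t ^+ n]mulrC etn mul1r subrK.
have [|||h hh] := @glue_unique _ _ (Omodule X) V P.
- move=> O W h hO hW [_ H]; split; first exact: subset_trans hO.
  rewrite -(fres_comp g hO hW); apply: dquot_rs => //; exact: subset_trans hV.
- move=> O h h' hO [_ H] [_ H']; apply: dquot_uniq H H'; exact: subset_trans hV.
- exact: Pex.
exists h => x Vx; have [O [Ox hO [h1 Ph1]]] := Pex x Vx.
have [_ H1] := Ph1; have [W [Wx hW [a [f [e1 e2 e3]]]]] := H1 x Ox.
exists W; split=> //; first exact: subset_trans hO.
exists a, f; split=> //; first by rewrite -(fres_comp g hO hW).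
have eh : fres V O h = h1 by apply: hh.
by rewrite -(fres_comp g hO hW) -(fres_comp _ hO hW) eh.
Qed.

Definition dext (V : opens X) (h : V `<=` U) (g : fn X V) : fn X V :=
  projT1 (cid (dquot_ex g h)).
Lemma dextP (V : opens X) (h : V `<=` U) (g : fn X V) : dquot g (dext h g).
Proof. exact: (projT2 (cid (dquot_ex g h))). Qed.

(** [klift] asks for a derivation on every open subset of [X], while [D] lives on [U]; hence values
    in the push-forward from [U]. *)
Definition dext_fun (V : opens X) (g : fn X V) : jpush U (Omodule X) V :=
  dext (@oIr _ V U) (fres V (oI V U) g).
Lemma dext_derivation (V : opens X) :
  derivation (@kcst k X V) (jpush U (Omodule X) V) (@dext_fun V).
Proof.
have hr := @oIr _ V U; have hl := @oIl _ V U; split=> [a b|a b|_ [c _ <-]].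
- apply: (dquot_uniq hr (dextP _ _)); rewrite fresD //.
  by apply: dquot_add => //; apply: dextP.
- apply: (dquot_uniq hr (dextP _ _)); rewrite fresM //.
  by apply: dquot_mul => //; apply: dextP.
apply: (dquot_uniq hr (dextP _ _)).
rewrite fres_cst // -(fres_cst c hr).
have -> : (0 : fn X (oI V U)) = fres U (oI V U) (D (Defs.cst U c)) by rewrite D_cst fres0.
exact: dquot_fres.
Qed.
Lemma dext_rs (V W : opens X) (g : fn X V) : W `<=` V ->
  dext_fun (fres V W g) = rs V W (dext_fun g).
Proof.
move=> hW; apply: (dquot_uniq (@oIr _ W U) (dextP _ _)).
have hWV := @oIS _ _ U V W hW.
rewrite fres_comp //; last exact: oIl.
rewrite -(fres_comp g (@oIl _ V U) hWV).
by apply: dquot_rs => //; [exact: oIr|exact: dextP].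
Qed.
Definition dcoord : ohom (Omega X) (jpush U (Omodule X)) :=
  klift (kcst_res (X := X)) dext_derivation dext_rs.

Variable u : fn X U.
Hypothesis D_u : D u = 1.
Hypothesis D_univ : forall (M : lmodType (fn X U)) (d : fn X U -> M) s,
  derivation (@kcst k X U) M d -> d s = D s *: d u.

Lemma dd_dquot (V : opens X) (g h : fn X V) : V `<=` U -> dquot g h ->
  dd g = h *: rs U V (dd u).
Proof.
move=> hVU H; apply: (sheaf_sep (omodP (Omega X))) => x Vx.
have [O [Ox hO [a [f [[t e1] e2 e3]]]]] := H x Vx; have hOU := subset_trans hO hVU.
exists O; split=> //; rewrite rsZ // rs_comp // -(kd_rs _ _ hO).
have hd (W : opens X) := kd_deriv (kcst_res (X := X)) W.
have ddU s : dd (fres U O s) = fres U O (D s) *: rs U O (dd u).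
  have -> : dd (fres U O s) = rs U O (dd s) by apply: kd_rs.
  have -> : dd s = D s *: dd u by apply: D_univ; apply: hd.
  by rewrite rsZ.
have := ddU a; rewrite -e2 /dd (Defs.derivM (hd O)) -/(dd _) -/(dd _) ddU -e3 scalerDl.
rewrite scalerA [fres V O g * _]mulrC => /addIr E.
by rewrite -[LHS]scale1r -e1 -scalerA [X in t *: X]E !scalerA mulrA e1 mul1r.
Qed.

(** Let [c] be the linear map induced by [D]. The maps [w |-> c(w) du] and [w |-> w] over [U] agree
    on exact differentials, hence everywhere, which gives existence of the coordinate. Its
    uniqueness comes from [c(du) = D u = 1]. *)
Lemma frame_dd : is_frame (fun _ : 'I_1 => dd u : Omega X U).
Proof.
pose c (V : opens X) (s : Omega X V) : fn X (oI V U) := dcoord V s.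
have c_lin V a (s t : Omega X V) : c V (a *: s + t) = fres V (oI V U) a * c V s + c V t.
  exact: (hf_lin dcoord a s t).
have c_rs (V W : opens X) (s : Omega X V) : W `<=` V -> c W (rs V W s) = fres (oI V U) (oI W U) (c V s).
  by move=> h; apply: (hf_rs dcoord s h).
have cE (V : opens X) (g : fn X V) : c V (dd g) = dext (@oIr _ V U) (fres V (oI V U) g).
  exact: (kliftE (kcst_res (X := X)) dext_derivation dext_rs g).
pose Q := jpush U (Omega X).
pose r V (s : Omega X V) : Q V := rs V (oI V U) s.
have r_lin V a (s t : Omega X V) : r V (a *: s + t) = a *: r V s + r V t.
  by apply: (rs_lin a s t); apply: oIl.
have r_rs (V W : opens X) (s : Omega X V) : W `<=` V -> r W (rs V W s) = rs V W (r V s).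
  move=> h; have hS := @oIS _ _ U V W h.
  rewrite /r rs_comp //; last exact: oIl.
  symmetry; exact: (rs_comp s (@oIl _ V U) hS).
pose b V (s : Omega X V) : Q V := c V s *: rs U (oI V U) (dd u).
have b_lin V a (s t : Omega X V) : b V (a *: s + t) = a *: b V s + b V t.
  by rewrite /b c_lin scalerDl -scalerA.
have b_rs (V W : opens X) (s : Omega X V) : W `<=` V -> b W (rs V W s) = rs V W (b V s).
  move=> h; have hS := @oIS _ _ U V W h.
  rewrite /b c_rs // -(rs_comp (dd u) (@oIr _ V U) hS); symmetry.
  exact: (rsZ (c V s) (rs U (oI V U) (dd u)) hS).
have rb V (s : Omega X V) : r V s = b V s.
  pose hr : ohom (Omega X) Q := Defs.Hom r_lin r_rs; pose hb : ohom (Omega X) Q := Defs.Hom b_lin b_rs.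
  apply: (@kaehler_hom_unique _ _ _ (kcst_res (X := X)) Q hr hb) => W g /=.
  rewrite /b -/(dd g) cE; rewrite -(dd_dquot (@oIr _ W U) (dextP _ _)).
  by symmetry; apply: kd_rs; apply: oIl.
move=> V s hV; have hVI : V `<=` oI V U by apply: oIs.
exists (\row_(i < 1) fres (oI V U) V (c V s)); split.
  rewrite big_ord1 mxE; have := congr1 (rs (oI V U) V) (rb V s).
  rewrite /r /b rs_comp //; last exact: oIl.
  by rewrite rs_id rsZ // rs_comp //; apply: oIr.
move=> a; rewrite big_ord1 => ea; apply/rowP => i; rewrite (ord1 i) mxE.
rewrite ea; have -> : a 0 0 *: rs U V (dd u) = a 0 0 *: rs U V (dd u) + 0 :> Omega X V.
  by rewrite addr0.
rewrite c_lin.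
have -> : c V 0 = 0 by exact: (hf0 dcoord V).
rewrite addr0 c_rs //.
have -> : c U (dd u) = 1.
  rewrite cE; apply: (dquot_uniq (@oIr _ U U) (dextP _ _)).
  by rewrite -(fres1 (@oIr _ U U)) -D_u; apply: dquot_fres; apply: oIl.
by rewrite fres1 ?mulr1 ?fres_comp ?fres_id //; [exact: oIl|exact: oIS].
Qed.
End DerivationExtension.

(** * Tensor products and evaluation *)

Lemma smooth1_frame (k : fieldType) (X : rspace k) : smooth1 X -> forall x : X,
  exists U : opens X, [/\ oset U x, affine U &
    exists w : Omega X U, is_frame (fun _ : 'I_1 => w)].
Proof.
move=> sm x; have [U [Ux affU [n [f [v [v_gen v_ker [g g_det]]]]]]] := sm x.
have nz : (1 : fn X U) != 0.
  by apply/eqP => e; apply: (inv_at0 affU (x := x)); rewrite -e; apply: inv_at1.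
exists U; split=> //; exists (dd (v ord_max)).
apply: (frame_dd affU (D := sder f g v_gen)).
- exact: (sderD nz v_gen v_ker g_det).
- exact: (sderM nz v_gen v_ker g_det).
- exact: (sder_cst nz v_gen v_ker g_det).
- exact: (sder_max nz v_gen v_ker g_det).
- by move=> M d s; apply: (derivation_sder nz v_gen v_ker g_det).
Qed.

Section TensorInd.
Variables (k : fieldType) (X : rspace k) (M N : psh X) (U : opens X).
Variable P : forall V : opens X, tensor M N V -> Prop.
Hypothesis P_pure : forall (V : opens X) (m : M V) (n : N V), V `<=` U -> P (tpure m n).
Hypothesis P_lin : forall (V : opens X) a (s t : tensor M N V), V `<=` U ->
  P s -> P t -> P (a *: s + t).
Hypothesis P_loc : forall (V : opens X) (s : tensor M N V), V `<=` U ->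
  (forall x, oset V x -> exists W : opens X, [/\ oset W x, W `<=` V & P (rs V W s)]) -> P s.

(** A section of the associated sheaf comes locally from the presheaf, where it is a finite
    combination of pure tensors. *)
Lemma tensor_ind (V : opens X) (s : tensor M N V) : V `<=` U -> P s.
Proof.
move=> hV; apply: P_loc => // x Vx; have [Wx hW hu] := repP s Vx.
set W := projT1 _ in Wx hW hu; exists W; split=> //.
have hWU := subset_trans hW hV.
have -> : rs V W s = sheafify_unit (tensor_psh M N) W (projT2 (rep s x)).
  apply: shf_ext => y Wy; exists W, (projT2 (rep s x)).
    by apply/(shf_rsE hW); split=> //; apply: hu.
  exact: shf_unitE.
rewrite (pres_span (projT2 (rep s x))) hf_sum.
apply: (big_ind (@P W)) => [|a b Pa Pb|p _].
- by rewrite -(tpure0l M (0 : N W)); apply: P_pure.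
- by rewrite -[a]scale1r; apply: P_lin.
rewrite hfZ -[_ *: _]addr0; apply: P_lin => //.
  by case: p => a [m n]; apply: P_pure.
by rewrite -(tpure0l M (0 : N W)); apply: P_pure.
Qed.
End TensorInd.

Section TensorUnique.
Variables (k : fieldType) (X : rspace k) (M N : psh X) (Q : omod X) (U : opens X).
Variables f g : forall V : opens X, V `<=` U -> tensor M N V -> Q V.
Hypothesis f_lin : forall (V : opens X) (h : V `<=` U) a s t,
  f h (a *: s + t) = a *: f h s + f h t.
Hypothesis g_lin : forall (V : opens X) (h : V `<=` U) a s t,
  g h (a *: s + t) = a *: g h s + g h t.
Hypothesis f_rs : forall (V W : opens X) (h : V `<=` U) (h' : W `<=` U) s, W `<=` V ->
  f h' (rs V W s) = rs V W (f h s).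
Hypothesis g_rs : forall (V W : opens X) (h : V `<=` U) (h' : W `<=` U) s, W `<=` V ->
  g h' (rs V W s) = rs V W (g h s).
Hypothesis fg : forall (V : opens X) (h : V `<=` U) m n, f h (tpure m n) = g h (tpure m n).

(** The two maps are families over the open subsets of [U] only, since coordinates in a frame and
    the inverse of [klog] exist only there. *)
Lemma tensor_unique (V : opens X) (h : V `<=` U) s : f h s = g h s.
Proof.
move: (h); apply: (@tensor_ind _ _ M N U (fun V s => forall h : V `<=` U, f h s = g h s)) => //.
- by move=> W a u t _ es et hW; rewrite f_lin g_lin es et.
move=> O u _ loc hO; apply: (sheaf_sep (omodP Q)) => x Ox.
have [W [Wx hW e]] := loc x Ox; exists W; split=> //.
have hWU := subset_trans hW hO.
by rewrite -(f_rs hO hWU) // -(g_rs hO hWU).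
Qed.
End TensorUnique.

Lemma tmap_pure (k : fieldType) (X : rspace k) (M M' N N' : psh X) (f : ohom M M')
    (g : ohom N N') (U : opens X) m n :
  tmap f g U (tpure m n) = tpure (f U m) (g U n).
Proof. exact: tliftE. Qed.

(* As phi is only given over U, the pairing with phi is constructed as a morphism
   to the push-forward to X of the restriction of M to U. *)
Section Contraction.
Variables (k : fieldType) (X : rspace k) (M E : omod X) (U : opens X).
Variable phi : shom E (Omodule X) U.
Definition contract_pure (V : opens X) (m : M V) (s : E V) : jpush U M V :=
  (phi (oI V U) (@oIr _ V U) (rs V (oI V U) s) : fn X (oI V U)) *: rs V (oI V U) m.
Lemma contract_l (V : opens X) a (m m' : M V) s :
  contract_pure (a *: m + m') s = a *: contract_pure m s + contract_pure m' s.
Proof.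
rewrite /contract_pure rs_lin; last exact: oIl.
by rewrite scalerDr [in LHS]scalerA mulrC -scalerA.
Qed.
Lemma contract_r (V : opens X) a (m : M V) s s' :
  contract_pure m (a *: s + s') = a *: contract_pure m s + contract_pure m s'.
Proof.
rewrite /contract_pure rs_lin; last exact: oIl.
by rewrite shom_lin scalerDl -scalerA.
Qed.
Lemma contract_rs (V W : opens X) (m : M V) (s : E V) : W `<=` V ->
  contract_pure (rs V W m) (rs V W s) = rs V W (contract_pure m s).
Proof.
move=> h; have hS := @oIS _ _ U V W h; have hl := @oIl _ V U; have hl' := @oIl _ W U.
rewrite /contract_pure !rs_comp //; symmetry.
rewrite [LHS](rsZ (_ : fn X (oI V U)) (rs V (oI V U) m) hS).
have -> : fres (oI V U) (oI W U) (phi (oI V U) (@oIr _ V U) (rs V (oI V U) s)) =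
    phi (oI W U) (@oIr _ W U) (rs V (oI W U) s) :> fn X _.
  by rewrite -(rs_comp s hl hS) (shom_rs _ (@oIr _ V U)).
by rewrite rs_comp.
Qed.
Definition contract_hom : ohom (tensor M E) (jpush U M) :=
  tlift contract_l contract_r contract_rs.
Definition contract (V : opens X) (t : tensor M E V) : M V :=
  rs (oI V U) V (contract_hom V t : M (oI V U)).

Lemma contractE (V : opens X) (h : V `<=` U) (m : M V) (s : E V) :
  contract (tpure m s) = (phi V h s : fn X V) *: m.
Proof.
have hI := oI_sub h; have hl := @oIl _ V U.
rewrite /contract /contract_hom tliftE /contract_pure rsZ // rs_comp // rs_id; congr (_ *: _).
have := shom_rs phi (@oIr _ V U) h (rs V (oI V U) s) hI.
by rewrite rs_comp // rs_id => ->.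
Qed.
Lemma contract_lin (V : opens X) (h : V `<=` U) a (s t : tensor M E V) :
  contract (a *: s + t) = a *: contract s + contract t.
Proof.
have hI := oI_sub h.
have -> : contract (a *: s + t) = rs (oI V U) V (fres V (oI V U) a *:
    (contract_hom V s : M (oI V U)) + (contract_hom V t : M (oI V U))).
  by congr (rs _ _ _); apply: (hf_lin contract_hom a s t).
rewrite rs_lin // fres_comp ?fres_id //; exact: oIl.
Qed.
Lemma contractD (V : opens X) (h : V `<=` U) (s t : tensor M E V) :
  contract (s + t) = contract s + contract t.
Proof. by rewrite -[s]scale1r contract_lin // !scale1r. Qed.
Lemma contract_res (V W : opens X) (t : tensor M E V) : V `<=` U -> W `<=` V ->
  contract (rs V W t) = rs V W (contract t).
Proof.
move=> hV h; have hS := @oIS _ _ U V W h.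
have hI := oI_sub hV; have hI' := oI_sub (subset_trans h hV).
have E1 : contract_hom W (rs V W t) =
    rs (oI V U) (oI W U) (contract_hom V t : M (oI V U)) :> M (oI W U).
  exact: (hf_rs contract_hom t h).
by rewrite /contract E1 !rs_comp.
Qed.
End Contraction.

Section TensorFrame.
Variables (k : fieldType) (X : rspace k) (M E : omod X) (U : opens X) (n : nat) (e : 'I_n -> E U).
Hypothesis he : is_frame e.
Local Notation co := (frame_coord he).
Definition tcoord j (V : opens X) (t : tensor M E V) : M V := contract (co j) t.
Lemma tcoordE j (V : opens X) (h : V `<=` U) (m : M V) (s : E V) :
  tcoord j (tpure m s) = (co j V h s : fn X V) *: m.
Proof. exact: contractE. Qed.
Lemma tcoord_lin j (V : opens X) (h : V `<=` U) a (s t : tensor M E V) :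
  tcoord j (a *: s + t) = a *: tcoord j s + tcoord j t.
Proof. exact: contract_lin. Qed.
Lemma tcoord_res j (V W : opens X) (t : tensor M E V) : V `<=` U -> W `<=` V ->
  tcoord j (rs V W t) = rs V W (tcoord j t).
Proof. exact: contract_res. Qed.

Lemma tensor_frameE (V : opens X) (h : V `<=` U) (t : tensor M E V) :
  t = \sum_j tpure (tcoord j t) (rs U V (e j)).
Proof.
apply: (tensor_unique (M := M) (N := E) (f := fun V (h : V `<=` U) t => t)
  (g := fun V (h : V `<=` U) t => \sum_j tpure (tcoord j t) (rs U V (e j))) _ _ _ _ _ h) => //.
- move=> W hW a s s'; rewrite scaler_sumr -big_split; apply: eq_bigr => j _ /=.
  by rewrite tcoord_lin // tpure_l.
- move=> W W' hW hW' s hWW; rewrite rs_sum //; apply: eq_bigr => j _.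
  by rewrite tcoord_res // -tpure_rs // rs_comp.
move=> W hW m s; rewrite {1}(frame_coordE he hW s).
under [RHS]eq_bigr => j _ do rewrite (tcoordE j hW) tpureZl -tpureZr.
elim/big_rec2: _ => [|j u v _ <-]; first exact: tpure0r.
by rewrite tpureDr.
Qed.
Lemma shom_frame_ext (N : omod X) (V : opens X) (hV : V `<=` U) (f g : shom E N V) :
  (forall j, f V (@opens_refl _ _) (rs U V (e j)) = g V (@opens_refl _ _) (rs U V (e j))) -> f = g.
Proof.
move=> H; apply: shom_ext => W h s; have hWU := subset_trans h hV.
rewrite (frame_coordE he hWU s) !shom_sum; apply: eq_bigr => j _; rewrite !shomZ; congr (_ *: _).
by rewrite -(rs_comp (e j) hV h) !(shom_rs _ (@opens_refl _ _)) // H.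
Qed.

Section Elementary.
Variables (N : omod X) (V : opens X) (hV : V `<=` U) (s : N V) (j : 'I_n).
(** The homomorphism [e_j^* (x) s]; when [s] is a frame vector of [E] it is a matrix unit. *)
Definition elem_fun (W : opens X) (h : W `<=` V) (t : E W) : N W :=
  (co j W (subset_trans h hV) t : fn X W) *: rs V W s.
Lemma elem_lin (W : opens X) (h : W `<=` V) a t t' :
  elem_fun h (a *: t + t') = a *: elem_fun h t + elem_fun h t'.
Proof. by rewrite /elem_fun shom_lin scalerDl -scalerA. Qed.
Lemma elem_rs (W W' : opens X) (h : W `<=` V) (h' : W' `<=` V) t : W' `<=` W ->
  elem_fun h' (rs W W' t) = rs W W' (elem_fun h t).
Proof.
move=> hW; rewrite /elem_fun (shom_rs _ (subset_trans h hV)) // rsZ //.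
by rewrite rs_comp.
Qed.
Definition elem_hom : sHom E N V := Shom elem_lin elem_rs.
Lemma elem_hom_at (W : opens X) (h : W `<=` V) (hW : W `<=` U) t :
  (elem_hom : shom E N V) W h t = (co j W hW t : fn X W) *: rs V W s.
Proof. by congr (_ *: _); exact: (shom_irr (co j)). Qed.
Lemma elem_homE i : (elem_hom : shom E N V) V (@opens_refl _ _) (rs U V (e i)) = (j == i)%:R *: s.
Proof.
by rewrite (elem_hom_at _ hV) rs_id (frame_coord_frame he).
Qed.
End Elementary.
End TensorFrame.

Definition iso_on (k : fieldType) (X : rspace k) (W : opens X) (M N : omod X) (f : ohom M N) : Prop :=
  forall V : opens X, V `<=` W -> injective (f V) /\ forall t, exists s, f V s = t.

Section IsoLocal.
Variables (k : fieldType) (X : rspace k) (M N : omod X) (f : ohom M N).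
(** Injectivity is local and is proved before surjectivity: it makes the local preimages unique, so
    that they glue. *)
Lemma iso_on_local (W : opens X) : (forall x, oset W x -> exists U : opens X,
  oset U x /\ iso_on U f) -> iso_on W f.
Proof.
move=> loc; have inj (V : opens X) : V `<=` W -> injective (f V).
  move=> hV s t e; apply: (sheaf_sep (omodP M)) => x Vx.
  have [U [Ux isoU]] := loc x (hV _ Vx).
  have hl := @oIl _ V U; have hr := @oIr _ V U; exists (oI V U); split=> //.
  by apply: (proj1 (isoU _ hr)); rewrite !hf_rs // e.
move=> V hV; split; first exact: inj.
move=> t; pose P (O : opens X) (s : M O) := f O s = rs V O t.
have [|||s hs] := @glue_unique _ _ M V P.
- by move=> O O' s hO hO' e; rewrite /P hf_rs // e rs_comp.
- move=> O s s' hO e e'; apply: (inj O); first exact: subset_trans hV.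
  by rewrite e.
- move=> x Vx; have [U [Ux isoU]] := loc x (hV _ Vx).
  have [_ sur] := isoU _ (@oIr _ V U); have [s es] := sur (rs V (oI V U) t).
  by exists (oI V U); split=> //; [apply: oIl|exists s].
exists s; apply: (sheaf_sep (omodP N)) => x Vx; have [U [Ux isoU]] := loc x (hV _ Vx).
have [_ sur] := isoU _ (@oIr _ V U); have [s' es] := sur (rs V (oI V U) t).
have hl := @oIl _ V U; exists (oI V U); split=> //.
by rewrite -hf_rs // (hs _ s').
Qed.
End IsoLocal.

Section TevIso.
Variables (k : fieldType) (X : rspace k).

Lemma tev_pure (M E : omod X) (U V : opens X) (h : V `<=` U) (m : M U) (f : sEnd E U) (s : E V) :
  (tev M E U (tpure m f) : shom _ _ _) V h s = tpure (rs U V m) ((f : shom _ _ _) V h s).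
Proof. by rewrite /tev tliftE. Qed.

Lemma tev_rsE (M E : omod X) (U W V : opens X) (h : V `<=` U) (hW : W `<=` U) (h' : V `<=` W)
    (z : tensor M (sEnd E) U) (s : E V) :
  (tev M E W (rs U W z) : shom _ _ _) V h' s = (tev M E U z : shom _ _ _) V h s.
Proof. by rewrite hf_rs //; apply: (shom_rE _ hW). Qed.

Section Frame.
Variables (M E : omod X) (U : opens X) (n : nat) (e : 'I_n -> E U).
Hypothesis he : is_frame e.
Local Notation refl V := (@opens_refl X V).
Local Notation tevf V z j := ((tev M E V z : shom E (tensor M E) V) V (refl V) (rs U V (e j))).

(** The right side depends on [z] only through [tev z], so it is an explicit left inverse of [tev]:
    the entry at [(i, j)] is the [i]-th coordinate of the value at [e_j]. *)
Lemma tev_recover (V : opens X) (h : V `<=` U) (z : tensor M (sEnd E) V) :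
  z = \sum_j \sum_i tpure (tcoord he i (tevf V z j)) (elem_hom he h (rs U V (e i)) j).
Proof.
have tcD (W : opens X) (hW : W `<=` U) i a (s t : tensor M E W) :
  tcoord he i (a *: s + t) = a *: tcoord he i s + tcoord he i t by apply: tcoord_lin.
apply: (tensor_unique (M := M) (N := sEnd E) (f := fun V (h : V `<=` U) t => t)
  (g := fun V (h : V `<=` U) z => \sum_j \sum_i tpure (tcoord he i (tevf V z j))
     (elem_hom he h (rs U V (e i)) j)) _ _ _ _ _ h) => //.
- move=> W hW a s s'; rewrite scaler_sumr -big_split; apply: eq_bigr => j _.
  rewrite [RHS]/= scaler_sumr -big_split; apply: eq_bigr => i _.
  rewrite -[RHS]tpure_l; congr tpure; rewrite -tcD //; congr (tcoord _ _ _).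
  by rewrite hf_lin shom_addE shom_scaleE fres_id.
- move=> W W' hW hW' s hWW; rewrite rs_sum //; apply: eq_bigr => j _.
  rewrite rs_sum //; apply: eq_bigr => i _.
  rewrite -tpure_rs //; congr tpure.
    rewrite -tcoord_res //; congr (tcoord _ _ _).
    by rewrite (tev_rsE hWW) // -(rs_comp (e j) hW hWW) (shom_rs _ (refl W)).
  apply: shom_ext => O h' t; have hOW := subset_trans h' hWW.
  have hOU := subset_trans h' hW'.
  by rewrite (shom_rE _ hWW h' hOW) !(elem_hom_at _ _ _ _ _ hOU) !rs_comp.
move=> W hW m f.
(* The endomorphism [f] written by its matrix in the frame. *)
have fE : f = \sum_j \sum_i (frame_coord he i W hW ((f : shom E E W) W (refl W) (rs U W (e j))) : fn X W) *:
    elem_hom he hW (rs U W (e i)) j.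
  apply: (shom_frame_ext he hW) => l.
  have sumE I (r : seq I) (F : I -> sEnd E W) s :
      ((\sum_(i <- r) F i : sEnd E W) : shom E E W) W (refl W) s =
      \sum_(i <- r) (F i : shom E E W) W (refl W) s.
    apply: (big_morph (fun g : sEnd E W => (g : shom E E W) W (refl W) s)) => //.
    by move=> a b; rewrite shom_addE.
  rewrite sumE (bigD1 l) //= [X in _ + X]big1 ?addr0; last first.
    move=> j /negbTE jl; rewrite sumE big1 // => i _.
    by rewrite shom_scaleE elem_homE jl scale0r scaler0.
  rewrite sumE {1}(frame_coordE he hW ((f : shom E E W) W (refl W) (rs U W (e l)))).
  by apply: eq_bigr => i _; rewrite shom_scaleE elem_homE eqxx scale1r fres_id.
transitivity (\sum_j \sum_i tpure ((frame_coord he i W hW ((f : shom E E W) W (refl W) (rs U W (e j))) : fn X W) *: m)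
    (elem_hom he hW (rs U W (e i)) j)).
  rewrite [in LHS]fE; elim/big_rec2: _ => [|j u v _ <-]; first exact: tpure0r.
  rewrite tpureDr; congr (_ + _).
  elim/big_rec2: _ => [|i u' v' _ <-]; first exact: tpure0r.
  by rewrite tpureDr tpureZr tpureZl.
apply: eq_bigr => j _; apply: eq_bigr => i _; congr tpure.
by rewrite tev_pure rs_id (tcoordE he i hW).
Qed.

Lemma tev_iso_frame : iso_on U (tev M E).
Proof.
move=> V h; split=> [z z' ez|psi].
  by rewrite (tev_recover h z) (tev_recover h z') ez.
exists (\sum_j \sum_i tpure (tcoord he i ((psi : shom E (tensor M E) V) V (refl V) (rs U V (e j))))
   (elem_hom he h (rs U V (e i)) j)).
apply: (shom_frame_ext he h) => l.
pose ev (F : sHom E (tensor M E) V) := (F : shom E (tensor M E) V) V (refl V) (rs U V (e l)).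
have evD F G : ev (F + G) = ev F + ev G by apply: shom_addE.
have ev0 : ev 0 = 0 by [].
rewrite -/(ev _) -/(ev psi) hf_sum (big_morph ev evD ev0).
transitivity (\sum_j (j == l)%:R *: ev psi).
  apply: eq_bigr => j _; rewrite hf_sum (big_morph ev evD ev0).
  have [->|jl] := eqVneq j l; last first.
    rewrite scale0r big1 // => i _.
    by rewrite /ev tev_pure elem_homE (negbTE jl) scale0r tpure0r.
  rewrite scale1r [RHS](tensor_frameE he h).
  by apply: eq_bigr => i _; rewrite /ev tev_pure elem_homE eqxx scale1r rs_id.
rewrite (bigD1 l) //= eqxx scale1r big1 ?addr0 // => j /negbTE ->.
by rewrite scale0r.
Qed.
End Frame.

Lemma tev_iso n (M E : omod X) (W : opens X) : locally_free n E -> iso_on W (tev M E).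
Proof.
move=> hE; apply: iso_on_local => x Wx; have [U [Ux [e he]]] := hE x.
by exists U; split=> //; apply: tev_iso_frame he.
Qed.

Lemma tidE (L : omod X) (U V : opens X) (h : V `<=` U) (w : Omega X U) (s : L V) :
  (tev (Omega X) L U (tid L U w) : shom _ _ _) V h s = tpure (rs U V w) s.
Proof. exact: tev_pure. Qed.

Lemma tid_iso (L : omod X) (W : opens X) : locally_free 1 L -> iso_on W (tid L).
Proof.
move=> hL; apply: iso_on_local => x Wx; have [U [Ux [e he]]] := hL x.
exists U; split=> // V h; split=> [w w' ew|z].
  have := congr1 (fun F : sHom L _ V => (F : shom _ _ _) V (@opens_refl _ V) (rs U V (e 0)))
    (congr1 (tev (Omega X) L V) ew).
  rewrite !tidE !rs_id => /(congr1 (@tcoord _ _ _ _ _ _ _ he 0 V)).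
  by rewrite !(tcoordE he 0 h) !(frame_coord_frame he) eqxx !scale1r.
exists (tcoord he 0 ((tev (Omega X) L V z : shom _ _ _) V (@opens_refl _ V) (rs U V (e 0)))).
apply: (proj1 (tev_iso_frame (Omega X) he h)).
apply: (shom_frame_ext he h) => j; rewrite (ord1 j) tidE rs_id.
by rewrite [RHS](tensor_frameE he h) big_ord1.
Qed.
End TevIso.

(** * First cohomology *)

Section H1Theory.
Variables (k : fieldType) (X : rspace k).
Implicit Types W V : opens X.

Lemma H1_eqP W (M : psh X) (c c' : cocycle W M) :
  \pi_(H1 W M)%qT c = \pi_(H1 W M)%qT c' <-> cohomologous c c'.
Proof. by split=> [/eqmodP|h]; [|apply/eqmodP]. Qed.
Lemma H1_repr W (M : psh X) (c : cocycle W M) : cohomologous (repr (\pi_(H1 W M)%qT c)) c.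
Proof. by apply/H1_eqP; rewrite reprK. Qed.
Lemma H1_ind W (M : psh X) (P : H1 W M -> Prop) :
  (forall c, P (\pi_(H1 W M)%qT c)) -> forall a, P a.
Proof. by move=> h a; rewrite -[a]reprK. Qed.

Lemma H1_eq W (M : psh X) (c c' : cocycle W M) : (forall x, cov c x = cov c' x) ->
  (forall x y, oset W x -> oset W y -> forall O : opens X, O `<=` cov c x -> O `<=` cov c y ->
    rs _ O (cval c x y) = rs _ O (cval c' x y)) ->
  \pi_(H1 W M)%qT c = \pi_(H1 W M)%qT c'.
Proof.
move=> ec h; apply/H1_eqP/asboolP; exists (cov c), (fun=> 0).
split=> [x Wx|x y Wx Wy O hx hy]; last by rewrite !rs0 // h // !subrr.
by have [? ?] := cov_in c Wx; split; rewrite // -ec.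
Qed.

(** [push] is computed on a chosen representative; here the choice is seen to be immaterial. *)
Lemma push_pi W (M N : psh X) (f : ohom M N) c :
  push W f (\pi_(H1 W M)%qT c) = \pi_(H1 W N)%qT (push_cocycle f c).
Proof.
apply/H1_eqP; have /asboolP [V [b [hV hb]]] := H1_repr c.
apply/asboolP; exists V, (fun x => f _ (b x)); split=> // x y Wx Wy O hx hy.
have [_ h1 h2] := hV x Wx; have [_ h3 h4] := hV y Wy.
have k1 := subset_trans hx h1; have k2 := subset_trans hx h2.
have k3 := subset_trans hy h3; have k4 := subset_trans hy h4.
rewrite -!hf_rs //; try exact: oIs.
by rewrite -!hfB (hb x y).

Qed.

Lemma restr_pi W W' (h : W' `<=` W) (M : psh X) (c : cocycle W M) :
  restr h (\pi_(H1 W M)%qT c) = \pi_(H1 W' M)%qT (restr_cocycle h c).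
Proof.
apply/H1_eqP; have /asboolP [V [b [hV hb]]] := H1_repr c.
apply/asboolP; exists (fun x => oI (V x) W'), (fun x => rs _ _ (b x)); split=> [x Wx|x y Wx Wy O hx hy].
  by have [Vx h1 h2] := hV x (h _ Wx); split=> //; apply: oIS.
have [_ h1 h2] := hV x (h _ Wx); have [_ h3 h4] := hV y (h _ Wy).
have hxV := subset_trans hx (@oIl _ _ _); have hyV := subset_trans hy (@oIl _ _ _).
have hW' := subset_trans hx (@oIr _ _ _).
have r (d : cocycle W M) u v : O `<=` cov d u -> O `<=` cov d v ->
    rs _ O (cval (restr_cocycle h d) u v) = rs _ O (cval d u v).
  move=> hu hv; rewrite /= /restr_val rs_comp //.
    by move=> t [[? _] [? _]].
  by move=> t Ot; split; split; [apply: hu|apply: hW'|apply: hv|apply: hW'].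
have k1 := subset_trans hxV h1; have k2 := subset_trans hxV h2.
have k3 := subset_trans hyV h3; have k4 := subset_trans hyV h4.
rewrite !r //.
rewrite !rs_comp //; try exact: oIl.
by apply: hb => //; apply: (h).
Qed.

Lemma push_comp W (M N Q : psh X) (g : ohom N Q) (f : ohom M N) a :
  push W g (push W f a) = push W (hcomp g f) a.
Proof. by elim/H1_ind: a => c; rewrite !push_pi; apply: H1_eq. Qed.

Lemma push_ext W (M N : psh X) (f g : ohom M N) a :
  (forall V s, V `<=` W -> f V s = g V s) -> push W f a = push W g a.
Proof.
move=> e; elim/H1_ind: a => c; rewrite !push_pi; apply: H1_eq => // x y Wx Wy O hx hy.
rewrite /= /push_val e //.
by apply: subset_trans (@oIl _ _ _) _; case: (cov_in c Wx).
Qed.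

Lemma push_restr W W' (h : W' `<=` W) (M N : psh X) (f : ohom M N) a :
  push W' f (restr h a) = restr h (push W f a).
Proof.
elim/H1_ind: a => c; rewrite push_pi !restr_pi push_pi; apply: H1_eq => // x y Wx Wy O hx hy.
rewrite /= /push_val /restr_val /= /push_val hf_rs //.
by move=> t [[? _] [? _]].
Qed.

Section Iso.
Variables (W : opens X) (M N : omod X) (f : ohom M N).
Hypothesis isof : iso_on W f.

Lemma push_inj : injective (push W f).
Proof.
move=> a a'; elim/H1_ind: a => c; elim/H1_ind: a' => c'.
rewrite !push_pi => /H1_eqP/asboolP [V [b [hV hb]]]; apply/H1_eqP/asboolP.
have ex x : exists s : M (V x), oset W x -> f (V x) s = b x.
  have [Wx|nWx] := pselect (oset W x); last by exists 0.
  have [_ h1 _] := hV x Wx; have [_ h2] := cov_in c Wx.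
  by have [s es] := proj2 (isof (subset_trans h1 h2)) (b x); exists s.
pose s x := projT1 (cid (ex x)).
have sE x : oset W x -> f (V x) (s x) = b x by exact: (projT2 (cid (ex x))).
exists V, s; split=> // x y Wx Wy O hx hy.
have [_ h1 h2] := hV x Wx; have [_ h3 h4] := hV y Wy; have [_ hW] := cov_in c Wx.
apply: (proj1 (isof (subset_trans hx (subset_trans h1 hW)))).
have [_ _ k2] := hV x Wx; have [_ _ k4] := hV y Wy.
have l1 := subset_trans hx h1; have l2 := subset_trans hx k2.
have l3 := subset_trans hy h3; have l4 := subset_trans hy k4.
rewrite !hfB !hf_rs //; try exact: oIs.
by rewrite !sE //; apply: hb.
Qed.

Lemma lift_cocycle (c : cocycle W N) : exists (v : forall x y, M (oI (cov c x) (cov c y)))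
  (vP : forall x y z, oset W x -> oset W y -> oset W z ->
    forall O : opens X, O `<=` cov c x -> O `<=` cov c y -> O `<=` cov c z ->
    rs _ O (v x y) + rs _ O (v y z) = rs _ O (v x z)),
  forall x y, oset W x -> oset W y -> f _ (v x y) = cval c x y.
Proof.
have ex x y : exists s : M (oI (cov c x) (cov c y)), oset W x -> oset W y -> f _ s = cval c x y.
  have [Wx|nWx] := pselect (oset W x); last by exists 0.
  have [_ h2] := cov_in c Wx.
  have [s es] := proj2 (isof (subset_trans (@oIl _ (cov c x) (cov c y)) h2)) (cval c x y).
  by exists s.
pose v x y := projT1 (cid (ex x y)).
have vE x y : oset W x -> oset W y -> f _ (v x y) = cval c x y.
  exact: (projT2 (cid (ex x y))).
exists v; split=> // x y z Wx Wy Wz O hx hy hz.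
have [_ hW] := cov_in c Wx; apply: (proj1 (isof (subset_trans hx hW))).
rewrite hfD !hf_rs; try exact: oIs.
by rewrite !vE //; apply: cocycleP.
Qed.

Lemma push_surj b : exists a, push W f a = b.
Proof.
elim/H1_ind: b => c; have [v [vP vE]] := lift_cocycle c.
exists (\pi_(H1 W M)%qT (Cocycle (@cov_in _ _ _ _ c) vP)).
rewrite push_pi; apply: H1_eq => // x y Wx Wy O hx hy.
by rewrite /= /push_val /= vE.
Qed.
End Iso.
End H1Theory.

(** * Cohomology of a push-forward *)

Section PullTheory.
Variables (k : fieldType) (Y X : rspace k) (p : mor Y X) (F : omod Y) (W : opens X).
Local Notation pF := (pushf p F).

Lemma pushf_rsE (U V : opens X) (O : opens Y) (s : pF U) : V `<=` U -> O `<=` preimo p V ->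
  rs (preimo p V) O (rs U V s : F (preimo p V)) = rs (preimo p U) O (s : F (preimo p U)).
Proof. by move=> h hO; apply: rs_comp => //; apply: preimS. Qed.

Section Cocycle.
Variable c : cocycle W pF.
(** A cochain of [p_* F] has values over preimages of open sets of [X]; this restricts them to
    arbitrary open sets of [Y]. *)
Definition yval (u v : X) (O : opens Y) : F O :=
  rs (preimo p (oI (cov c u) (cov c v))) O (cval c u v : F _).
Lemma yval_rs u v (O O' : opens Y) : O `<=` preimo p (cov c u) -> O `<=` preimo p (cov c v) ->
  O' `<=` O -> rs O O' (yval u v O) = yval u v O'.
Proof. by move=> hu hv hO; apply: rs_comp => // y Oy; split; [apply: hu|apply: hv]. Qed.
Lemma yvalP x y z : oset W x -> oset W y -> oset W z ->
  forall O : opens Y, O `<=` preimo p (cov c x) -> O `<=` preimo p (cov c y) ->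
  O `<=` preimo p (cov c z) -> yval x y O + yval y z O = yval x z O.
Proof.
move=> Wx Wy Wz O hx hy hz.
pose T := oI (cov c x) (oI (cov c y) (cov c z)).
have hO : O `<=` preimo p T.
  by move=> t Ot; split; [exact: hx|split; [exact: hy|exact: hz]].
have hTx : T `<=` cov c x by exact: oIl.
have hTy : T `<=` cov c y by move=> t [_ []].
have hTz : T `<=` cov c z by move=> t [_ []].
rewrite /yval -(pushf_rsE (cval c x y) (oIs hTx hTy) hO) -(pushf_rsE (cval c y z) (oIs hTy hTz) hO).
rewrite -(pushf_rsE (cval c x z) (oIs hTx hTz) hO) -rsD //; congr (rs _ _ _); exact: (cocycleP (c := c)).
Qed.
Lemma pull_valE y y' (O : opens Y) : O `<=` pull_cov c y -> O `<=` pull_cov c y' ->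
  rs _ O (pull_val c y y') = yval (p y) (p y') O.
Proof. by move=> h h'; apply: rs_comp => //; apply: oIs. Qed.
End Cocycle.

Lemma pull_pi (c : cocycle W pF) :
  pull p F W (\pi_(H1 W pF)%qT c) = \pi_(H1 (preimo p W) F)%qT (pull_cocycle c).
Proof.
apply/H1_eqP; have /asboolP [V [b [hV hb]]] := H1_repr c.
apply/asboolP; exists (fun y => preimo p (V (p y))), (fun y => b (p y) : F _).
split=> [y Wy|y y' Wy Wy' O hy hy'].
  by have [h0 h1 h2] := hV (p y) Wy; split=> //; apply: preimS.
have [h0 h1 h2] := hV (p y) Wy; have [h0' h1' h2'] := hV (p y') Wy'.
have hpy := subset_trans hy (preimS h1); have hpy' := subset_trans hy' (preimS h1').
have hqy := subset_trans hy (preimS h2); have hqy' := subset_trans hy' (preimS h2').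
rewrite !pull_valE //; pose T := oI (V (p y)) (V (p y')).
have hO : O `<=` preimo p T by apply: (@oIs _ (preimo p (V (p y))) (preimo p (V (p y')))).
have hl : T `<=` V (p y) by apply: oIl.
have hr : T `<=` V (p y') by apply: oIr.
have k1 := subset_trans hl h1; have k2 := subset_trans hl h2.
have k3 := subset_trans hr h1'; have k4 := subset_trans hr h2'.
rewrite /yval -(pushf_rsE (cval c _ _) (oIs k2 k4) hO) -(pushf_rsE (cval (repr _) _ _) (oIs k1 k3) hO).
rewrite -(pushf_rsE (b (p y')) hr hO) -(pushf_rsE (b (p y)) hl hO).
by rewrite -!rsB //; congr (rs _ _ _); apply: hb.
Qed.

(* If b trivializes c' - c on Y, the sections b_z + (c' - c)(p z, x), for z in Y,
   glue to a section over the preimage of a neighbourhood of x. *)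
Lemma pull_inj : injective (pull p F W).
Proof.
move=> a a'; elim/H1_ind: a => c; elim/H1_ind: a' => c'.
rewrite !pull_pi => /H1_eqP/asboolP [V [b [hV hb]]]; apply/H1_eqP/asboolP.
pose V' x := oI (cov c x) (cov c' x).
pose D u v O := yval c' u v O - yval c u v O.
have Vl x (O : opens Y) : O `<=` preimo p (V' x) -> O `<=` preimo p (cov c x).
  by move=> h; apply: subset_trans h (preimS (@oIl _ _ _)).
have Vr x (O : opens Y) : O `<=` preimo p (V' x) -> O `<=` preimo p (cov c' x).
  by move=> h; apply: subset_trans h (preimS (@oIr _ _ _)).
have DP x y z (O : opens Y) : oset W x -> oset W y -> oset W z ->
    O `<=` preimo p (V' x) -> O `<=` preimo p (V' y) -> O `<=` preimo p (V' z) ->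
    D x y O + D y z O = D x z O.
  by move=> Wx Wy Wz hx hy hz; rewrite /D addrACA -opprD !yvalP //; (apply: Vl || apply: Vr).
have D_rs x y (O O' : opens Y) : O `<=` preimo p (V' x) -> O `<=` preimo p (V' y) ->
    O' `<=` O -> rs O O' (D x y O) = D x y O'.
  by move=> hx hy hO; rewrite /D rsB // !yval_rs //; (apply: (Vl) => //) || (apply: (Vr) => //).
have VV' z : oset W (p z) -> V z `<=` preimo p (V' (p z)).
  by move=> Wz y Vy; have [_ h1 h2] := hV z Wz; split; [apply: h1|apply: h2].
have Db z z' (O : opens Y) : oset W (p z) -> oset W (p z') -> O `<=` V z -> O `<=` V z' ->
    D (p z) (p z') O = rs _ O (b z') - rs _ O (b z).
  move=> Wz Wz' h h'; rewrite -(hb z z' Wz Wz' O h h').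
  have k1 := subset_trans h (VV' z Wz); have k2 := subset_trans h' (VV' z' Wz').
  have a1 : O `<=` pull_cov c z by apply: Vl.
  have a2 : O `<=` pull_cov c' z by apply: Vr.
  have a3 : O `<=` pull_cov c z' by apply: Vl.
  have a4 : O `<=` pull_cov c' z' by apply: Vr.
  by rewrite !pull_valE.
pose P x (O : opens Y) (s : F O) := exists z, [/\ oset W (p z), O `<=` V z,
  O `<=` preimo p (V' x) & s = rs _ O (b z) + D (p z) x O].
have ex x : exists t : F (preimo p (V' x)), oset W x -> forall (O : opens Y) (s : F O),
    P x O s -> rs _ O t = s.
  have [Wx|nWx] := pselect (oset W x); last by exists 0.
  have [|||t ht] := @glue_unique _ _ F (preimo p (V' x)) (P x).
  - move=> O O' s hO hO' [z [Wz h1 h2 ->]]; exists z.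
    have h3 := subset_trans h1 (VV' z Wz).
    by split=> //; [exact: subset_trans h1|exact: subset_trans h2|rewrite rsD // rs_comp // D_rs].
  - move=> O s s' hO [z [Wz h1 h2 ->]] [z' [Wz' h1' h2' ->]].
    have h3 := subset_trans h1 (VV' z Wz); have h3' := subset_trans h1' (VV' z' Wz').
    (* [D(p z, x) = D(p z, p z') + D(p z', x)] and the first term is [b_z' - b_z], so the section
       does not depend on [z]. *)
    by rewrite -(DP (p z) (p z') x O) // (Db z z') // addrA [X in X + _ = _]addrC subrK.
  - move=> y V'y; have [cy c'y] : oset (V' x) (p y) by [].
    have Wy : oset W (p y) by case: (cov_in c Wx) => _; apply.
    have [Vy _ _] := hV y Wy; exists (oI (preimo p (V' x)) (V y)); split=> //; first exact: oIl.
    exists (rs _ _ (b y) + D (p y) x _), y; split=> //; [exact: oIr|exact: oIl].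
  exists t => _ O s Ps; apply: ht => //.
  by case: Ps => z [].
pose t x : pF (V' x) := projT1 (cid (ex x)).
have tE x : oset W x -> forall (O : opens Y) (s : F O),
    P x O s -> rs _ O (t x : F (preimo p (V' x))) = s.
  exact: (projT2 (cid (ex x))).
exists V', t; split=> [x Wx|x x' Wx Wx' O hx hx'].
  have [cx _] := cov_in c Wx; have [c'x _] := cov_in c' Wx.
  by split=> //; [exact: oIl|exact: oIr].
apply: (sheaf_sep (omodP F)) => y Oy.
have pOx := preimS (p := p) hx; have pOx' := preimS (p := p) hx'.
have Wy : oset W (p y).
  by case: (cov_in c Wx) => _; apply; case: (hx _ Oy).
have [Vy _ _] := hV y Wy; pose O' := oI (preimo p O) (V y).
have hl : O' `<=` preimo p O by exact: oIl.
have hr : O' `<=` V y by exact: oIr.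
have hO'x := subset_trans hl pOx; have hO'x' := subset_trans hl pOx'.
have hO'y := subset_trans hr (VV' y Wy).
exists O'; split=> //.
have tO z (Wz : oset W z) (hz : O `<=` V' z) (hOz : O' `<=` preimo p (V' z)) :
    rs (preimo p O) O' (rs (V' z) O (t z) : F (preimo p O)) = rs _ O' (b y) + D (p y) z O'.
  by rewrite (pushf_rsE _ hz hl); apply: (tE z Wz); exists y.
have cO (d : cocycle W pF) : O `<=` oI (cov d x) (cov d x') ->
    rs (preimo p O) O' (rs _ O (cval d x x') : F (preimo p O)) = yval d x x' O'.
  by move=> h; rewrite pushf_rsE.
transitivity (D x x' O').
  rewrite [LHS](rsB (M := F)) // !cO //; move=> z Oz; split;
    by [case: (hx _ Oz)|case: (hx' _ Oz)].
(* Near [y] both glued sections are computed with the same [z = y], so [b_y] cancels and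
   [D(p y, x') - D(p y, x) = D(x, x')] remains. *)
rewrite [RHS](rsB (M := F)) // !tO // opprD addrACA subrr add0r.
by rewrite -(DP (p y) x x' O') // [RHS]addrAC subrr add0r.
Qed.
End PullTheory.

(** * Connections and Atiyah classes *)

(** The rearrangement by which two families of local connections have cocycles differing by a
    coboundary. *)
Lemma addrBB (V : zmodType) (a b c d : V) : (a - b) - (c - d) = (a - c) - (b - d).
Proof. by rewrite !opprB !(addrC d) addrACA. Qed.
(** The common term [y] is the Leibniz term, which cancels in the difference of two connections. *)
Lemma addrDB (V : zmodType) (x y z x' z' : V) :
  (x' + y + z') - (x + y + z) = x' - x + (z' - z).
Proof. by rewrite opprD addrACA opprD (addrACA x') subrr addr0. Qed.

Section Connections.
Variables (k : fieldType) (X : rspace k) (F : omod X).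
Local Notation OF := (tensor (Omega X) F).
Local Notation J := (jets F).

(* A splitting of the jet sequence, i.e. a connection s |-> (sigma s).2. *)
Definition splits (U : opens X) (sigma : sHom F J U) : Prop :=
  forall (V : opens X) (h : V `<=` U) (s : F V), ((sigma : shom F J U) V h s).1 = s.

Definition nabla (U : opens X) (sigma : sHom F J U) (V : opens X) (h : V `<=` U) (s : F V) : OF V :=
  ((sigma : shom F J U) V h s).2.

Section Nabla.
Variables (U : opens X) (sigma : sHom F J U) (ss : splits sigma).
Lemma nabla_irr (V : opens X) (h h' : V `<=` U) s : nabla sigma h s = nabla sigma h' s.
Proof. by rewrite (Prop_irrelevance h h'). Qed.
Lemma nabla_lin (V : opens X) (h : V `<=` U) a s t :
  nabla sigma h (a *: s + t) = a *: nabla sigma h s + tpure (dd a) s + nabla sigma h t.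
Proof. by rewrite /nabla shom_lin /= ss. Qed.
Lemma nabla_rs (V W : opens X) (h : V `<=` U) (h' : W `<=` U) s : W `<=` V ->
  nabla sigma h' (rs V W s) = rs V W (nabla sigma h s).
Proof. by move=> hW; rewrite /nabla (shom_rs _ h h'). Qed.
Lemma splits_rs (W : opens X) : W `<=` U -> splits (rs U W sigma).
Proof.
move=> hW V h s; have hVU := subset_trans h hW.
by rewrite (shom_rE _ hW h hVU).
Qed.
Lemma nabla_res (W : opens X) (hW : W `<=` U) (V : opens X) (h : V `<=` W) (h' : V `<=` U) s :
  nabla (rs U W sigma) h s = nabla sigma h' s.
Proof. by rewrite /nabla (shom_rE _ hW h h'). Qed.
End Nabla.

Section Difference.
Variables (U U' : opens X) (sigma : sHom F J U) (sigma' : sHom F J U').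
Hypotheses (ss : splits sigma) (ss' : splits sigma').
Definition diff_fun (V : opens X) (h : V `<=` oI U U') (s : F V) : OF V :=
  nabla sigma' (subset_trans h (@oIr _ _ _)) s - nabla sigma (subset_trans h (@oIl _ _ _)) s.
Lemma diff_lin (V : opens X) (h : V `<=` oI U U') a s t :
  diff_fun h (a *: s + t) = a *: diff_fun h s + diff_fun h t.
Proof.
by rewrite /diff_fun !nabla_lin // scalerBr addrDB.
Qed.
Lemma diff_rs (V W : opens X) (h : V `<=` oI U U') (h' : W `<=` oI U U') s : W `<=` V ->
  diff_fun h' (rs V W s) = rs V W (diff_fun h s).
Proof.
move=> hW; rewrite /diff_fun rsB //.
by rewrite -(nabla_rs _ _ (subset_trans h' (@oIr _ _ _))) // -(nabla_rs _ _ (subset_trans h' (@oIl _ _ _))).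
Qed.
Definition conn_diff : sHom F OF (oI U U') := Shom diff_lin diff_rs.
Lemma conn_diffE (V : opens X) (h : V `<=` oI U U') (hl : V `<=` U) (hr : V `<=` U') s :
  (conn_diff : shom _ _ _) V h s = nabla sigma' hr s - nabla sigma hl s.
Proof. by congr (_ - _); apply: nabla_irr. Qed.
End Difference.

Section DualBasis.
Variables (U : opens X) (r : nat) (phi : 'I_r -> shom F (Omodule X) U) (m : 'I_r -> F U).
Hypothesis hd : dual_basis phi m.
Definition dual_conn_fun (V : opens X) (h : V `<=` U) (s : F V) : J V :=
  (s, \sum_i tpure (dd (phi i V h s : fn X V)) (rs U V (m i))).
Lemma dual_conn_lin (V : opens X) (h : V `<=` U) a s t :
  dual_conn_fun h (a *: s + t) = a *: dual_conn_fun h s + dual_conn_fun h t.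
Proof.
congr pair; rewrite [RHS]/=.
have hdd := kd_deriv (kcst_res (X := X)) V.
(* Expanding [s] in the dual basis matches [da (x) s] with the terms [phi_i(s) da (x) m_i] coming
   from [d(a phi_i(s))]. *)
rewrite [in tpure (dd a) s](hd h s).
have -> : tpure (dd a) (\sum_i (phi i V h s : fn X V) *: rs U V (m i)) =
    \sum_i (phi i V h s : fn X V) *: tpure (dd a) (rs U V (m i)).
  elim/big_rec2: _ => [|i u v _ <-]; first exact: tpure0r.
  by rewrite tpureDr tpureZr.
rewrite scaler_sumr -!big_split; apply: eq_bigr => i _ /=.
rewrite shom_lin /dd (Defs.derivD hdd) (Defs.derivM hdd) !tpureDl !tpureZl.
by congr (_ + _).
Qed.
Lemma dual_conn_rs (V W : opens X) (h : V `<=` U) (h' : W `<=` U) s : W `<=` V ->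
  dual_conn_fun h' (rs V W s) = rs V W (dual_conn_fun h s).
Proof.
move=> hW; congr pair; rewrite [RHS]rs_sum //; apply: eq_bigr => i _.
rewrite -tpure_rs // rs_comp // (shom_rs _ h) //; congr tpure.
exact: kd_rs.
Qed.
Definition dual_conn : sHom F J U := Shom dual_conn_lin dual_conn_rs.
Lemma dual_conn_splits : splits dual_conn. Proof. by []. Qed.
Lemma dual_connE (V : opens X) (h : V `<=` U) s :
  nabla dual_conn h s = \sum_i tpure (dd (phi i V h s : fn X V)) (rs U V (m i)).
Proof. by []. Qed.
End DualBasis.

Section AtiyahClass.
Variable W : opens X.
Notation represents := (represents_ext (jets_in F) (jets_pr F) (W := W)).

(** [ext_class] picks some represented class. Two choices of local splittings differ by linear maps,
    which form the cochain relating their cocycles. *)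
Lemma ext_class_jets c : represents c ->
  ext_class (jets_in F) (jets_pr F) W = \pi_(H1 W (sHom F OF))%qT c.
Proof.
move=> hc; rewrite /ext_class; set P := [set a | _].
have [c' [s' [hs' hc']] ->] : P (xget (H1_zero W (sHom F OF)) P).
  by apply: xgetPex; exists (\pi_(H1 W (sHom F OF))%qT c), c.
have [s [hs hcs]] := hc.
have sP x : oset W x -> splits (s x) by move=> Wx V h t; apply: hs.
have sP' x : oset W x -> splits (s' x) by move=> Wx V h t; apply: hs'.
apply/esym/H1_eqP/asboolP.
have ex x : exists b : sHom F OF (oI (cov c x) (cov c' x)), oset W x ->
    forall (V : opens X) (h : V `<=` oI (cov c x) (cov c' x)) (hl : V `<=` cov c x)
      (hr : V `<=` cov c' x) t,
    (b : shom _ _ _) V h t = nabla (s' x) hr t - nabla (s x) hl t.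
  have [Wx|nWx] := pselect (oset W x); last by exists 0.
  by exists (conn_diff (sP x Wx) (sP' x Wx)) => _ V h hl hr t; apply: conn_diffE.
exists (fun x => oI (cov c x) (cov c' x)), (fun x => projT1 (cid (ex x))).
split=> [x Wx|x y Wx Wy O hx hy].
  have [? _] := cov_in c Wx; have [? _] := cov_in c' Wx.
  by split=> //; [exact: oIl|exact: oIr].
have hxl := subset_trans hx (@oIl _ _ _); have hxr := subset_trans hx (@oIr _ _ _).
have hyl := subset_trans hy (@oIl _ _ _); have hyr := subset_trans hy (@oIr _ _ _).
apply: shom_ext => V h t.
have vE (G H : sHom F OF O) : (G - H : shom _ _ _) V h t = (G : shom _ _ _) V h t - (H : shom _ _ _) V h t.
  by rewrite shom_addE shom_oppE.
rewrite !vE.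
have hO Q (q : sHom F OF Q) (hQ : O `<=` Q) (hV : V `<=` Q) :
    (rs _ O q : shom _ _ _) V h t = (q : shom _ _ _) V hV t by apply: shom_rE.
rewrite (hO _ _ (oIs hxr hyr) (oIs (subset_trans h hxr) (subset_trans h hyr))).
rewrite (hO _ _ (oIs hxl hyl) (oIs (subset_trans h hxl) (subset_trans h hyl))).
rewrite (hO _ _ hy (subset_trans h hy)) (hO _ _ hx (subset_trans h hx)).
rewrite (projT2 (cid (ex y)) Wy _ _ (subset_trans h hyl) (subset_trans h hyr)).
rewrite (projT2 (cid (ex x)) Wx _ _ (subset_trans h hxl) (subset_trans h hxr)).
have /(congr1 snd) /= -> := hc' x y Wx Wy V (subset_trans h hxr) (subset_trans h hyr) t.
have /(congr1 snd) /= -> := hcs x y Wx Wy V (subset_trans h hxl) (subset_trans h hyl) t.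
rewrite -/(nabla _ _ _) -/(nabla _ _ _) -/(nabla _ _ _) -/(nabla _ _ _).
exact: addrBB.
Qed.

(** Surjectivity of [tev] on [H1], which uses local freeness, ensures that [At] is a genuine
    preimage and not the default value. *)
Lemma push_tev_At n c : locally_free n F -> represents c ->
  push W (tev (Omega X) F) (At W F) = \pi_(H1 W (sHom F OF))%qT c.
Proof.
move=> hF hc; rewrite -(ext_class_jets hc) /At.
set P := [set a | _]; apply: (@xgetPex _ _ P).
by apply: push_surj; apply: tev_iso hF.
Qed.

Lemma push_tid_AtL : locally_free 1 F -> push W (tid F) (AtL F W) = At W F.
Proof.
move=> hF; rewrite /AtL; set P := [set a | _]; apply: (@xgetPex _ _ P).
by apply: push_surj; apply: tid_iso.
Qed.
End AtiyahClass.
End Connections.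

(** * The Atiyah class of a line bundle computed on the base *)

Section LineAtiyahPull.
Variables (k : fieldType) (Y X : rspace k) (p : mor Y X) (L : omod Y).
Hypothesis hL : locally_free 1 L.
Local Notation OY := (Omega Y).
Local Notation pO := (pushf p OY).

Lemma line_tev_inj (O : opens Y) (w w' : OY O) :
  (forall (V : opens Y) (h : V `<=` O) (s : L V), tpure (rs O V w) s = tpure (rs O V w') s) -> w = w'.
Proof.
move=> H; apply: (proj1 (tid_iso hL (@opens_refl _ O))).
apply: (proj1 (tev_iso OY hL (@opens_refl _ O))).
by apply: shom_ext => V h s; rewrite !tidE H.
Qed.

Variable W : opens X.

Definition conn_cocycle (c : cocycle W pO)
    (sigma : forall x, sHom L (jets L) (preimo p (cov c x))) : Prop :=
  forall x y, oset W x -> oset W y -> forall (V : opens Y)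
    (hx : V `<=` preimo p (cov c x)) (hy : V `<=` preimo p (cov c y)) (s : L V),
  tpure (yval c x y V) s = nabla (sigma y) hy s - nabla (sigma x) hx s.

(** The difference of two connections on a line bundle is multiplication by a unique form. Existence
    of the form gives [v], uniqueness gives the cocycle condition. The covering is prescribed so
    that it can be shared with the cocycle of [E]. *)
Lemma conn_cocycle_ex (U : X -> opens X)
    (hU : forall x, oset W x -> oset (U x) x /\ U x `<=` W)
    (sigma : forall x, sHom L (jets L) (preimo p (U x))) :
  (forall x, oset W x -> splits (sigma x)) ->
  exists (v : forall x y, pO (oI (U x) (U y)))
    (vP : forall x y z, oset W x -> oset W y -> oset W z ->
      forall O : opens X, O `<=` U x -> O `<=` U y -> O `<=` U z ->
      rs _ O (v x y) + rs _ O (v y z) = rs _ O (v x z)),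
  conn_cocycle (c := Cocycle hU vP) sigma.
Proof.
move=> ss.
pose G x y := preimo p (oI (U x) (U y)).
have Gl x y : G x y `<=` preimo p (U x) by move=> t [].
have Gr x y : G x y `<=` preimo p (U y) by move=> t [].
have ex x y : exists v : OY (G x y), oset W x -> oset W y ->
    forall (V : opens Y) (h : V `<=` G x y) (hl : V `<=` preimo p (U x))
      (hr : V `<=` preimo p (U y)) (s : L V),
    tpure (rs (G x y) V v) s = nabla (sigma y) hr s - nabla (sigma x) hl s.
  have [Wx|nWx] := pselect (oset W x); last by exists 0.
  have [Wy|nWy] := pselect (oset W y); last by exists 0.
  pose d := rs _ (G x y) (conn_diff (ss x Wx) (ss y Wy)).
  have hG : G x y `<=` oI (preimo p (U x)) (preimo p (U y)) by [].
  have [z ez] := proj2 (tev_iso OY hL (@opens_refl _ (G x y))) d.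
  have [v ev] := proj2 (tid_iso hL (@opens_refl _ (G x y))) z.
  exists v => _ _ V h hl hr s; rewrite -(tidE h) ev ez.
  by rewrite (shom_rE _ hG h (subset_trans h hG)); apply: conn_diffE.
pose v x y : pO (oI (U x) (U y)) := projT1 (cid (ex x y)).
have vE x y (Wx : oset W x) (Wy : oset W y) := projT2 (cid (ex x y)) Wx Wy.
have vP x y z : oset W x -> oset W y -> oset W z ->
    forall O : opens X, O `<=` U x -> O `<=` U y -> O `<=` U z ->
    rs _ O (v x y) + rs _ O (v y z) = rs _ O (v x z).
  move=> Wx Wy Wz O hx hy hz; apply: line_tev_inj => V h s.
  have hxy := oIs hx hy; have hyz := oIs hy hz; have hxz := oIs hx hz.
  have kx := subset_trans h (preimS (p := p) hx); have ky := subset_trans h (preimS (p := p) hy).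
  have kz := subset_trans h (preimS (p := p) hz).
  rewrite [rs (preimo p O) V (_ + _)]rsD // tpureDl !(pushf_rsE (V := O)) //.
  rewrite (vE x y Wx Wy V _ kx ky); last exact: subset_trans (preimS hxy).
  rewrite (vE y z Wy Wz V _ ky kz); last exact: subset_trans (preimS hyz).
  rewrite (vE x z Wx Wz V _ kx kz); last exact: subset_trans (preimS hxz).
  by rewrite addrC addrA subrK.
exists v, vP => x y Wx Wy V hx hy s.
by apply: vE => //; apply: (@oIs _ (preimo p (U x)) (preimo p (U y))).
Qed.

(** Pulled back to [Y], the cocycle [c] consists of the differences of the connections
    [sigma (p y)], so it represents the Atiyah class of [L]. Injectivity of [pull] then identifies
    the chosen preimage with the class of [c]. *)
Lemma pull_inv_AtL (c : cocycle W pO) (sigma : forall x, sHom L (jets L) (preimo p (cov c x))) :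
  (forall x, oset W x -> splits (sigma x)) -> conn_cocycle sigma ->
  pull_inv p OY W (AtL L (preimo p W)) = \pi_(H1 W pO)%qT c.
Proof.
move=> ss hc; have pE : pull p OY W (\pi_(H1 W pO)%qT c) = AtL L (preimo p W).
  rewrite pull_pi; apply: (push_inj (tid_iso hL)); rewrite push_tid_AtL //.
  apply: (push_inj (tev_iso OY hL)); rewrite !push_pi; symmetry.
  apply: (push_tev_At hL); exists (fun y => sigma (p y)); split.
    by move=> y Wy V h s; apply: ss.
  move=> y y' Wy Wy' V hy hy' s.
  have E : nabla (sigma (p y')) hy' s - nabla (sigma (p y)) hy s = tpure (yval c (p y) (p y') V) s.
    by rewrite (hc (p y) (p y') Wy Wy' V hy hy').
  rewrite [LHS]/= /jets_in_fun; rewrite [RHS]surjective_pairing.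
  congr pair.
    rewrite /= [X in X - _](_ : _ = s) ?[X in _ - X](_ : _ = s) ?subrr //; exact: ss.
  rewrite [RHS]E -(pull_valE hy hy').
  by rewrite [LHS](tidE (oIs hy hy')).
apply: (@pull_inj _ _ _ p OY W); rewrite pE /pull_inv.
by set P := [set b | _]; apply: (@xgetPex _ _ P); exists (\pi_(H1 W pO)%qT c).
Qed.

Lemma conn_cocycle_restr (W' : opens X) (h : W' `<=` W) (c : cocycle W pO)
    (sigma : forall x, sHom L (jets L) (preimo p (cov c x))) :
  conn_cocycle sigma -> forall x y, oset W' x -> oset W' y -> forall (V : opens Y)
    (hx : V `<=` preimo p (cov (restr_cocycle h c) x))
    (hy : V `<=` preimo p (cov (restr_cocycle h c) y)) (s : L V),
  tpure (yval (restr_cocycle h c) x y V) s =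
  nabla (rs _ (preimo p (restr_cov W' c y)) (sigma y)) hy s -
  nabla (rs _ (preimo p (restr_cov W' c x)) (sigma x)) hx s.
Proof.
move=> hc x y Wx Wy V hx hy s.
have hl z : preimo p (restr_cov W' c z) `<=` preimo p (cov c z) by apply: preimS; apply: oIl.
have kx := subset_trans hx (hl x); have ky := subset_trans hy (hl y).
rewrite (nabla_res _ (hl y) hy ky) (nabla_res _ (hl x) hx kx).
rewrite -(hc x y (h _ Wx) (h _ Wy) V kx ky); congr tpure.
apply: pushf_rsE; first by move=> t [[? _] [? _]].
by move=> t Vt; split; [apply: hx|apply: hy].
Qed.
End LineAtiyahPull.

(** * Logarithmic forms *)

Section LogTensor.
Variables (k : fieldType) (X : rspace k) (I : forall U : opens X, fn X U -> Prop).
Hypothesis I_res : forall (U V : opens X) f, V `<=` U -> I f -> I (fres U V f).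
Local Notation W := (cosupp I).
Local Notation OL := (OmegaLog I_res).

Lemma log_valE (U V : opens X) (w : OL U) : V `<=` U ->
  subm_val (rs U V w) = rs (oI U W) (oI V W) (subm_val w : Omega X (oI U W)) :> Omega X (oI V W).
Proof. by move=> h; rewrite [LHS]subm_rsE. Qed.

(** The value of a logarithmic form is already a form on [oI U W]. The two inclusions pass between
    this set and [oI (oI U W) W], which has the same points. *)
Lemma log_separated (U : opens X) (w : OL U) : rs U (oI U W) w = 0 -> w = 0.
Proof.
move=> e; apply: subm_ext.
have h : oI (oI U W) W `<=` oI U W by exact: oIl.
have h' : oI U W `<=` oI (oI U W) W by apply: oIs => //; exact: oIr.
have E : rs (oI U W) (oI (oI U W) W) (subm_val w : Omega X (oI U W)) = 0.
  by rewrite -(log_valE w (@oIl _ U W)) e.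
by rewrite -[LHS](rs_id (M := Omega X)) -[LHS](rs_comp _ h h') E rs0.
Qed.

Section Inverse.
Variable M : psh X.

(* Omega(log) (x) M -> j_* j^* (Omega (x) M) *)
Definition unlog_pure (U : opens X) (w : OL U) (m : M U) : jpush W (tensor (Omega X) M) U :=
  tpure (subm_val w : Omega X (oI U W)) (rs U (oI U W) m).
Lemma unlog_l (U : opens X) a w w' m :
  @unlog_pure U (a *: w + w') m = a *: unlog_pure w m + unlog_pure w' m.
Proof.
rewrite /unlog_pure.
have -> : subm_val (a *: w + w') = fres U (oI U W) a *: (subm_val w : Omega X (oI U W)) +
    (subm_val w' : Omega X (oI U W)) :> Omega X (oI U W).
  by rewrite [LHS]subm_valD subm_valZ.
exact: tpure_l.
Qed.
Lemma unlog_r (U : opens X) a w m m' :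
  @unlog_pure U w (a *: m + m') = a *: unlog_pure w m + unlog_pure w m'.
Proof. by rewrite /unlog_pure rs_lin ?tpure_r //; apply: oIl. Qed.
Lemma unlog_rs (U V : opens X) (w : OL U) (m : M U) : V `<=` U ->
  unlog_pure (rs U V w) (rs U V m) = rs U V (unlog_pure w m).
Proof.
move=> h; have hS := @oIS _ _ W U V h.
rewrite /unlog_pure log_valE // rs_comp //; last exact: oIl.
rewrite -(rs_comp m (@oIl _ U W) hS); exact: tpure_rs.
Qed.
Definition unlog_hom : ohom (tensor OL M) (jpush W (tensor (Omega X) M)) :=
  tlift unlog_l unlog_r unlog_rs.
Definition unlog_sec (U : opens X) (z : tensor OL M U) : tensor (Omega X) M U :=
  rs (oI U W) U (unlog_hom U z : tensor (Omega X) M (oI U W)).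

Local Notation kM := (tmap (klog I_res) (hid M)).

Lemma unlog_secE (U : opens X) (h : U `<=` W) (w : OL U) (m : M U) :
  unlog_sec (tpure w m) = tpure (rs (oI U W) U (subm_val w : Omega X (oI U W))) m.
Proof.
have h' := oI_sub h; rewrite /unlog_sec /unlog_hom tliftE /unlog_pure -tpure_rs //.
by rewrite rs_comp ?rs_id //; apply: oIl.
Qed.
Lemma unlog_sec_lin (U : opens X) (h : U `<=` W) a (s t : tensor OL M U) :
  unlog_sec (a *: s + t) = a *: unlog_sec s + unlog_sec t.
Proof.
have h' := oI_sub h.
have -> : unlog_sec (a *: s + t) = rs (oI U W) U (fres U (oI U W) a *:
    (unlog_hom U s : tensor (Omega X) M (oI U W)) + (unlog_hom U t : tensor (Omega X) M (oI U W))).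
  by congr (rs _ _ _); apply: (hf_lin unlog_hom a s t).
rewrite rs_lin // fres_comp ?fres_id //; exact: oIl.
Qed.
Lemma unlog_sec_rs (U V : opens X) (h : U `<=` W) (t : tensor OL M U) : V `<=` U ->
  unlog_sec (rs U V t) = rs U V (unlog_sec t).
Proof.
move=> hV; have hS := @oIS _ _ W U V hV.
have hI := oI_sub h; have hI' := oI_sub (subset_trans hV h).
have E1 : unlog_hom V (rs U V t) =
    rs (oI U W) (oI V W) (unlog_hom U t : tensor (Omega X) M (oI U W)) :> tensor (Omega X) M (oI V W).
  exact: (hf_rs unlog_hom t hV).
by rewrite /unlog_sec E1 !rs_comp.
Qed.

Lemma klog_val (U : opens X) (w : Omega X U) :
  subm_val (klog I_res U w) = rs U (oI U W) w :> Omega X (oI U W).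
Proof. by []. Qed.

(** The inverse is [unlog_sec]; the two compositions are compared with the identity on pure
    tensors. *)
Lemma klog_iso : iso_on W kM.
Proof.
have unK (V : opens X) (h : V `<=` W) (t : tensor (Omega X) M V) : unlog_sec (kM V t) = t.
  apply: (tensor_unique (M := Omega X) (N := M) (U := W)
    (f := fun V (h : V `<=` W) t => unlog_sec (kM V t)) (g := fun V (h : V `<=` W) t => t)
    _ _ _ _ _ h) => //.
  - by move=> V' h' a s' t'; rewrite hf_lin unlog_sec_lin.
  - by move=> V' V'' h' h'' s' hV; rewrite hf_rs // unlog_sec_rs.
  - move=> V' h' w m; rewrite tmap_pure unlog_secE // klog_val rs_comp ?rs_id //.
      exact: oIl.
    exact: oI_sub.
have kK (V : opens X) (h : V `<=` W) (t : tensor OL M V) : kM V (unlog_sec t) = t.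
  apply: (tensor_unique (M := OL) (N := M) (U := W)
    (f := fun V (h : V `<=` W) t => kM V (unlog_sec t)) (g := fun V (h : V `<=` W) t => t)
    _ _ _ _ _ h) => //.
  - by move=> V' h' a s' t'; rewrite unlog_sec_lin // hf_lin.
  - by move=> V' V'' h' h'' s' hV; rewrite unlog_sec_rs // hf_rs.
  - move=> V' h' w m; rewrite unlog_secE // tmap_pure; congr tpure; apply: subm_ext.
    rewrite [LHS]klog_val [LHS]rs_comp; [exact: rs_id|exact: oI_sub|exact: oIl].
move=> V h; split=> [s t e|t]; first by rewrite -(unK V h s) e unK.
by exists (unlog_sec t); apply: kK.
Qed.
End Inverse.

(** In a frame of [E] a section is a tuple of logarithmic forms, to which [log_separated]
    applies. *)
Lemma log_tensor_separated n (E : omod X) (V : opens X) (s t : tensor OL E V) :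
  locally_free n E -> rs V (oI V W) s = rs V (oI V W) t -> s = t.
Proof.
move=> hE e; apply: (sheaf_sep (omodP (tensor OL E))) => x Vx.
have [U [Ux hU [b hb]]] := frame_near hE Vx; exists U; split=> //.
rewrite (tensor_frameE hb (@opens_refl _ U) (rs V U s)).
rewrite (tensor_frameE hb (@opens_refl _ U) (rs V U t)).
apply: eq_bigr => j _; congr tpure; apply: subr0_eq; apply: log_separated.
have hl := @oIl _ U W; have hS := @oIS _ _ W V U hU.
rewrite rsB // -!(tcoord_res hb j _ (@opens_refl _ U) hl) !rs_comp //.
by rewrite -!(rs_comp _ (@oIl _ V W) hS) e subrr.
Qed.
End LogTensor.

Section Postcomposition.
Variables (k : fieldType) (X : rspace k) (M : psh X) (N N' : omod X) (g : ohom N N').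
Section Fun.
Variables (U : opens X) (f : shom M N U).
Definition post_fun (V : opens X) (h : V `<=` U) (s : M V) : N' V := g V (f V h s).
Lemma post_lin (V : opens X) (h : V `<=` U) a s t :
  post_fun h (a *: s + t) = a *: post_fun h s + post_fun h t.
Proof. by rewrite /post_fun shom_lin hf_lin. Qed.
Lemma post_rs (V W : opens X) (h : V `<=` U) (h' : W `<=` U) s : W `<=` V ->
  post_fun h' (rs V W s) = rs V W (post_fun h s).
Proof. by move=> hW; rewrite /post_fun (shom_rs _ h) // hf_rs. Qed.
Definition post_val : sHom M N' U := Shom post_lin post_rs.
End Fun.
Lemma post_hom_lin U a (f f' : sHom M N U) :
  post_val (a *: f + f') = a *: post_val f + post_val f'.
Proof.
apply: shom_ext => V h s; rewrite shom_addE shom_scaleE /= /post_fun.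
by rewrite [in LHS]shom_addE [in LHS]shom_scaleE hf_lin.
Qed.
Lemma post_hom_rs (U V : opens X) (f : sHom M N U) : V `<=` U ->
  post_val (rs U V f) = rs U V (post_val f).
Proof.
move=> hV; apply: shom_ext => W h s; have h' := subset_trans h hV.
by rewrite (shom_rE _ hV h h') /= /post_fun (shom_rE _ hV h h').
Qed.
Definition spost : ohom (sHom M N) (sHom M N') := Defs.Hom post_hom_lin post_hom_rs.
Lemma spostE (U V : opens X) (h : V `<=` U) (f : sHom M N U) s :
  (spost U f : shom M N' U) V h s = g V ((f : shom M N U) V h s).
Proof. by []. Qed.
End Postcomposition.

Lemma tev_natural (k : fieldType) (X : rspace k) (M M' E : omod X) (g : ohom M M')
    (U : opens X) (z : tensor M (sEnd E) U) :
  tev M' E U (tmap g (hid (sEnd E)) U z) = spost E (tmap g (hid E)) U (tev M E U z).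
Proof.
apply: (tensor_unique (U := U) (Q := sHom E (tensor M' E))
  (f := fun V (h : V `<=` U) z => tev M' E V (tmap g (hid (sEnd E)) V z))
  (g := fun V (h : V `<=` U) z => spost E (tmap g (hid E)) V (tev M E V z))) => //.
- by move=> V h a s t; rewrite !hf_lin.
- by move=> V h a s t; rewrite !hf_lin.
- by move=> V W h h' s hW; rewrite !hf_rs.
- by move=> V W h h' s hW; rewrite !hf_rs.
move=> V h m f; rewrite tmap_pure; apply: shom_ext => W hW s.
by rewrite tev_pure spostE tev_pure tmap_pure hf_rs.
Qed.

(** * The spectral cover *)

Section SpectralCharts.
Variables (k : fieldType) (X Y : rspace k) (n : nat) (E : omod X).
Variables (theta : ohom E (tensor (Omega X) E)) (p : mor Y X).
Variable tau : tensor (Omega X) (pushf p (Omodule Y)) (oT X).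
Hypotheses (hX : smooth1 X) (hE : locally_free n E) (hp : spectral_curve n theta tau).

(** [spectral_curve] speaks of affine sets carrying a Higgs matrix. A principal open subset of a
    chart with a generator of [Omega], inside a set with a frame of [E], is one: the matrix entries
    are the coordinates of [theta] in both frames. *)
Lemma spectral_chart (x : X) : exists U : opens X, [/\ oset U x,
  exists e : 'I_n -> E U, is_frame e & affine (preimo p U)].
Proof.
have [U [Ux affU [w hw]]] := smooth1_frame hX x.
have [V [Vx hV [e he]]] := frame_near hE Ux.
have [f [fx hf]] := affine_basis_D affU Ux Vx.
have fU := subset_trans hf hV.
have he' := frame_rs he hf; have hw' := frame_rs hw fU.
exists (Dopen f); split=> //; first by exists (fun j => rs V (Dopen f) (e j)).
have ex i j : exists a : fn X (Dopen f), tcoord he' i (theta _ (rs V (Dopen f) (e j))) =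
    a *: rs U (Dopen f) w.
  have [a ea] := line_frame hw' (tcoord he' i (theta _ (rs V (Dopen f) (e j)))) (@opens_refl _ _).
  by exists a; rewrite ea rs_id.
pose A := \matrix_(i < n, j < n) projT1 (cid (ex i j)).
have hA : higgs_matrix theta (fun j => rs V (Dopen f) (e j)) (rs U (Dopen f) w) A.
  split=> // j; rewrite [LHS](tensor_frameE he' (@opens_refl _ _)).
  by apply: eq_bigr => i _; rewrite rs_id (projT2 (cid (ex i j))) mxE tpureZl.
by have [] := hp (affine_D affU f) hA.
Qed.
End SpectralCharts.

Lemma pushf_scale_lin (k : fieldType) (Y X : rspace k) (p : mor Y X) (F : omod Y) (U : opens X)
    (c : fn Y (preimo p U)) a (u v : F (preimo p U)) :
  c *: ((a *: (u : pushf p F U) + (v : pushf p F U) : pushf p F U) : F (preimo p U)) =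
  (a *: (c *: u : pushf p F U) + (c *: v : pushf p F U) : pushf p F U).
Proof.
transitivity (c *: (msharp p U a *: u + v)); first by [].
by rewrite scalerDr scalerA mulrC -scalerA.
Qed.

(** * The logarithmic connection on [E] *)

Section LogConnection.
Variables (k : fieldType) (X Y : rspace k) (n : nat) (E : omod X) (p : mor Y X).
Variables (L : omod Y) (e : ohom E (pushf p L)) (e' : ohom (pushf p L) E).
Hypothesis hE : locally_free n E.
Hypotheses (eK : forall U, cancel (e U) (e' U)) (e'K : forall U, cancel (e' U) (e U)).
Local Notation B := (pushf p (Omodule Y)).
Local Notation OL := (OmegaXlog p).
Local Notation OY := (Omega Y).
Variable lambda : ohom (pushf p OY) (tensor OL B).
Hypothesis hlambda : etale_identification lambda.
Local Notation k_ N := (tmap (klogX p) (hid N)).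
Local Notation refl V := (@opens_refl _ V).

Definition act (U : opens X) (b : fn Y (preimo p U)) (s : E U) : E U :=
  e' U (b *: (e U s : L (preimo p U))).
(* The action of a section of Omega(log) (x) p_* O_Y on E. *)
Definition rho (U : opens X) (z : tensor OL B U) (s : E U) : tensor OL E U :=
  (tev OL E U (tmap (hid OL) (mult e e') U z) : shom E (tensor OL E) U) U (refl U) s.

Lemma rho_pure (U : opens X) (w : OL U) (b : B U) (s : E U) :
  rho (tpure w b) s = tpure w (act b s).
Proof.
rewrite /rho tmap_pure tev_pure rs_id /= /mult_fun; congr tpure.
by rewrite (rs_id b).
Qed.
Lemma rho_lin (U : opens X) a (z z' : tensor OL B U) (s : E U) :
  rho (a *: z + z') s = a *: rho z s + rho z' s.
Proof. by rewrite /rho !hf_lin shom_addE shom_scaleE fres_id. Qed.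
Lemma rhoD (U : opens X) (z z' : tensor OL B U) (s : E U) : rho (z + z') s = rho z s + rho z' s.
Proof. by rewrite -[z]scale1r rho_lin !scale1r. Qed.
Lemma rho_at (U V : opens X) (h : V `<=` U) (z : tensor OL B U) (s : E V) :
  (tev OL E U (tmap (hid OL) (mult e e') U z) : shom E (tensor OL E) U) V h s = rho (rs U V z) s.
Proof. by rewrite /rho !hf_rs // (shom_rE _ h _ h). Qed.
Lemma rho_rs (U V : opens X) (z : tensor OL B U) (s : E U) : V `<=` U ->
  rho (rs U V z) (rs U V s) = rs U V (rho z s).
Proof. by move=> h; rewrite -(rho_at h) (shom_rs _ (refl U)). Qed.

Lemma Xo_iso (M : psh X) : iso_on (Xo p) (k_ M).
Proof. exact: klog_iso. Qed.

Lemma lambda_Xo (U : opens X) (h : U `<=` Xo p) (v : tensor (Omega X) B U) :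
  lambda U (kappa p U v) = k_ B U v.
Proof. by apply/hlambda. Qed.

Lemma kappa_surj_Xo (U : opens X) (h : U `<=` Xo p) (w : pushf p OY U) : exists v, kappa p U v = w.
Proof.
have [v ev] := proj2 (Xo_iso B h) (lambda U w); exists v.
by apply/(hlambda w v h).
Qed.

(** Both halves rest on [k (x) id] being bijective over [Xo]: injectivity because it equals
    [lambda o kappa], surjectivity because [etale_identification] turns a preimage of [lambda w]
    under it into a preimage of [w] under [kappa]. *)
Lemma kappa_iso : iso_on (Xo p) (kappa p).
Proof.
move=> U h; split=> [v v' ev|w]; last exact: kappa_surj_Xo.
by apply: (proj1 (Xo_iso B h)); rewrite -!lambda_Xo // ev.
Qed.

Lemma log_separatedE (U : opens X) (s t : tensor OL E U) :
  rs U (oI U (Xo p)) s = rs U (oI U (Xo p)) t -> s = t.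
Proof. by apply: log_tensor_separated hE. Qed.

(** The relation [lambda o kappa = k (x) id] is given over [Xo]; acting on [E] moves it to
    [Omega(log) (x) E], whose sections are determined there. *)
Lemma rho_lambda_kappa (U : opens X) (v : tensor (Omega X) B U) (s : E U) :
  rho (lambda U (kappa p U v)) s = rho (k_ B U v) s.
Proof.
apply: log_separatedE; have hl := @oIl _ U (Xo p).
by rewrite -!rho_rs // -!hf_rs // lambda_Xo //; apply: oIr.
Qed.

Lemma kappa_pure (U : opens X) (w : Omega X U) (b : B U) :
  kappa p U (tpure w b) = (b : fn Y (preimo p U)) *: (dpull p U w : OY (preimo p U)).
Proof. exact: tliftE. Qed.

Lemma act_rs (U V : opens X) (b : fn Y (preimo p U)) (s : E U) : V `<=` U ->
  rs U V (act b s) = act (fres (preimo p U) (preimo p V) b) (rs U V s).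
Proof.
move=> h; rewrite /act -hf_rs //; congr (e' V _); rewrite hf_rs //.
exact: (rsZ b (e U s : L (preimo p U)) (preimS h)).
Qed.
Lemma actM (U : opens X) (b b' : fn Y (preimo p U)) (s : E U) : act (b * b') s = act b (act b' s).
Proof. by rewrite /act e'K scalerA. Qed.

(* rho o lambda is linear over p_* O_Y: true over Xo, where lambda is inverse to
   kappa, hence everywhere, as Omega(log) (x) E has no section supported on the
   discriminant. *)
Lemma rho_lambda_linear (U : opens X) (b : fn Y (preimo p U)) (w : OY (preimo p U)) (s : E U) :
  rho (lambda U (b *: w : pushf p OY U)) s = rho (lambda U (w : pushf p OY U)) (act b s).
Proof.
apply: log_separatedE; set V := oI U (Xo p).
have hl : V `<=` U by exact: oIl. have hr : V `<=` Xo p by exact: oIr.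
rewrite -!rho_rs // act_rs // -!(hf_rs lambda) //.
have -> : rs U V (b *: w : pushf p OY U) =
    fres (preimo p U) (preimo p V) b *: rs (preimo p U) (preimo p V) w :> OY (preimo p V).
  exact: (rsZ b w (preimS hl)).
have -> : rs U V (w : pushf p OY U) = rs (preimo p U) (preimo p V) w :> OY (preimo p V) by [].
move: (fres _ _ b) (rs _ _ w) (rs U V s) => {}b {}w {}s.
have [v <-] := kappa_surj_Xo hr w.
(* Over [Xo] every form is some [kappa v], and [b kappa(w (x) b') = kappa(w (x) b b')], so induction
   on [v] applies. *)
pose P (O : opens X) (v : tensor (Omega X) B O) := forall (b : fn Y (preimo p O)) (s : E O),
  rho (lambda O (b *: (kappa p O v : OY (preimo p O)) : pushf p OY O)) s =
  rho (lambda O (kappa p O v)) (act b s).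
apply: (@tensor_ind _ _ (Omega X) B V P) => //.
- move=> O m b' hO c t; have hOX := subset_trans hO hr.
  rewrite lambda_Xo // tmap_pure rho_pure.
  have -> : c *: (kappa p O (tpure m b') : OY (preimo p O)) =
      kappa p O (tpure m (c * (b' : fn Y _) : B O)) :> OY (preimo p O).
    by rewrite !kappa_pure scalerA.
  by rewrite lambda_Xo // tmap_pure rho_pure /= mulrC actM.
- move=> O a z z' hO hz hz' c t.
  have -> : c *: (kappa p O (a *: z + z') : OY (preimo p O)) =
     (a *: (c *: (kappa p O z : OY (preimo p O)) : pushf p OY O) +
     (c *: (kappa p O z' : OY (preimo p O)) : pushf p OY O) : pushf p OY O) :> OY (preimo p O).
    by rewrite hf_lin; apply: pushf_scale_lin.
  by rewrite !hf_lin !rho_lin hz hz'.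
- move=> O z hO loc c t; apply: (sheaf_sep (omodP (tensor OL E))) => x Ox.
  have [T [Tx hT hz]] := loc x Ox; exists T; split=> //.
  rewrite -!rho_rs // act_rs // -!(hf_rs lambda) // -[in RHS](hf_rs (kappa p)) // -hz; congr (rho (lambda T _) _).
  rewrite [kappa p T _]hf_rs //.
  exact: (rsZ c (kappa p O z : OY (preimo p O)) (preimS hT)).
Qed.

Section DualBasis.
Variables (U : opens X) (r : nat).
Variables (phi : 'I_r -> shom L (Omodule Y) (preimo p U)) (m : 'I_r -> L (preimo p U)).
Hypothesis hd : dual_basis phi m.
Local Notation m_ i := (e' U (m i : pushf p L U)).

Definition nablalog (V : opens X) (h : V `<=` U) (s : E V) : tensor OL E V :=
  \sum_i rho (lambda V (dd (phi i (preimo p V) (preimS h) (e V s) : fn Y (preimo p V)) : pushf p OY V))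
    (rs U V (m_ i)).

Lemma sum_act (V : opens X) (h : V `<=` U) (s : E V) :
  s = \sum_i act (phi i (preimo p V) (preimS h) (e V s)) (rs U V (m_ i)).
Proof.
rewrite -{1}(eK s) {1}[e V s](hd (preimS h)).
transitivity (e' V (\sum_i ((phi i _ (preimS h) (e V s) : fn Y (preimo p V)) *:
    rs (preimo p U) (preimo p V) (m i) : pushf p L V))); first by [].
rewrite hf_sum; apply: eq_bigr => i _; rewrite /act -hf_rs // e'K.
by [].
Qed.

(** In [d(a f + g) = a df + f p^*da + dg] the middle term is [kappa(da (x) f)], on which [lambda] is
    known. *)
Lemma rho_lambda_dd (V : opens X) a (f g : fn Y (preimo p V)) (s : E V) :
  rho (lambda V (dd (msharp p V a * f + g) : pushf p OY V)) s =
  a *: rho (lambda V (dd f : pushf p OY V)) s + tpure (klogX p V (dd a)) (act f s) +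
  rho (lambda V (dd g : pushf p OY V)) s.
Proof.
have hdd := kd_deriv (kcst_res (X := Y)) (preimo p V).
have -> : dd (msharp p V a * f + g) = (a *: (dd f : pushf p OY V) +
    (kappa p V (tpure (dd a) (f : B V)) + (dd g : pushf p OY V)) : pushf p OY V) :> OY (preimo p V).
  rewrite kappa_pure addrA /dd (Defs.derivD hdd) (Defs.derivM hdd); congr (_ + _ *: _ + _).
  exact: (esym (kliftE (kcst_res (X := X)) (dpull_deriv p) (dpull_rs p) a)).
by rewrite hf_lin rho_lin hfD rhoD rho_lambda_kappa tmap_pure rho_pure addrA.
Qed.

Lemma nablalog_lin (V : opens X) (h : V `<=` U) a s t :
  nablalog h (a *: s + t) = a *: nablalog h s + k_ E V (tpure (dd a) s) + nablalog h t.
Proof.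
have -> : k_ E V (tpure (dd a) s) =
   \sum_i tpure (klogX p V (dd a)) (act (phi i (preimo p V) (preimS h) (e V s)) (rs U V (m_ i))).
  rewrite tmap_pure [hid E V s](sum_act h s).
  by elim/big_rec2: _ => [|i u v _ <-]; [exact: tpure0r|rewrite tpureDr].
rewrite /nablalog scaler_sumr -!big_split; apply: eq_bigr => i _.
rewrite -[RHS]rho_lambda_dd; congr (rho (lambda V (dd _)) _).
rewrite hf_lin; exact: (shom_lin (phi i) (preimS h) (msharp p V a) (e V s : L _) (e V t : L _)).
Qed.

Lemma nablalog_rs (V W : opens X) (h : V `<=` U) (h' : W `<=` U) s : W `<=` V ->
  nablalog h' (rs V W s) = rs V W (nablalog h s).
Proof.
move=> hW; rewrite rs_sum //; apply: eq_bigr => i _.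
rewrite -rho_rs // rs_comp // -(hf_rs lambda) //; congr (rho (lambda W _) _).
transitivity (dd (fres (preimo p V) (preimo p W) (phi i _ (preimS h) (e V s))) : OY (preimo p W)).
  congr dd; rewrite hf_rs //.
  exact: (shom_rs (phi i) (preimS h) (preimS h') (e V s) (preimS hW)).
by apply: kd_rs; apply: preimS.
Qed.

(* w (x) l |-> lambda(w) l; by [rho_lambda_linear] it does not depend on the dual
   basis used to define it. *)
Definition transfer (V : opens X) (h : V `<=` U) (z : tensor OY L (preimo p V)) : tensor OL E V :=
  \sum_i rho (lambda V (contract (phi i) z : pushf p OY V)) (rs U V (m_ i)).
Lemma transferD (V : opens X) (h : V `<=` U) (z z' : tensor OY L (preimo p V)) :
  transfer h (z + z') = transfer h z + transfer h z'.
Proof.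
rewrite /transfer -big_split; apply: eq_bigr => i _.
rewrite [contract _ _](contractD _ (preimS h)).
by rewrite [lambda V _]hfD rhoD.
Qed.
(** The coefficients [phi_i(l)] move from the form to the vectors [m_i], where they add up to
    [l]. *)
Lemma transfer_pure (V : opens X) (h : V `<=` U) (w : OY (preimo p V)) (l : L (preimo p V)) :
  transfer h (tpure w l) = rho (lambda V (w : pushf p OY V)) (e' V (l : pushf p L V)).
Proof.
rewrite [in RHS](sum_act h (e' V (l : pushf p L V))).
rewrite /rho shom_sum -/(rho _ _); apply: eq_bigr => i _.
by rewrite (contractE (phi i) (preimS h)) rho_lambda_linear e'K.
Qed.
End DualBasis.

(** The transfer uses one dual basis and the connection another. Since transfer is intrinsic on pure
    tensors, both connections can be transferred with the same basis and compared. *)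
Lemma transfer_nabla (U U' V : opens X) (h : V `<=` U) (h' : V `<=` U')
    r (phi : 'I_r -> shom L (Omodule Y) (preimo p U)) (m : 'I_r -> L (preimo p U)) (hd : dual_basis phi m)
    r' (phi' : 'I_r' -> shom L (Omodule Y) (preimo p U')) (m' : 'I_r' -> L (preimo p U'))
    (hd' : dual_basis phi' m') (s : E V) :
  transfer phi m h (nabla (dual_conn hd') (preimS h') (e V s)) = nablalog phi' m' h' s.
Proof.
rewrite dual_connE.
have t0 : transfer phi m h 0 = 0.
  by apply: (addrI (transfer phi m h 0)); rewrite -transferD !addr0.
rewrite (big_morph _ (transferD phi m h) t0); apply: eq_bigr => i _.
rewrite transfer_pure //; congr (rho _ _).
by rewrite -[RHS]hf_rs.
Qed.

Lemma rho_lambda_diff (U U' V : opens X) (h : V `<=` U) (h' : V `<=` U')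
    r (phi : 'I_r -> shom L (Omodule Y) (preimo p U)) (m : 'I_r -> L (preimo p U)) (hd : dual_basis phi m)
    r' (phi' : 'I_r' -> shom L (Omodule Y) (preimo p U')) (m' : 'I_r' -> L (preimo p U'))
    (hd' : dual_basis phi' m') (w : OY (preimo p V)) (s : E V) :
  tpure w (e V s : L (preimo p V)) =
    nabla (dual_conn hd') (preimS h') (e V s) - nabla (dual_conn hd) (preimS h) (e V s) ->
  rho (lambda V (w : pushf p OY V)) s = nablalog phi' m' h' s - nablalog phi m h s.
Proof.
move=> ew; rewrite -(transfer_nabla h h' hd hd') -(transfer_nabla h h hd hd).
apply/eqP; rewrite eq_sym subr_eq eq_sym -{1}(eK s) -(transfer_pure hd h) -transferD ew.
by rewrite subrK.
Qed.
End LogConnection.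

(** * Comparison of the two Atiyah classes *)

Section Main.
Variables (k : fieldType) (X Y : rspace k) (n : nat) (E : omod X).
Variables (theta : ohom E (tensor (Omega X) E)) (p : mor Y X).
Variable tau : tensor (Omega X) (pushf p (Omodule Y)) (oT X).
Hypotheses (hX : smooth1 X) (hE : locally_free n E) (hp : spectral_curve n theta tau).
Variables (L : omod Y) (e : ohom E (pushf p L)) (e' : ohom (pushf p L) E).
Hypothesis hL : locally_free 1 L.
Hypotheses (eK : forall U, cancel (e U) (e' U)) (e'K : forall U, cancel (e' U) (e U)).
Local Notation B := (pushf p (Omodule Y)).
Local Notation OL := (OmegaXlog p).
Local Notation OY := (Omega Y).
Local Notation pO := (pushf p OY).
Variable lambda : ohom pO (tensor OL B).
Hypothesis hlambda : etale_identification lambda.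
Local Notation k_ N := (tmap (klogX p) (hid N)).
Local Notation q := (centr_incl e e').
Local Notation mu := (sat_cores (mult e e')).

(** The connection on [E] and the dual basis of [L] are attached to the same open set, so that both
    cocycles have one covering. *)
Record chart (x : X) := Chart {
  ch_set : opens X;
  ch_in : oset ch_set x;
  ch_conn : sHom E (jets E) ch_set;
  ch_splits : splits ch_conn;
  ch_rank : nat;
  ch_phi : 'I_ch_rank -> shom L (Omodule Y) (preimo p ch_set);
  ch_m : 'I_ch_rank -> L (preimo p ch_set);
  ch_dual : dual_basis ch_phi ch_m }.
Arguments ch_splits {x} c [V] h s : rename.
Arguments ch_dual {x} c [V] h s : rename.
Arguments ch_phi {x} c _ : rename.
Arguments ch_m {x} c _ : rename.

Lemma chart_ex (x : X) : exists c : chart x, True.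
Proof.
have [U [Ux [b hb] affU]] := spectral_chart hX hE hp x.
have [r [phi [m hd]]] := line_dual_basis hL affU.
by exists (Chart Ux (dual_conn_splits (frame_dual_basis hb)) hd).
Qed.
Definition charts (x : X) : chart x := projT1 (cid (chart_ex x)).
Local Notation U x := (ch_set (charts x)).

Lemma charts_in x : oset (oT X) x -> oset (U x) x /\ U x `<=` oT X.
Proof. by move=> _; split=> //; apply: ch_in. Qed.

Definition line_conn x : sHom L (jets L) (preimo p (U x)) := dual_conn (ch_dual (charts x)).

Lemma E_cocycleP x y z : oset (oT X) x -> oset (oT X) y -> oset (oT X) z ->
  forall O : opens X, O `<=` U x -> O `<=` U y -> O `<=` U z ->
  rs _ O (conn_diff (ch_splits (charts x)) (ch_splits (charts y))) +
  rs _ O (conn_diff (ch_splits (charts y)) (ch_splits (charts z))) =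
  rs _ O (conn_diff (ch_splits (charts x)) (ch_splits (charts z))).
Proof.
move=> _ _ _ O hx hy hz; apply: shom_ext => V h s; rewrite shom_addE.
have kx := subset_trans h hx; have ky := subset_trans h hy; have kz := subset_trans h hz.
rewrite (shom_rE _ (oIs hx hy) h (oIs kx ky)) (shom_rE _ (oIs hy hz) h (oIs ky kz)).
rewrite (shom_rE _ (oIs hx hz) h (oIs kx kz)).
rewrite (conn_diffE _ _ _ kx ky) (conn_diffE _ _ _ ky kz) (conn_diffE _ _ _ kx kz).
by rewrite addrC addrA subrK.
Qed.
Definition E_cocycle : cocycle (oT X) (sHom E (tensor (Omega X) E)) :=
  Cocycle charts_in E_cocycleP.

Lemma E_cocycle_represents : represents_ext (jets_in E) (jets_pr E) E_cocycle.
Proof.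
exists (fun x => ch_conn (charts x)); split; first by move=> x _; apply: ch_splits.
move=> x y _ _ V hx hy s; rewrite [RHS]surjective_pairing [LHS]/= /jets_in_fun; congr pair.
  rewrite /= [X in X - _](_ : _ = s) ?[X in _ - X](_ : _ = s) ?subrr //; exact: ch_splits.
exact: (conn_diffE (ch_splits (charts x)) (ch_splits (charts y)) (oIs hx hy) hx hy s).
Qed.

Section Cochain.
Variable x : X.
Local Notation c := (charts x).
(** The cochain whose coboundary is the difference of the two cocycles; both connections have the
    Leibniz term [(k (x) id)(da (x) s)], hence its linearity. *)
Definition log_diff_fun (V : opens X) (h : V `<=` U x) (s : E V) : tensor OL E V :=
  nablalog e e' lambda (ch_phi c) (ch_m c) h s - k_ E V (nabla (ch_conn c) h s).
Lemma log_diff_lin (V : opens X) (h : V `<=` U x) a s t :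
  log_diff_fun h (a *: s + t) = a *: log_diff_fun h s + log_diff_fun h t.
Proof.
rewrite /log_diff_fun (nablalog_lin hE eK e'K hlambda (ch_dual c)).
rewrite (nabla_lin (ch_splits c)) [k_ E V (_ + _ + _)]hfD [k_ E V (_ + _)]hfD hfZ.
by rewrite scalerBr addrDB.
Qed.
Lemma log_diff_rs (V W : opens X) (h : V `<=` U x) (h' : W `<=` U x) s : W `<=` V ->
  log_diff_fun h' (rs V W s) = rs V W (log_diff_fun h s).
Proof.
move=> hW; rewrite /log_diff_fun rsB // -hf_rs // -(nabla_rs _ h h') //.
by rewrite (nablalog_rs _ _ _ _ _ h h').
Qed.
Definition log_diff : sHom E (tensor OL E) (U x) := Shom log_diff_lin log_diff_rs.
End Cochain.

Lemma tmap_centr (V : opens X) (z : tensor OL B V) :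
  tmap (hid OL) q V (tmap (hid OL) mu V z) = tmap (hid OL) (mult e e') V z.
Proof.
apply: (tensor_unique (U := V) (Q := tensor OL (sEnd E))
  (f := fun V h z => tmap (hid OL) q V (tmap (hid OL) mu V z))
  (g := fun V h z => tmap (hid OL) (mult e e') V z)) => //.
- by move=> W h a s t; rewrite !hf_lin.
- by move=> W h a s t; rewrite !hf_lin.
- by move=> W W' h h' s hW; rewrite !hf_rs.
- by move=> W W' h h' s hW; rewrite !hf_rs.
by move=> W h w b; rewrite !tmap_pure.
Qed.

Lemma tmap_klog_mult (V : opens X) (z : tensor (Omega X) B V) :
  k_ (sEnd E) V (tmap (hid (Omega X)) (mult e e') V z) = tmap (hid OL) (mult e e') V (k_ B V z).
Proof.
apply: (tensor_unique (U := V) (Q := tensor OL (sEnd E))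
  (f := fun V h z => k_ (sEnd E) V (tmap (hid (Omega X)) (mult e e') V z))
  (g := fun V h z => tmap (hid OL) (mult e e') V (k_ B V z))) => //.
- by move=> W h a s t; rewrite !hf_lin.
- by move=> W h a s t; rewrite !hf_lin.
- by move=> W W' h h' s hW; rewrite !hf_rs.
- by move=> W W' h h' s hW; rewrite !hf_rs.
by move=> W h w b; rewrite !tmap_pure.
Qed.

Section Classes.
Variable v : forall x y, pO (oI (U x) (U y)).
Hypothesis vP : forall x y z, oset (oT X) x -> oset (oT X) y -> oset (oT X) z ->
  forall O : opens X, O `<=` U x -> O `<=` U y -> O `<=` U z ->
  rs _ O (v x y) + rs _ O (v y z) = rs _ O (v x z).
Local Notation c := (Cocycle charts_in vP).
Hypothesis hc : conn_cocycle (c := c) line_conn.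

Lemma line_conn_splits x : splits (line_conn x).
Proof. exact: dual_conn_splits. Qed.

Lemma pull_inv_total : pull_inv p OY (oT X) (AtL L (preimo p (oT X))) = \pi_(H1 (oT X) pO)%qT c.
Proof. by apply: (pull_inv_AtL hL _ hc) => x _; apply: line_conn_splits. Qed.

(** The two sides involve independent choices. They agree because the restricted connections
    represent the class over [W] by the restriction of the same cocycle. *)
Lemma pull_inv_restr (W : opens X) (h : W `<=` oT X) :
  pull_inv p OY W (AtL L (preimo p W)) = restr h (pull_inv p OY (oT X) (AtL L (preimo p (oT X)))).
Proof.
rewrite pull_inv_total restr_pi.
apply: (pull_inv_AtL hL (c := restr_cocycle h c) (sigma := fun x => rs _ (preimo p (restr_cov W c x)) (line_conn x))).
  move=> x Wx; apply: splits_rs; first exact: line_conn_splits.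
  by apply: preimS; apply: oIl.
exact: conn_cocycle_restr.
Qed.

Lemma At_log_global : push (oT X) (k_ (sEnd E)) (At (oT X) E) =
  push (oT X) (tmap (hid OL) q) (Atlog e e' lambda).
Proof.
(* The comparison takes place in [Hom(E, Omega(log) (x) E)], where both cocycles are differences of
   connections. *)
apply: (push_inj (tev_iso OL hE)).
have -> : push (oT X) (tev OL E) (push (oT X) (k_ (sEnd E)) (At (oT X) E)) =
    push (oT X) (spost E (k_ E)) (push (oT X) (tev (Omega X) E) (At (oT X) E)).
  by rewrite !push_comp; apply: push_ext => V s _; apply: tev_natural.
have -> : push (oT X) (tmap (hid OL) q) (Atlog e e' lambda) =
    push (oT X) (hcomp (tmap (hid OL) (mult e e')) lambda)
      (pull_inv p OY (oT X) (AtL L (preimo p (oT X)))).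
  rewrite [LHS](push_comp (tmap (hid OL) q) (hcomp (tmap (hid OL) mu) lambda)).
  by apply: push_ext => V s _; apply: tmap_centr.
rewrite (push_tev_At hE E_cocycle_represents) push_pi pull_inv_total !push_pi.
apply/H1_eqP/asboolP; exists (fun x => U x), log_diff.
split=> [x _|x y _ _ O hx hy].
  by split; [exact: ch_in|exact: opens_refl|exact: opens_refl].
apply: shom_ext => V h s.
have vE (G H : sHom E (tensor OL E) O) :
    (G - H : shom _ _ _) V h s = (G : shom _ _ _) V h s - (H : shom _ _ _) V h s.
  by rewrite shom_addE shom_oppE.
have kx := subset_trans h hx; have ky := subset_trans h hy.
have kxy := oIs kx ky.
rewrite !vE (shom_rE _ (oIs hx hy) h kxy) (shom_rE _ (oIs hx hy) h kxy).
rewrite (shom_rE _ hx h kx) (shom_rE _ hy h ky).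
have c1E : (cval (push_cocycle (spost E (k_ E)) E_cocycle) x y : shom _ _ _) V kxy s =
    k_ E V (nabla (ch_conn (charts y)) ky s) - k_ E V (nabla (ch_conn (charts x)) kx s).
  rewrite -hfB; congr (k_ E V _).
  exact: (conn_diffE (ch_splits (charts x)) (ch_splits (charts y)) kxy kx ky s).
have c2E : (cval (push_cocycle (tev OL E)
    (push_cocycle (hcomp (tmap (hid OL) (mult e e')) lambda) c)) x y : shom _ _ _) V kxy s =
    rho e e' (lambda V (rs _ V (v x y))) s.
  by rewrite hf_rs //; apply: rho_at.
rewrite [X in X - _]c2E [X in _ - X]c1E.
rewrite (rho_lambda_diff hE eK e'K hlambda (h := kx) (h' := ky)
  (hd := ch_dual (charts x)) (hd' := ch_dual (charts y))).
  exact: addrBB.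
exact: (hc (x := x) (y := y) I I (preimS kx) (preimS ky) (e V s)).
Qed.

Lemma At_log_local : let j_res M := @restr _ X (oT X) (Xo p) (@Xo_sub _ Y X p) M in
  unlog (push (Xo p) (tmap (hid OL) q) (j_res _ (Atlog e e' lambda))) = j_res _ (At (oT X) E) /\
  push (Xo p) (tmap (hid (Omega X)) (mult e e')) (beta_spec p L) = j_res _ (At (oT X) E).
Proof.
move=> j_res.
(* Both equalities are tested after applying [k (x) id], which turns their common right side into
   the restriction of the global identity. *)
have kinj := push_inj (Xo_iso (p := p) (sEnd E)).
have E1 : push (Xo p) (k_ (sEnd E)) (j_res _ (At (oT X) E)) =
    push (Xo p) (tmap (hid OL) q) (j_res _ (Atlog e e' lambda)).
  by rewrite /j_res push_restr At_log_global -push_restr.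
split; apply: kinj; rewrite E1.
  rewrite /unlog; set P := [set b | _]; apply: (@xgetPex _ _ P).
  by exists (j_res _ (At (oT X) E)).
have kb : push (Xo p) (kappa p) (beta_spec p L) =
    pull_inv p OY (Xo p) (AtL L (preimo p (Xo p))).
  rewrite /beta_spec; set P := [set b | _]; apply: (@xgetPex _ _ P).
  by apply: push_surj; apply: kappa_iso hlambda.
(* The restricted class is now the image of [beta_spec] under [kappa] followed by [lambda], that is,
   under [k (x) id]. *)
rewrite /Atlog /j_res -push_restr -(pull_inv_restr (@Xo_sub _ Y X p)) -kb !push_comp.
apply: push_ext => V s hV /=.
by rewrite [LHS]tmap_klog_mult [RHS]tmap_centr (lambda_Xo hlambda hV).
Qed.
End Classes.
End Main.

Theorem theorem4p6 (R : realType) (X Y : rspace R[i]) (hX : smooth_projective_curve X)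
    (n : nat) (E : omod X) (hE : locally_free n E)
    (theta : ohom E (tensor (Omega X) E)) (htheta : regular_semisimple n theta)
    (p : mor Y X) (tau : tensor (Omega X) (pushf p (Omodule Y)) (oT X))
    (hp : spectral_curve n theta tau) (hYs : scheme Y) (hY : smooth1 Y)
    (L : omod Y) (e : ohom E (pushf p L)) (e' : ohom (pushf p L) E)
    (hL : spectral_bundle theta tau e e')
    (hD : reduced_ideal (discr_ideal p))
    (lambda : ohom (pushf p (Omega Y)) (tensor (OmegaXlog p) (pushf p (Omodule Y))))
    (hlambda : etale_identification lambda) :
  let k := klogX p in
  let q := centr_incl e e' in
  let m := mult e e' in
  let j_res M := @restr _ X (oT X) (Xo p) (@Xo_sub _ Y X p) M in
  push (oT X) (tmap k (hid (sEnd E))) (At (oT X) E) =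
    push (oT X) (tmap (hid (OmegaXlog p)) q) (Atlog e e' lambda) /\
  (unlog (push (Xo p) (tmap (hid (OmegaXlog p)) q) (j_res _ (Atlog e e' lambda))) =
    push (Xo p) (tmap (hid (Omega X)) m) (beta_spec p L) /\
  push (Xo p) (tmap (hid (Omega X)) m) (beta_spec p L) = j_res _ (At (oT X) E)).
Proof.
move=> k q m j_res; have [_ _ smX _] := hX; have [L1 eK e'K _] := hL.
have ss x : oset (oT X) x -> splits (line_conn smX hE hp L1 x).
  by move=> _; apply: line_conn_splits.
have [v [vP hc]] := conn_cocycle_ex L1 (charts_in smX hE hp L1) ss.
have [h1 h2] := At_log_local eK e'K hlambda hc.
split; first exact: (At_log_global eK e'K hlambda hc).
by rewrite h1 h2.
Qed.
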